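(* Let $F = \{(p_n, q_n) : n \geq 1\} \subseteq \mathbb{N} \times \mathbb{N}$, where $(p_n,q_n)_{n \geq 1}$ is a sequence with $p_n \to +\infty$. Let $\Omega \subseteq \mathbb{C}$ be an open set such that $\{\infty\} \cup (\mathbb{C} \setminus \overline{\Omega})$ is connected, and let $\{L_n\}_{n \geq 1}$ be an increasing sequence of compact subsets of $\overline{\Omega}$ such that: (i) $\overline{L_n \cap \Omega} = L_n$ for every $n \geq 1$; (ii) each connected component of $\{\infty\} \cup (\mathbb{C} \setminus L_n)$ contains at least one connected component of $\{\infty\} \cup (\mathbb{C} \setminus \overline{\Omega})$, for every $n \ge 1$; (iii) every compact subset of $\Omega$ is contained in one of the sets $L_n$. Let $K \subseteq \mathbb{C}$ be a compact set with connected complement such that $K \cap L_n = \emptyset$ for every $n \geq 1$, and let $m \geq 1$ be a fixed natural number. Then there exists a function $f \in Y^{\infty}(\Omega)$ such that for every polynomial $P$ there exists a subsequence $(p_{k_n}, q_{k_n})_{n \geq 1}$ of $(p_n, q_n)_{n \geq 1}$ satisfying the following properties: (1) $f \in D_{p_{k_n}, q_{k_n}}(\zeta)$ for every $\zeta \in L_m$ and every $n \geq 1$; (2) for every $l \in \mathbb{N}$, $\sup_{\zeta \in L_m} \sup_{z \in L_m} |[f; p_{k_n}/q_{k_n}]^{(l)}_{\zeta}(z) - f^{(l)}(z)| \to 0$ as $n \to +\infty$; (3) for every $l \in \mathbb{N}$, $\sup_{\zeta \in L_m} \sup_{z \in K} |[f; p_{k_n}/q_{k_n}]_{\zeta}^{(l)}(z)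 - P^{(l)}(z)| \to 0$ as $n \to +\infty$; (4) for every $l \in \mathbb{N}$, $\sup_{\zeta \in L_m} \sup_{z \in L_m} |S^{(l)}_{p_{k_n}}(f, \zeta)(z) - f^{(l)}(z)| \to 0$ as $n \to +\infty$; (5) for every $l \in \mathbb{N}$, $\sup_{\zeta \in L_m} \sup_{z \in K} |S^{(l)}_{p_{k_n}}(f, \zeta)(z) - P^{(l)}(z)| \to 0$ as $n \to +\infty$. Moreover, the set of all functions $f \in Y^{\infty}(\Omega)$ with this property is dense and $G_{\delta}$ in $Y^{\infty}(\Omega)$.
   Context: $\mathbb{N} = \{0,1,2,\dots\}$. ''Connected complement'' means $\mathbb{C} \setminus K$ is connected. Closures are taken in $\mathbb{C}$; sets containing $\infty$ are regarded as subsets of the Riemann sphere. Given $\Omega$ and $\{L_n\}_{n \geq 1}$, $T^{\infty}(\Omega) = T^{\infty}(\Omega, \{L_n\}_{n \geq 1})$ is the space of all holomorphic functions $f$ on $\Omega$ such that for every $l \geq 0$ and every $n \geq 1$ the restriction of $f^{(l)}$ to $L_n \cap \Omega$ is uniformly continuous, and hence extends continuously to $\overline{L_n \cap \Omega} = L_n$; the extension is again denoted $f^{(l)}$. It is a Fréchet space under the seminorms $\sup_{z \in L_n} |f^{(l)}(z)|$, $l \geq 0$, $n \geq 1$. $Y^{\infty}(\Omega)$ is the closure in $T^{\infty}(\Omega)$ of the set of all rational functions with poles off $\bigcup_{n \geq 1} L_n$, with the induced topology. For $\zeta \in \bigcup_n L_n$, the Taylor coefficients of $f$ at $\zeta$ are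 $a_k = f^{(k)}(\zeta)/k!$ (using the continuous extensions if $\zeta \in \partial \Omega$), and $S_N(f,\zeta)(z) = \sum_{k=0}^{N} a_k (z-\zeta)^k$. Padé approximants: put $a_k = 0$ for $k<0$ and let $p,q \in \mathbb{N}$. We write $f \in D_{p,q}(\zeta)$ if the $q \times q$ Hankel determinant $\det (a_{p-q+i+j-1})_{1 \leq i,j \leq q}$ is not $0$ (for $q=0$ this always holds). In this case there are unique polynomials $A, B$ with $\deg A \leq p$, $\deg B \leq q$, $B(\zeta) = 1$ such that the Taylor expansion $\sum_k b_k (z-\zeta)^k$ of $A/B$ at $\zeta$ satisfies $b_k = a_k$ for $k = 0, \dots, p+q$; the rational function $[f;p/q]_{\zeta} = A/B$ is the $(p,q)$-Padé approximant of $f$ with center $\zeta$. At a pole its value is $\infty$, so finiteness of a supremum involving $[f;p/q]_\zeta$ over a set entails that it has no poles there. The superscript $(l)$ denotes the $l$-th derivative with respect to $z$. *)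

(* Defs.v *)
From HB Require Import structures.
From mathcomp Require Import all_boot all_order all_algebra.
From mathcomp Require Import all_classical all_reals all_analysis.
From mathcomp Require Import borel_hierarchy complex.

Set Implicit Arguments.
Unset Strict Implicit.
Unset Printing Implicit Defensive.
Import Order.TTheory GRing.Theory Num.Theory.
Import numFieldNormedType.Exports.

Local Open Scope classical_set_scope.
Local Open Scope ring_scope.

(* The complex plane is R[i] for a realType R, with the topology of its
   modulus; derive1n below is the iterated complex derivative. *)
HB.instance Definition _ (R : rcfType) := GRing.ComAlgebra.copy R[i] R[i]^o.
HB.instance Definition _ (R : rcfType) := Vector.copy R[i] R[i]^o.
HB.instance Definition _ (R : rcfType) := NormedModule.copy R[i] R[i]^o.

Section Definitions.
Context {R : realType}.
Local Notation C := R[i].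

(* Real-valued modulus: `|z| has type R[i]. *)
Definition cabs (z : C) : R := Normc.normc z.

(* Supremum in [0, +oo] of nonnegative quantities; the added 0 makes the
   supremum over the empty set 0 instead of -oo. *)
Definition sup0 (A : set C) (g : C -> \bar R) : \bar R :=
  ereal_sup ([set 0%E] `|` g @` A).

(* {oo} U (C \ A) as a subset of the Riemann sphere. *)
Definition sphere_compl (A : set C) : set (one_point_compactification C) :=
  [set None] `|` Some @` (~` A).

(* Value at z of the continuous extension to the closure of E `&` Omega of the
   restriction of f^(l) to E `&` Omega; E is one of the sets L n. As L is
   increasing, the value does not depend on the n such that L n z. *)
Definition dext (Omega E : set C) (f : C -> C) (l : nat) (z : C) : C :=
  lim (derive1n l f @ within (E `&` Omega) (nbhs z)).

(* A function on Omega is represented by its extension by 0 to the plane. *)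
Record Tinf (Omega : set C) (L : nat -> set C) := MkTinf {
  Tfun :> C -> C ;
  Tfun_out : forall z, ~ Omega z -> Tfun z = 0 ;
  Tfun_holo : forall z, Omega z -> derivable Tfun z 1 ;
  Tfun_unif : forall l n,
    unif_continuous (derive1n l Tfun : subspace (L n `&` Omega) -> C)
}.

Section Topology.
Variables (Omega : set C) (L : nat -> set C).
Local Notation T := (Tinf Omega L).

(* The seminorm sup_{L n} |h^(l)| evaluated at h = f - g. *)
Definition Tdist (n l : nat) (f g : T) : \bar R :=
  sup0 (L n) (fun z =>
    (cabs (dext Omega (L n) f l z - dext Omega (L n) g l z))%:E).

Definition Topen (U : set T) := forall f, U f ->
  exists N : nat, exists2 e : R, 0 < e &
    forall g, (forall n l, (n <= N)%N -> (l <= N)%N -> (Tdist n l g f < e%:E)%E) ->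
      U g.

Lemma TopenT : Topen setT.
Proof. by move=> f _; exists 0%N; exists 1. Qed.

Lemma TopenI : setI_closed Topen.
Proof.
move=> U V oU oV f [/oU[N [e e0 UN]] /oV[M [d d0 VM]]].
exists (maxn N M); exists (Num.min e d); first by rewrite lt_min e0.
move=> g Hg; split.
- apply: UN => n l nN lN; apply: (lt_le_trans (Hg n l _ _)).
  + exact: leq_trans nN (leq_maxl _ _).
  + exact: leq_trans lN (leq_maxl _ _).
  + by rewrite lee_fin ge_min lexx.
- apply: VM => n l nM lM; apply: (lt_le_trans (Hg n l _ _)).
  + exact: leq_trans nM (leq_maxr _ _).
  + exact: leq_trans lM (leq_maxr _ _).
  + by rewrite lee_fin ge_min lexx orbT.
Qed.

Lemma Topen_bigcup (I : Type) (F : I -> set T) :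
  (forall i, Topen (F i)) -> Topen (\bigcup_i F i).
Proof.
move=> oF f [i _ /oF[N [e e0 FN]]]; exists N; exists e => // g /FN Fg.
by exists i.
Qed.

HB.instance Definition _ := gen_eqMixin T.
HB.instance Definition _ := gen_choiceMixin T.
HB.instance Definition _ :=
  isOpenTopological.Build T TopenT TopenI Topen_bigcup.

(* Rational functions with poles off the union of the L n. *)
Definition rationals : set T := [set f | exists A B : {poly C},
  (forall n z, L n z -> B.[z] != 0) /\
  (forall z, Omega z -> f z = A.[z] / B.[z])].

(* As a type, Yinf carries the topology induced by T. *)
Definition Yinf : set T := closure rationals.

End Topology.

Arguments rationals : clear implicits.
Arguments Yinf : clear implicits.

Definition taylor_coef (Omega E : set C) (f : C -> C) (zeta : C) (k : nat) : C :=
  dext Omega E f k zeta / k`!%:R.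

Definition taylor_sum (a : nat -> C) (zeta : C) (N : nat) (z : C) : C :=
  \sum_(k < N.+1) a k * (z - zeta) ^+ k.

Definition coefz (a : nat -> C) (k : int) : C :=
  if k is Posz n then a n else 0.

(* With indices i, j starting at 0, a_{p-q+i+j-1} becomes a_{p-q+i+j+1}. *)
Definition hankel (a : nat -> C) (p q : nat) : 'M[C]_q :=
  \matrix_(i < q, j < q) coefz a (p%:Z - q%:Z + i%:Z + j%:Z + 1).

Definition in_D (a : nat -> C) (p q : nat) : Prop := \det (hankel a p q) != 0.

Definition ratfun (AB : {poly C} * {poly C}) (z : C) : C :=
  AB.1.[z] / AB.2.[z].

Definition is_pade (a : nat -> C) (zeta : C) (p q : nat)
    (AB : {poly C} * {poly C}) : Prop :=
  [/\ (size AB.1 <= p.+1)%N, (size AB.2 <= q.+1)%N, AB.2.[zeta] = 1 &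
    forall k, (k <= p + q)%N -> derive1n k (ratfun AB) zeta / k`!%:R = a k].

(* Meaningful only when in_D a p q, in which case the pair is unique. *)
Definition pade (a : nat -> C) (zeta : C) (p q : nat) : {poly C} * {poly C} :=
  xget (0, 1) [set AB | is_pade a zeta p q AB].

(* |[f;p/q]^(l)(z) - w|, infinite at poles. When in_D a p q, uniqueness of the
   pair (A, B) makes A and B coprime, so the poles are the roots of B. *)
Definition pade_err (a : nat -> C) (zeta : C) (p q l : nat) (z w : C) : \bar R :=
  let AB := pade a zeta p q in
  if AB.2.[z] == 0 then +oo%E
  else (cabs (derive1n l (ratfun AB) z - w))%:E.

Definition pade_universal (Omega : set C) (L : nat -> set C) (p q : nat -> nat)
    (K : set C) (m : nat) : set (Yinf Omega L) :=
  [set f0 : Yinf Omega L |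
    let f : C -> C := set_val f0 in
    let E := L m in
    let a := taylor_coef Omega E f in
    let df := dext Omega E f in
    let S N zeta := taylor_sum (a zeta) zeta N in
    forall P : {poly C}, exists k : nat -> nat,
    [/\ increasing_seq k,
        forall n zeta, E zeta -> in_D (a zeta) (p (k n)) (q (k n)) &
        forall l : nat,
        [/\ (fun n => sup0 E (fun zeta => sup0 E (fun z =>
               pade_err (a zeta) zeta (p (k n)) (q (k n)) l z (df l z))))
              @ \oo --> 0%E,
            (fun n => sup0 E (fun zeta => sup0 K (fun z =>
               pade_err (a zeta) zeta (p (k n)) (q (k n)) l z
                 (derive1n l (horner P) z))))
              @ \oo --> 0%E,
            (fun n => sup0 E (fun zeta => sup0 E (fun z =>
               (cabs (derive1n l (S (p (k n)) zeta) z - df l z))%:E)))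
              @ \oo --> 0%E &
            (fun n => sup0 E (fun zeta => sup0 K (fun z =>
               (cabs (derive1n l (S (p (k n)) zeta) z
                      - derive1n l (horner P) z))%:E)))
              @ \oo --> 0%E]]].

End Definitions.

Arguments rationals {R} Omega L.
Arguments Yinf {R} Omega L.
Arguments pade_universal {R} Omega L p q K m.

(* Main.v *)
(* Approximation up to order N is measured on jets, the expansions of h(z + t) in
   powers of t, for which the truncated norm of coefficients is submultiplicative.
   If X is compact with connected complement, the jets of 1/(w - z), w off X, are
   limits of jets of polynomials, by pushing the pole w to infinity with geometric
   series. A Riemann sum of the Cauchy kernel over the squares of a fine grid that
   lie near L telescopes to a combination of poles off the disjoint union of L and
   K, and is close to 1 on L and to 0 on K. Hence a rational function on L and a
   polynomial P on K have a common polynomial approximation g. Adding to g a small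
   multiple of z^(p n), where p n >= deg g, yields a polynomial h of exact degree
   p n; its Hankel determinants do not vanish, and its (p n, q n)-Pade approximants
   and Taylor sums of order p n, at any centre, are h itself.
   By Cramer's rule the Pade approximants depend continuously on f and zeta, so
   "the errors in (1)-(5), for l <= s and some index n >= s, are < 1/(s + 1)" is an
   open condition on f. Letting P have rational coefficients, the universal
   functions form a G_delta, which is dense by nesting balls around polynomials. *)

Require Import Defs.
From HB Require Import structures.
From mathcomp Require Import all_boot all_order all_algebra.
From mathcomp Require Import all_classical all_reals all_analysis.
From mathcomp Require Import borel_hierarchy complex.
From mathcomp Require Import perm polyrcf ring lra zify.

Set Implicit Arguments.
Unset Strict Implicit.
Unset Printing Implicit Defensive.
Import Order.TTheory GRing.Theory Num.Theory.
Import numFieldNormedType.Exports.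

Local Open Scope classical_set_scope.
Local Open Scope ring_scope.

(** Values on [L n] do not control derivatives up to its boundary, so all orders up to N are
    approximated at once. Jets at a point form an algebra, in which Neumann series and products work
    as they do for functions.

    Poles can be pushed to infinity only past a set without bounded complementary components. That
    the disjoint union of two such sets is again one is a planar fact of Janiszewski type; it is
    obtained mod 2, by a Mayer-Vietoris argument over rectangles.

    The separating function need not be accurate. Its error 1/10 is measured with weight h, the grid
    step, on the variable t, a scale in which the estimates do not depend on h. A polynomial
    iteration then makes the error as small as desired, which pays for the return to weight 1. The
    contour sum around a point is a constant [kappa], a discrete 2 pi i; its lower bound 4 is all
    that is used.

    The category argument is carried out directly, with polynomials as centres of the nested balls,
    so that only limits of polynomials have to be constructed. *)

#[local] Arguments cabs : simpl never.

(** * The modulus and its topology *)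

Section Modulus.
Context {R : realType}.
Local Notation C := R[i].
Implicit Types (z w : C) (e : R).

Lemma cabsM z w : cabs (z * w) = cabs z * cabs w.
Proof. exact: Normc.normcM. Qed.

Lemma cabsV z : cabs z^-1 = (cabs z)^-1.
Proof. exact: Normc.normcV. Qed.

Lemma cabs0 : cabs (0 : C) = 0. Proof. exact: Normc.normc0. Qed.
Lemma cabs1 : cabs (1 : C) = 1. Proof. exact: Normc.normc1. Qed.
Lemma cabsN z : cabs (- z) = cabs z. Proof. exact: normcN. Qed.
Lemma cabsD z w : cabs (z + w) <= cabs z + cabs w.
Proof. exact: le_normcD. Qed.

Lemma cabs_norm z : `|z| = ((cabs z)%:C)%C.
Proof. by []. Qed.

Lemma cabsB z w : cabs (z - w) = cabs (w - z).
Proof. by rewrite -cabsN opprB. Qed.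

Lemma cabs_ge0 z : 0 <= cabs z.
Proof. by case: z => a b; rewrite /cabs /= sqrtr_ge0. Qed.

Lemma cabs_eq0 z : (cabs z == 0) = (z == 0).
Proof.
apply/eqP/eqP => [/Normc.eq0_normc //|->]; exact: cabs0.
Qed.

Lemma cabs_gt0 z : (0 < cabs z) = (z != 0).
Proof. by rewrite lt_def cabs_eq0 cabs_ge0 andbT. Qed.

Lemma cabsX z n : cabs (z ^+ n) = cabs z ^+ n.
Proof. by elim: n => [|n IH]; rewrite ?expr0 ?cabs1 // !exprS cabsM IH. Qed.

Lemma cabs_real (x : R) : cabs ((x%:C)%C : C) = `|x|.
Proof. by rewrite /cabs /= expr0n addr0 sqrtr_sqr. Qed.

Lemma cabs_nat n : cabs (n%:R : C) = n%:R.
Proof. by rewrite -(rmorph_nat (real_complex R)) cabs_real normr_nat. Qed.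

Lemma cabs_triangle z w v : cabs (z - w) <= cabs (z - v) + cabs (v - w).
Proof. by rewrite (_ : z - w = (z - v) + (v - w)) ?cabsD //; ring. Qed.

Lemma cabs_sum (I : Type) (r : seq I) (P : pred I) (F : I -> C) :
  cabs (\sum_(i <- r | P i) F i) <= \sum_(i <- r | P i) cabs (F i).
Proof.
elim/big_rec2: _ => [|i y x _ IH]; first by rewrite cabs0.
by apply: le_trans (cabsD _ _) _; rewrite lerD2l.
Qed.

Lemma cabs_Re z : `|complex.Re z| <= cabs z.
Proof.
case: z => a b; rewrite /cabs /= -sqrtr_sqr ler_sqrt.
  by rewrite lerDl sqr_ge0.
by rewrite addr_ge0 ?sqr_ge0.
Qed.

Lemma cabs_Im z : `|complex.Im z| <= cabs z.
Proof.
case: z => a b; rewrite /cabs /= -sqrtr_sqr ler_sqrt.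
  by rewrite lerDr sqr_ge0.
by rewrite addr_ge0 ?sqr_ge0.
Qed.

Lemma cabs_ReIm z : cabs z <= `|complex.Re z| + `|complex.Im z|.
Proof.
rewrite -[leRHS]ger0_norm ?addr_ge0 // -sqrtr_sqr.
case: z => a b; rewrite /cabs /= ler_sqrt ?sqr_ge0 //.
by rewrite sqrrD !real_normK ?num_real // lerD2r lerDl mulrn_wge0 ?mulr_ge0.
Qed.

Lemma nbhs_cabs z (P : set C) :
  nbhs z P <-> exists2 e, 0 < e & forall w, cabs (w - z) < e -> P w.
Proof.
split.
  move=> /nbhs_ballP[e /= e0 H]; exists (complex.Re e).
    by move: e0; rewrite ltcE /= => /andP[].
  move=> w wz; apply: H; rewrite -ball_normE /= -opprB normrN cabs_norm.
  by move: e0; rewrite !ltcE /= => /andP[/eqP-> _]; rewrite eqxx.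
move=> [e e0 H]; apply/nbhs_ballP; exists (e%:C)%C => /=.
  by rewrite ltcR.
by move=> w; rewrite -ball_normE /= -opprB normrN cabs_norm ltcR; exact: H.
Qed.

Lemma cvg_cabs (T : Type) (F : set_system T) (FF : Filter F) (f : T -> C) (l : C) :
  (f @ F --> l) <-> forall e, 0 < e -> \forall x \near F, cabs (f x - l) < e.
Proof.
split.
  move=> fl e e0; apply: (fl (fun w => cabs (w - l) < e)).
  by apply/nbhs_cabs; exists e.
move=> H A /nbhs_cabs[e e0 He]; rewrite nbhs_simpl /=.
by apply: filterS (H _ e0) => x; exact: He.
Qed.

Lemma open_cabs (U : set C) :
  open U <-> forall z, U z -> exists2 e, 0 < e & forall w, cabs (w - z) < e -> U w.
Proof.
rewrite openE; split => H z /H; first by move/nbhs_cabs.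
by move=> ?; apply/nbhs_cabs.
Qed.

End Modulus.

(** * Compact sets with connected complement *)

Section Topology.
Context {R : realType}.
Local Notation C := R[i].
Implicit Types (X L K U A B : set C) (z w : C).

Lemma compact_cabs_bounded X : compact X ->
  exists2 r : R, 0 < r & forall z, X z -> cabs z < r.
Proof.
move=> /compact_near_coveringP /(_ _ (pinfty_nbhs R) (fun r z => cabs z < r) _).
case=> [z _|r [rr /(_ (Num.max r 0 + 1))]].
  exists ([set w : C | cabs (w - z) < 1], [set r : R | cabs z + 1 < r]).
    split; first by apply/nbhs_cabs; exists 1.
    by exists (cabs z + 1); split => //; rewrite num_real.
  case=> w r /= [wz zr]; apply: lt_trans zr; rewrite -ltrBlDl.
  apply: le_lt_trans wz; rewrite lerBlDl.
  by apply: le_trans (cabsD _ _); rewrite addrC subrK.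
move=> H; exists (Num.max r 0 + 1).
  by rewrite ltr_wpDl // le_max lexx orbT.
by apply: H; rewrite ltr_pwDr // le_max lexx.
Qed.

Lemma compact_closed_dist A B : compact A -> closed B -> A `&` B = set0 ->
  exists2 d : R, 0 < d & forall z w, A z -> B w -> d <= cabs (z - w).
Proof.
move=> /compact_near_coveringP cA cB AB0.
have [z Az|e /= e0 He] := cA _ (0 : R)^'+
    (fun d z => forall w, B w -> d <= cabs (z - w)) _.
  have /open_cabs/(_ z)[|e e0 He] : open (~` B) by exact: closed_openC.
    by move=> Bz; have : (A `&` B) z by []; rewrite AB0.
  exists ([set w : C | cabs (w - z) < e / 2], [set r : R | r < e / 2]).
    split; first by apply/nbhs_cabs; exists (e / 2) => //; rewrite divr_gt0.
    by apply: nbhs_right_lt; rewrite divr_gt0.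
  case=> z' r /= [z'z re] w Bw; rewrite leNgt; apply/negP => z'w.
  apply: (He w) => //; apply: le_lt_trans (cabs_triangle _ _ z') _.
  by rewrite [e]splitr ltrD // cabsB; exact: lt_trans re.
exists (e / 2); first by rewrite divr_gt0.
move=> z w Az Bw; apply: He => //=; last by rewrite divr_gt0.
by rewrite sub0r normrN gtr0_norm ?divr_gt0 // gtr_pMr ?invf_lt1 ?ltr1n.
Qed.

(* For compact X, the complement of X has no bounded component. *)
Definition filled X := forall U, open U -> open (~` X `\` U) -> U `<=` ~` X ->
  (exists r : R, forall z, U z -> cabs z <= r) -> U = set0.

Definition locconst A (f : C -> bool) z :=
  \forall w \near z, A w -> f w = f z.

Definition rect (I J : set R) : set C :=
  [set z | I (complex.Re z) /\ J (complex.Im z)].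

Lemma locconst_interval (I : set R) (g : R -> bool) : is_interval I ->
  (forall x, I x -> \forall y \near x, I y -> g y = g x) ->
  forall x y, I x -> I y -> g x = g y.
Proof.
move=> /connected_intervalP cI lcg x y Ix Iy.
have opn (b : bool) : exists2 D, open D & I `&` [set y | g y = b] = I `&` D.
  exists (interior [set y | I y -> g y = b]); first exact: open_interior.
  apply/seteqP; split => t /= [It].
    move=> gt; split=> //; apply: filterS (lcg t It) => s H Is.
    by rewrite H.
  by move=> /nbhs_singleton H; split=> //; exact: H.
have /seteqP[_ /(_ y Iy)[_ /= <-//]] : I `&` [set y | g y = g x] = I.
apply: cI; [by exists x|exact: opn|].
have [D oD DE] := opn (~~ g x).
exists (~` D); first exact: open_closedC.
apply/seteqP; split => t /= [It] H; split=> //.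
  move=> Dt; have [_ /=] : (I `&` [set y | g y = ~~ g x]) t by rewrite DE.
  by rewrite H; case: (g x).
case: (eqVneq (g t) (g x)) => // gt; case: H.
have [] // : (I `&` D) t; rewrite -DE; split=> //=.
by case: (g t) (g x) gt => [] [].
Qed.

(** One moves horizontally at constant height and then vertically, each time along an interval. *)
Lemma rect_locconst (I J : set R) (f : C -> bool) :
  is_interval I -> is_interval J ->
  (forall z, rect I J z -> locconst (rect I J) f z) ->
  forall z w, rect I J z -> rect I J w -> f z = f w.
Proof.
move=> iI iJ lcf [x y] [x' y'] [/= Ix Jy] [/= Ix' Jy'].
transitivity (f (x' +i* y)%C).
  apply: (@locconst_interval I (fun t => f (t +i* y)%C)) => // t It.
  have /nbhs_cabs[e e0 He] := lcf (t +i* y)%C (conj It Jy).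
  apply/nbhs_ballP; exists e => //= s; rewrite /ball /= distrC => st Is; apply: He => //.
  apply: le_lt_trans (cabs_ReIm _) _ => /=.
  by rewrite subrr normr0 addr0.
apply: (@locconst_interval J (fun t => f (x' +i* t)%C)) => // t It.
have /nbhs_cabs[e e0 He] := lcf (x' +i* t)%C (conj Ix' It).
apply/nbhs_ballP; exists e => //= s; rewrite /ball /= distrC => st Is; apply: He => //.
apply: le_lt_trans (cabs_ReIm _) _ => /=.
by rewrite subrr normr0 add0r.
Qed.

(** A nonempty U that is open and relatively closed is all of the connected complement, which is
    unbounded. *)
Lemma connected_complement_filled X : compact X -> connected (~` X) -> filled X.
Proof.
move=> cX conX U oU oXU UX [r Ur].
apply: contrapT => /eqP/set0P U0.
have XUE : U = ~` X.
  apply: conX => //.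
    by exists U => //; apply/seteqP; split => z //= => [Uz|[]//]; split => //; exact: UX.
  exists (~` (~` X `\` U)); first exact: open_closedC.
  apply/seteqP; split => z /=.
    by move=> Uz; split; [exact: UX|case].
  by move=> [Xz H]; apply: contrapT => Uz; exact: H.
have [s s0 Xs] := compact_cabs_bounded cX.
(* A real point off X and beyond the bound r of U. *)
pose t := Num.max r s + 1.
have cabst : cabs ((t%:C)%C : C) = t.
  by rewrite cabs_real ger0_norm // addr_ge0 // le_max (ltW s0) orbT.
have : U (t%:C)%C.
  rewrite XUE => /Xs; rewrite cabst; apply/negP; rewrite -leNgt.
  by rewrite ler_wpDr // le_max lexx orbT.
move=> /Ur; rewrite cabst; apply/negP; rewrite -ltNge.
by rewrite ltr_pwDr // le_max lexx.
Qed.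

Lemma compact_box (r : R) :
  compact [set z : C | `|complex.Re z| <= r /\ `|complex.Im z| <= r].
Proof.
pose f (t : R * R) : C := (t.1 +i* t.2)%C.
have -> : [set z : C | `|complex.Re z| <= r /\ `|complex.Im z| <= r] =
    f @` (`[- r, r]%classic `*` `[- r, r]%classic).
  apply/seteqP; split => [[x y] /= [xr yr]|_ [[x y] /= [xr yr] <-] /=].
    by exists (x, y) => //=; rewrite !in_itv /= -!ler_norml.
  by move: xr yr; rewrite /= !in_itv /= -!ler_norml.
apply: continuous_compact; last by apply: compact_setX; exact: segment_compact.
apply: continuous_subspaceT => -[x y]; apply/cvg_cabs => e e0.
exists (ball x (e / 2), ball y (e / 2)).
  by split; apply: nbhsx_ballx; rewrite divr_gt0.
case=> x' y' [/= xx' yy']; change (cabs (f (x', y') - f (x, y)) < e).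
apply: le_lt_trans (cabs_ReIm _) _ => /=.
by rewrite [e]splitr ltrD // distrC.
Qed.

(** A bounded relatively clopen piece of the complement remains relatively clopen once infinity is
    added, because a neighbourhood of infinity misses it; if nonempty, it would by connectedness
    contain infinity. *)
Lemma connected_sphere_compl_filled X : compact X -> connected (sphere_compl X) ->
  filled X.
Proof.
move=> cX conX U oU oXU UX [r Ur].
apply: contrapT => /eqP/set0P [u Uu].
pose A := [set z : C | `|complex.Re z| <= r /\ `|complex.Im z| <= r].
have cA : compact A by exact: compact_box.
have clA : closed A by apply: compact_closed cA; exact: norm_hausdorff.
have clX : closed X by apply: compact_closed cX; exact: norm_hausdorff.
have : Some @` U = sphere_compl X.
  apply: conX; first by exists (Some u); exists u.
    exists (Some @` U); first exact: one_point_compactification_open_some.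
    apply/seteqP; split => [_ [z Uz <-]|x []//].
    by split; [right; exists z => //; exact: UX|exists z].
  exists (~` ([set None] `|` Some @` (~` X `\` U))).
    apply: open_closedC; rewrite openE => -[z|].
      case=> // -[w [Xw Uw]] [<-].
      have oS := one_point_compactification_open_some _ oXU.
      by apply: filterS (open_nbhs_nbhs (conj oS (imageP Some (conj Xw Uw)))) => t; right.
    (* Neighbourhoods of infinity are complements of closed compact sets; the box A contains U. *)
    move=> _; exists (A `|` X).
      by split; [exact: compactU|exact: closedU].
    move=> _ [[z /not_orP[Az Xz] <-]|->]; last by left.
    right; exists z => //; split => // Uz; apply: Az.
    by split; [apply: le_trans (cabs_Re _) _|apply: le_trans (cabs_Im _) _]; exact: Ur.
  apply/seteqP; split => x.
    case=> z Uz <-; split; first by right; exists z => //; exact: UX.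
    by case=> // -[w [Xw Uw] [wz]]; apply: Uw; rewrite wz.
  case=> -[->|[z Xz <-]] H; first by case: H; left.
  exists z => //; apply: contrapT => Uz; apply: H; right; exists z => //.
by move=> /seteqP[_ /(_ None)[]]; [left|].
Qed.

(** * Gluing mod 2 over rectangles *)

Section Gluing.
Variables (X : bool -> set C) (U : set C).
Hypothesis oU : open U.
Hypothesis oU' : open (~` (X false `|` X true) `\` U).

(* phi represents a cochain on A whose coboundary is the indicator of U,
   placed on X false. *)
Definition gauge A (phi : C -> bool) := forall (b : bool) z, A z -> ~ X b z ->
  locconst A (fun w => phi w (+) (b && `[< U w >])) z.

Definition gauged A := exists phi, gauge A phi.

Lemma locconst_piece A z : ~ X false z -> ~ X true z ->
  locconst A (fun w => `[< U w >]) z.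
Proof.
move=> X0 X1; case: (pselect (U z)) => Uz.
  move: (open_nbhs_nbhs (conj oU Uz)); apply: filterS => w Uw _.
  by rewrite !asboolT.
have H : (~` (X false `|` X true) `\` U) z by split => // -[].
move: (open_nbhs_nbhs (conj oU' H)); apply: filterS => w [_ Uw] _.
by rewrite !asboolF.
Qed.

(** If A misses [X true] the indicator of U serves, and if it misses [X false] the zero function
    does: at the points of A off the other set, U is locally constant. *)
Lemma gauged_base A (b : bool) : A `&` X b = set0 -> gauged A.
Proof.
move=> AX; have nX z : A z -> ~ X b z.
  by move=> Az Xz; have : (A `&` X b) z by []; rewrite AX.
exists (fun w => b && `[< U w >]) => c z Az Xz.
have {}nX := nX z Az.
case: b c nX Xz {AX} => [] [] nX Xz; rewrite /locconst.
- by apply: (@filterE _ (nbhs z)) => w _; rewrite !addbb.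
- by move: (locconst_piece A Xz nX); apply: filterS => w H /H ->.
- by move: (locconst_piece A nX Xz); apply: filterS => w H /H ->.
- exact: (@filterE _ (nbhs z)).
Qed.

Hypothesis X01 : X false `&` X true = set0.

(** The Mayer-Vietoris step: on the overlap the two gauges differ by a constant bit c, and adding c
    to the second one makes them agree. *)
Lemma gauged_glue A B : closed A -> closed B ->
  (forall f, (forall z, (A `&` B) z -> locconst (A `&` B) f z) ->
    forall z w, (A `&` B) z -> (A `&` B) w -> f z = f w) ->
  gauged A -> gauged B -> gauged (A `|` B).
Proof.
move=> clA clB AB [f gf] [g gg].
have off z : exists b, ~ X b z.
  case: (pselect (X false z)) => X0; last by exists false.
  exists true => X1.
  by have : (X false `&` X true) z by []; rewrite X01.
(* The terms in U cancel in [f (+) g], and every point is off some [X b] because these sets are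
   disjoint. *)
have fg z w : (A `&` B) z -> (A `&` B) w -> f z (+) g z = f w (+) g w.
  apply: (AB (fun z => f z (+) g z)) => {w} {}z [Az Bz].
  have [b Xz] := off z.
  apply: filterS2 (gf b z Az Xz) (gg b z Bz Xz) => w Hf Hg [/Hf + /Hg].
  by case: (f z) (g z) (f w) (g w) (b && _) (b && _) => [] [] [] [] [] [].
have [c fgc] : exists c, forall z, A z -> B z -> g z (+) c = f z.
  case: (pselect (exists z, A z /\ B z)) => [[z [Az Bz]]|nAB].
    exists (f z (+) g z) => w Aw Bw.
    by rewrite (fg z w) // addbC addbK.
  by exists false => z Az Bz; case: nAB; exists z.
pose phi z := if `[< A z >] then f z else g z (+) c.
have phiA z : A z -> phi z = f z by move=> Az; rewrite /phi asboolT.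
have phiB z : B z -> phi z = g z (+) c.
  rewrite /phi; case: asboolP => // Az Bz; by rewrite fgc.
have far (D : set C) z : closed D -> ~ D z -> \forall w \near z, ~ D w.
  by move=> clD Dz; apply: open_nbhs_nbhs; split => //; exact: closed_openC.
exists phi => b z ABz Xz.
case: (pselect (A z)) => Az; last first.
  case: ABz => // Bz.
  apply: filterS2 (far A z clA Az) (gg b z Bz Xz) => w nAw Hg [//|Bw].
  by rewrite !phiB // !(addbAC _ c) Hg.
have HA := gf b z Az Xz.
case: (pselect (B z)) => Bz; last first.
  apply: filterS2 (far B z clB Bz) HA => w nBw Hf [Aw|//].
  by rewrite !phiA // Hf.
apply: filterS2 HA (gg b z Bz Xz) => w Hf Hg [Aw|Bw].
  by rewrite !phiA // Hf.
by rewrite !phiB // !(addbAC _ c) Hg.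
Qed.

Lemma closed_rect (I J : set R) : closed I -> closed J -> closed (rect I J).
Proof.
move=> cI cJ; rewrite -[rect I J]setCK; apply: open_closedC.
have near_coord (D : set R) (h : C -> R) z : closed D ->
    (forall z w, `|h z - h w| <= cabs (z - w)) -> ~ D (h z) ->
    \forall w \near z, ~ D (h w).
  move=> cD hl Dz; have oD : open (~` D) by exact: closed_openC.
  have /nbhs_ballP[e /= e0 He] := open_nbhs_nbhs (conj oD Dz).
  apply/nbhs_cabs; exists e => // w wz; apply: He.
  by rewrite /ball /=; apply: le_lt_trans (hl _ _) _; rewrite cabsB.
rewrite openE => z /not_andP[Iz|Jz].
  have H : \forall w \near z, ~ I (complex.Re w).
    apply: near_coord => // z1 z2.
    by apply: le_trans (cabs_Re _); case: z1 z2 => [? ?] [? ?].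
  by apply: (@filterS _ (nbhs z) _ _ _ _ H) => w Iw [].
have H : \forall w \near z, ~ J (complex.Im w).
  apply: near_coord => // z1 z2.
  by apply: le_trans (cabs_Im _); case: z1 z2 => [? ?] [? ?].
by apply: (@filterS _ (nbhs z) _ _ _ _ H) => w Iw [].
Qed.

(** Two rectangles meet in a rectangle, on which local constancy implies constancy. *)
Lemma gauged_rectU (I1 I2 J1 J2 I J : set R) :
  rect I J = rect I1 J1 `|` rect I2 J2 ->
  closed I1 -> closed I2 -> closed J1 -> closed J2 ->
  is_interval (I1 `&` I2) -> is_interval (J1 `&` J2) ->
  gauged (rect I1 J1) -> gauged (rect I2 J2) -> gauged (rect I J).
Proof.
move=> -> cI1 cI2 cJ1 cJ2 iI iJ g1 g2.
apply: gauged_glue => //; [exact: closed_rect|exact: closed_rect|].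
suff -> : rect I1 J1 `&` rect I2 J2 = rect (I1 `&` I2) (J1 `&` J2).
  by move=> f lcf z w; exact: rect_locconst.
by apply/seteqP; split => z; rewrite /rect /= => -[[? ?] [? ?]].
Qed.

Variables (d r : R).
Hypothesis d0 : 0 < d.
Hypothesis Xd : forall z w, X false z -> X true w -> d *+ 4 <= cabs (z - w).
Hypothesis Xr : forall b z, X b z -> cabs z < r.

(** The diameter is at most 2 d, less than the distance 4 d between the two sets, so one of them is
    missed. *)
Lemma gauged_small (I J : set R) : (forall x y, I x -> I y -> `|x - y| <= d) ->
  (forall x y, J x -> J y -> `|x - y| <= d) -> gauged (rect I J).
Proof.
move=> dI dJ; case: (pselect (exists z, rect I J z /\ X false z)) => H; last first.
  by apply: (gauged_base (b := false)); apply/seteqP; split => // z [Iz Xz]; case: H; exists z.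
apply: (gauged_base (b := true)); apply/seteqP; split => // w [[Iw Jw] Xw].
case: H => z [[Iz Jz] Xz]; have := Xd Xz Xw; apply/negP; rewrite -ltNge.
apply: le_lt_trans (cabs_ReIm _) _.
have -> : complex.Re (z - w) = complex.Re z - complex.Re w by case: z w {Iz Jz Xz Iw Jw Xw} => [? ?] [].
have -> : complex.Im (z - w) = complex.Im z - complex.Im w by case: z w {Iz Jz Xz Iw Jw Xw} => [? ?] [].
have := dI _ _ Iz Iw; have := dJ _ _ Jz Jw; have := d0; rewrite -mulr_natr; lra.
Qed.

Lemma gauged_far (I J : set R) :
  (forall x y, I x -> J y -> r <= `|x| \/ r <= `|y|) -> gauged (rect I J).
Proof.
move=> far; apply: (gauged_base (b := false)); apply/seteqP; split => // z [[Iz Jz] /Xr].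
move=> zr; have [|] := far _ _ Iz Jz; rewrite leNgt => /negP; apply.
  exact: le_lt_trans (cabs_Re _) zr.
exact: le_lt_trans (cabs_Im _) zr.
Qed.

Let le_set (a : R) : set R := [set x | x <= a].
Let ge_set (a : R) : set R := [set x | a <= x].

Lemma archi_steps : exists n, r *+ 2 <= d *+ n.
Proof.
exists (Num.bound `|r *+ 2 / d|).
rewrite -[d *+ _]mulr_natl -ler_pdivrMr //.
apply/ltW; apply: le_lt_trans (ler_norm _) _.
exact: (archi_boundP (normr_ge0 _)).
Qed.

(** Sweep from left to right: a half strip to the left of both sets, then rectangles of width d one
    by one, then a half strip to the right of both sets. *)
Lemma gauged_strip (J : set R) : closed J -> is_interval J ->
  (forall x y, J x -> J y -> `|x - y| <= d) -> gauged (rect setT J).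
Proof.
move=> cJ iJ dJ.
have step n : gauged (rect (le_set (- r + d *+ n)) J).
  elim: n => [|n IH].
    apply: gauged_far => x y; rewrite mulr0n addr0 /le_set /= => xr _; left.
    by rewrite -normrN; apply: le_trans (ler_norm _); rewrite lerNr.
  apply: (@gauged_rectU (le_set (- r + d *+ n))
    (`[- r + d *+ n, - r + d *+ n.+1]) J J) => //.
  - apply/seteqP; split => z; rewrite /rect /le_set /= in_itv /=.
      by move=> [xn Jz]; case: (leP (complex.Re z) (- r + d *+ n)) => H;
         [left|right; split => //; rewrite (ltW H)].
    move=> [[zn Jz]|[/andP[_ zn] Jz]]; split => //.
    by apply: le_trans zn _; rewrite lerD2l mulrS lerDr ltW.
  - exact: itv_closed.
  - by move=> x y [_ +] [+ _] z /andP[xz zy]; rewrite /le_set /= !in_itv /= => 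
     /andP[H _] H2; split; [exact: le_trans H2|rewrite (le_trans H xz)];
     rewrite (le_trans zy) // (le_trans H2) // lerD2l mulrS lerDr ltW.
  - by rewrite setIid.
  - apply: gauged_small => // x y; rewrite /= !in_itv /= mulrS => xx yy.
    by rewrite ler_distl; lra.
have [n rn] := archi_steps.
apply: (@gauged_rectU (le_set (- r + d *+ n)) (ge_set (- r + d *+ n)) J J) => //.
- apply/seteqP; split => z; rewrite /rect /le_set /ge_set /=; last by case => -[].
  by move=> [_ Jz]; case: (leP (complex.Re z) (- r + d *+ n)) => H; [left|right; split => //; exact: ltW].
- move=> x y [_ +] [+ _] z /andP[xz zy]; rewrite /le_set /ge_set /= => H H2.
  by split; [exact: le_trans H2|exact: le_trans xz].
- by rewrite setIid.
- apply: gauged_far => x y; rewrite /ge_set /= => xr _; left.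
  apply: le_trans (ler_norm _); move: rn; rewrite mulr2n; lra.
Qed.

(** The same sweep upwards, with whole strips in place of the small rectangles. *)
Lemma gauged_plane : gauged setT.
Proof.
have step n : gauged (rect setT (le_set (- r + d *+ n))).
  elim: n => [|n IH].
    apply: gauged_far => x y _; rewrite mulr0n addr0 /le_set /= => yr; right.
    by rewrite -normrN; apply: le_trans (ler_norm _); rewrite lerNr.
  apply: (@gauged_rectU setT setT (le_set (- r + d *+ n))
    (`[- r + d *+ n, - r + d *+ n.+1])) => //.
  - apply/seteqP; split => z; rewrite /rect /le_set /= in_itv /=.
      by move=> [_ zn]; case: (leP (complex.Im z) (- r + d *+ n)) => H;
         [left|right; split => //; rewrite (ltW H)].
    move=> [[_ zn]|[_ /andP[_ zn]]]; split => //.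
    by apply: le_trans zn _; rewrite lerD2l mulrS lerDr ltW.
  - exact: itv_closed.
  - by move=> x y [_ +] [+ _] z /andP[xz zy]; rewrite /le_set /= !in_itv /= => 
     /andP[H _] H2; split; [exact: le_trans H2|rewrite (le_trans H xz)];
     rewrite (le_trans zy) // (le_trans H2) // lerD2l mulrS lerDr ltW.
  - apply: gauged_strip.
    + exact: itv_closed.
    + by move=> x y /=; rewrite !in_itv /= => /andP[a b] /andP[c e] z /andP[f g];
        rewrite in_itv /= (le_trans a f) (le_trans g e).
    + move=> x y; rewrite /= !in_itv /= mulrS => xx yy.
      by rewrite ler_distl; lra.
have [n rn] := archi_steps.
have -> : [set: C] = rect setT setT by apply/seteqP; split.
apply: (@gauged_rectU setT setT (le_set (- r + d *+ n)) (ge_set (- r + d *+ n))) => //.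
- apply/seteqP; split => z; rewrite /rect /le_set /ge_set //=.
  by move=> _; case: (leP (complex.Im z) (- r + d *+ n)) => H; [left|right; split => //; exact: ltW].
- move=> x y [_ +] [+ _] z /andP[xz zy]; rewrite /le_set /ge_set /= => H H2.
  by split; [exact: le_trans H2|exact: le_trans xz].
- apply: gauged_far => x y _; rewrite /ge_set /= => xr; right.
  apply: le_trans (ler_norm _); move: rn; rewrite mulr2n; lra.
Qed.

End Gluing.

(* If U is a bounded piece of the complement of L `|` K, a gauge phi of the
   plane is locally constant off L, and phi (+) U is locally constant off K;
   being constant near infinity both are constant, so that U is empty. *)
Lemma filled_setU L K : compact L -> compact K -> L `&` K = set0 ->
  filled L -> filled K -> filled (L `|` K).
Proof.
move=> cL cK LK fL fK U oU oU' UX [s Us].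
pose X (b : bool) := if b then K else L.
have clK : closed K by apply: compact_closed cK; exact: norm_hausdorff.
have [d d0 LKd] := compact_closed_dist cL clK LK.
have [l l0 Ll] := compact_cabs_bounded cL.
have [k k0 Kk] := compact_cabs_bounded cK.
pose r := Num.max s (Num.max l k) + 1.
have Xr b z : X b z -> cabs z < r.
  by case: b => [/Kk|/Ll] zr; apply: (lt_trans zr); rewrite /r;
     rewrite ltr_pwDr // !le_max lexx ?orbT.
have Ur z : U z -> cabs z < r.
  by move=> /Us zs; apply: (le_lt_trans zs); rewrite ltr_pwDr // le_max lexx.
have [phi gphi] : gauged X U setT.
  apply: (@gauged_plane X U oU oU' LK (d / 4) r) => //; first by rewrite divr_gt0.
  by move=> z w Lz Kw; rewrite -[_ *+ 4]mulr_natr divfK //; exact: LKd.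
pose f (b : bool) w := phi w (+) (b && `[< U w >]).
have lcf b z : ~ X b z -> locconst setT (f b) z by exact: gphi.
have clX b : closed (X b) by case: b => //; apply: compact_closed cL; exact: norm_hausdorff.
(* Off [X false] the gauge itself is locally constant: this is the case b = false. *)
have halfplane (I J : set R) : is_interval I -> is_interval J ->
    (forall z, rect I J z -> r <= cabs z) ->
    forall z w, rect I J z -> rect I J w -> phi z = phi w.
  move=> iI iJ far; apply: rect_locconst => // z zIJ.
  have /(lcf false) : ~ X false z.
    by move=> /Xr; apply/negP; rewrite -leNgt far.
  rewrite /locconst => H; apply: filterS H => w H _.
  by have := H Logic.I; rewrite /f /= !addbF.
have le_int a : is_interval [set x : R | x <= a].
  by move=> x y _ /= ya z /andP[_ zy]; exact: le_trans ya.
have ge_int a : is_interval [set x : R | a <= x].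
  by move=> x y /= ax _ z /andP[xz _]; exact: le_trans xz.
have T_int : is_interval [set: R] by [].
have Re_le (z : C) : complex.Re z <= cabs z by apply: le_trans (ler_norm _) (cabs_Re _).
have Im_le (z : C) : complex.Im z <= cabs z by apply: le_trans (ler_norm _) (cabs_Im _).
have ReN_le (z : C) : - complex.Re z <= cabs z.
  by apply: le_trans (cabs_Re _); rewrite -normrN ler_norm.
have ImN_le (z : C) : - complex.Im z <= cabs z.
  by apply: le_trans (cabs_Im _); rewrite -normrN ler_norm.
(* Four half planes at distance r from the origin cover this region. The gauge is constant on each,
   and neighbouring ones share a corner of the square of half side r. *)
have far_const z : r *+ 2 <= cabs z -> phi z = phi (r +i* r)%C.
  move=> zr.
  have r1 w : r <= complex.Re w -> phi w = phi (r +i* r)%C.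
    move=> wr; apply: (halfplane [set x | r <= x] setT) => //.
      by move=> v [/= vr _]; exact: le_trans (Re_le v).
    by split => /=.
  have r2 w : r <= complex.Im w -> phi w = phi (r +i* r)%C.
    move=> wr; apply: (halfplane setT [set x | r <= x]) => //.
      by move=> v [/= _ vr]; exact: le_trans (Im_le v).
    by split => /=.
  have r3 w : complex.Re w <= - r -> phi w = phi (r +i* r)%C.
    move=> wr; transitivity (phi ((- r) +i* r)%C); last by rewrite r2.
    apply: (halfplane [set x | x <= - r] setT) => //.
      by move=> v [/= vr _]; apply: le_trans (ReN_le v); rewrite lerNr.
    by split => /=.
  have r4 w : complex.Im w <= - r -> phi w = phi (r +i* r)%C.
    move=> wr; transitivity (phi (r +i* (- r))%C); last by rewrite r1.
    apply: (halfplane setT [set x | x <= - r]) => //.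
      by move=> v [/= _ vr]; apply: le_trans (ImN_le v); rewrite lerNr.
    by split => /=.
  case: (leP r `|complex.Re z|) => [|Rez].
    by rewrite ler_normr => /orP[/r1 //|]; rewrite lerNr => /r3.
  case: (leP r `|complex.Im z|) => [|Imz].
    by rewrite ler_normr => /orP[/r2 //|]; rewrite lerNr => /r4.
  have := cabs_ReIm z; rewrite leNgt => /negP[]; apply: lt_le_trans zr.
  by rewrite mulr2n ltrD.
have r0 : 0 < r by rewrite ltr_wpDl // !le_max (ltW l0) orbT.
have fX b : filled (X b) by case: b.
(* The points where [f b] differs from its value at infinity form a bounded, relatively clopen
   subset of the complement of [X b]. *)
have const b z : ~ X b z -> f b z = phi (r +i* r)%C.
  move=> Xz; pose V := [set w | ~ X b w /\ f b w <> phi (r +i* r)%C].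
  have oV c : open [set w | ~ X b w /\ f b w = c].
    rewrite openE => w [Xw fw].
    have oX : open (~` X b) by exact: closed_openC.
    have := open_nbhs_nbhs (conj oX Xw).
    rewrite /interior; apply: filterS2 (lcf _ _ Xw) => v H Xv; split => //.
    by rewrite H.
  have VE : V = [set w | ~ X b w /\ f b w = ~~ phi (r +i* r)%C].
    apply/seteqP; split => w [Xw] fw; split => //; first by move: fw; case: (f _ _) (phi _) => [] [].
    by rewrite fw; case: (phi _).
  have V0 : V = set0.
    apply: (fX b); first by rewrite VE; exact: oV.
    - suff -> : ~` X b `\` V = [set w | ~ X b w /\ f b w = phi (r +i* r)%C] by exact: oV.
      apply/seteqP; split => w [Xw]; last by move=> fw; split => // -[].
      by move=> Vw; split => //; apply: contrapT => fw; apply: Vw.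
    - by move=> w [].
    - exists (r *+ 2) => w [Xw fw]; rewrite leNgt; apply/negP => wr; apply: fw.
      rewrite /f asboolF ?andbF ?addbF; first by apply: far_const; exact: ltW.
      move=> /Ur; apply/negP; rewrite -leNgt; apply: le_trans (ltW wr).
      by rewrite mulr2n lerDl ltW.
  by apply: contrapT => fz; have : V z by []; rewrite V0.
apply/seteqP; split => // z Uz; have [nL nK] : ~ L z /\ ~ K z.
  by split => Xz; apply: (UX z Uz); [left|right].
(* On U the functions [f false] and [f true] differ, although both equal the value at infinity. *)
have := const false z nL; rewrite -(const true z nK) /f /= asboolT //.
by case: (phi z).
Qed.

End Topology.

(** * Jets and approximation by polynomials *)

Section Jets.
Context {R : realType}.
Local Notation C := R[i].
Variables (N : nat) (rho : R).
Hypothesis rho0 : 0 < rho.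
Implicit Types (p q : {poly C}) (z w : C) (X : set C) (u s t : C -> {poly C}).

(* The jet of a function at z is its expansion in powers of t = w - z; only the
   coefficients up to order N matter. *)
Definition jet p z : {poly C} := p \Po ('X + z%:P).

(** The weight [rho] is the size allotted to t: the grid step in the discrete Cauchy formula, and 1
    in the final estimates. *)
Definition jnorm p : R := \sum_(l < N.+1) cabs p`_l * rho ^+ l.

Definition jeq p q := forall l, (l <= N)%N -> p`_l = q`_l.

Lemma jnorm_jeq p q : jeq p q -> jnorm p = jnorm q.
Proof. by move=> pq; apply: eq_bigr => l _; rewrite pq // -ltnS. Qed.

Lemma jeqB p q p' q' : jeq p p' -> jeq q q' -> jeq (p - q) (p' - q').
Proof. by move=> pp qq l lN; rewrite !coefB pp // qq. Qed.

Lemma jeqM p q p' q' : jeq p p' -> jeq q q' -> jeq (p * q) (p' * q').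
Proof.
move=> pp qq l lN; rewrite !coefM; apply: eq_bigr => i _.
rewrite pp ?qq //; first exact: leq_trans (leq_subr _ _) lN.
by rewrite (leq_trans _ lN) // -ltnS.
Qed.

Lemma jeq_sym p q : jeq p q -> jeq q p.
Proof. by move=> pq l lN; rewrite pq. Qed.

Lemma jeq_trans q p r : jeq p q -> jeq q r -> jeq p r.
Proof. by move=> pq qr l lN; rewrite pq ?qr. Qed.

Lemma jnorm_ge0 p : 0 <= jnorm p.
Proof. by apply: sumr_ge0 => l _; rewrite mulr_ge0 ?cabs_ge0 ?exprn_ge0 // ltW. Qed.

Lemma jnormD p q : jnorm (p + q) <= jnorm p + jnorm q.
Proof.
rewrite -big_split /=; apply: ler_sum => l _.
by rewrite coefD -mulrDl ler_wpM2r ?cabsD ?exprn_ge0 // ltW.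
Qed.

Lemma jnormN p : jnorm (- p) = jnorm p.
Proof. by apply: eq_bigr => l _; rewrite coefN cabsN. Qed.

Lemma jnormB p q : jnorm (p - q) = jnorm (q - p).
Proof. by rewrite -jnormN opprB. Qed.

Lemma jnorm_triangle r p q : jnorm (p - q) <= jnorm (p - r) + jnorm (r - q).
Proof. by apply: le_trans (jnormD _ _); rewrite (_ : _ + _ = p - q) //; ring. Qed.

Lemma jnorm_sum (I : Type) (r : seq I) (P : pred I) (F : I -> {poly C}) :
  jnorm (\sum_(i <- r | P i) F i) <= \sum_(i <- r | P i) jnorm (F i).
Proof.
elim/big_rec2: _ => [|i y x _ IH].
  by rewrite /jnorm big1 // => l _; rewrite coef0 cabs0 mul0r.
by apply: le_trans (jnormD _ _) _; rewrite lerD2l.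
Qed.

Lemma jnorm_coef p l : (l <= N)%N -> cabs p`_l * rho ^+ l <= jnorm p.
Proof.
move=> lN; rewrite /jnorm (bigD1 (Ordinal (n := N.+1) (m := l) lN)) //= lerDl.
by apply: sumr_ge0 => i _; rewrite mulr_ge0 ?cabs_ge0 ?exprn_ge0 // ltW.
Qed.

Lemma jnormC c : jnorm c%:P = cabs c.
Proof.
rewrite /jnorm big_ord_recl coefC /= expr0 mulr1 big1 ?addr0 // => i _.
by rewrite coefC /bump /= cabs0 mul0r.
Qed.

Lemma jnorm1 : jnorm 1 = 1. Proof. by rewrite jnormC cabs1. Qed.

Lemma jnormX : jnorm 'X <= rho.
Proof.
rewrite /jnorm big_ord_recl coefX /= mulr0n cabs0 mul0r add0r.
case: N => [|n]; first by rewrite big_ord0 ltW.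
rewrite big_ord_recl coefX /bump /= mulr1n cabs1 mul1r expr1 big1 ?addr0 // => i _.
by rewrite coefX /bump /= mulr0n cabs0 mul0r.
Qed.

(** [T p] is the majorant of p, with coefficients of modulus scaled by the weight; its value at 1 is
    the norm. The product of two majorants dominates the majorant of the product, and truncation
    only drops nonnegative terms. *)
Lemma jnormM p q : jnorm (p * q) <= jnorm p * jnorm q.
Proof.
pose T (p : {poly C}) : {poly R} := \poly_(l < N.+1) (cabs p`_l * rho ^+ l).
have TE r : jnorm r = (T r).[1].
  by rewrite horner_poly; apply: eq_bigr => l _; rewrite expr1n mulr1.
have Tge0 r i : 0 <= (T r)`_i.
  by rewrite coef_poly; case: ifP => // _; rewrite mulr_ge0 ?cabs_ge0 ?exprn_ge0 // ltW.
rewrite [X in _ <= X * _]TE [X in _ <= _ * X]TE -hornerM.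
rewrite (@horner_coef_wide _ (maxn N.+1 (size (T p * T q)))) ?leq_maxr //.
have TTge0 i : 0 <= (T p * T q)`_i.
  by rewrite coefM; apply: sumr_ge0 => j _; rewrite mulr_ge0.
apply: (@le_trans _ _ (\sum_(l < N.+1) (T p * T q)`_l)).
  apply: ler_sum => l _; rewrite !coefM.
  apply: le_trans (ler_wpM2r _ (cabs_sum _ _ _)) _; first by rewrite exprn_ge0 // ltW.
  rewrite mulr_suml; apply: ler_sum => i _; rewrite !coef_poly.
  have lN := ltn_ord l; have il := ltn_ord i.
  rewrite (leq_ltn_trans (leq_subr _ _) lN) (leq_trans il lN) cabsM.
  rewrite mulrACA -exprD subnKC //; rewrite -ltnS; exact: il.
set n := maxn _ _; set r := T p * T q.
rewrite -(big_mkord xpredT (fun i => r`_i)).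
rewrite -(big_mkord xpredT (fun i => r`_i * 1 ^+ i)).
rewrite [leRHS](big_cat_nat (leq0n N.+1)) ?leq_maxl //=.
under [X in _ <= X + _]eq_bigr do rewrite expr1n mulr1.
by rewrite lerDl; apply: sumr_ge0 => i _; rewrite expr1n mulr1.
Qed.

Lemma jnormXn p n : jnorm (p ^+ n) <= jnorm p ^+ n.
Proof.
elim: n => [|n IH]; first by rewrite !expr0 jnorm1.
rewrite !exprS; apply: le_trans (jnormM _ _) _.
by rewrite ler_wpM2l ?jnorm_ge0.
Qed.

Lemma jnormZ c p : jnorm (c *: p) <= cabs c * jnorm p.
Proof. by rewrite -mul_polyC; apply: le_trans (jnormM _ _) _; rewrite jnormC. Qed.

Lemma jetD p q z : jet (p + q) z = jet p z + jet q z.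
Proof. exact: comp_polyD. Qed.

Lemma jetM p q z : jet (p * q) z = jet p z * jet q z.
Proof. exact: comp_polyM. Qed.

Lemma jetC c z : jet c%:P z = c%:P. Proof. exact: comp_polyC. Qed.
Lemma jetX z : jet 'X z = 'X + z%:P. Proof. exact: comp_polyX. Qed.

Lemma jnorm_jet_bound p (r : R) :
  exists2 M, 0 < M & forall z, cabs z <= r -> jnorm (jet p z) <= M.
Proof.
elim/poly_ind: p => [|p c [M M0 HM]].
  by exists 1 => // z _; rewrite jetC jnormC cabs0.
exists (M * (rho + `|r|) + cabs c + 1).
  by rewrite ltr_pwDr // addr_ge0 ?cabs_ge0 // mulr_ge0 ?addr_ge0 // ltW.
move=> z zr; rewrite jetD jetM jetX jetC.
apply: le_trans (jnormD _ _) _; rewrite jnormC -addrA lerD //; last first.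
  by rewrite lerDl.
apply: le_trans (jnormM _ _) _; apply: ler_pM; rewrite ?jnorm_ge0 ?HM //.
apply: le_trans (jnormD _ _) _; rewrite jnormC lerD ?jnormX //.
exact: le_trans zr (ler_norm _).
Qed.

(* Truncated expansion of 1/(v - t) in powers of t. *)
Definition pole (v : C) : {poly C} := \poly_(l < N.+1) v^-1 ^+ l.+1.

Lemma coef_pole v l : (l <= N)%N -> (pole v)`_l = v^-1 ^+ l.+1.
Proof. by move=> lN; rewrite coef_poly ltnS lN. Qed.

Lemma poleK v : v != 0 -> jeq ((v%:P - 'X) * pole v) 1.
Proof.
move=> v0 l lN; rewrite mulrBl coefB coefCM coefXM coef_pole // coef1.
case: l lN => [|l] lN; first by rewrite subr0 expr1 mulfV.
by rewrite coef_pole ?(ltnW lN) //= [_ ^+ l.+2]exprS mulrA mulfV // mul1r subrr.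
Qed.

Lemma jnorm_pole_le v d : 0 < d -> d <= cabs v ->
  jnorm (pole v) <= \sum_(l < N.+1) d^-1 ^+ l.+1 * rho ^+ l.
Proof.
move=> d0 dv; apply: ler_sum => l _; rewrite coef_pole; last by rewrite -ltnS.
apply: ler_wpM2r; first by rewrite exprn_ge0 // ltW.
have v0 : 0 < cabs v by apply: lt_le_trans dv.
by rewrite cabsX cabsV lerXn2r ?nnegrE ?invr_ge0 ?(ltW d0) ?(ltW v0) // lef_pV2.
Qed.

(** A geometric series of ratio rho / |v| <= 1/2. *)
Lemma jnorm_pole v : rho *+ 2 <= cabs v -> jnorm (pole v) <= 2 / cabs v.
Proof.
move=> rv; have v0 : 0 < cabs v by apply: lt_le_trans rv; rewrite pmulrn_lgt0.
apply: le_trans (jnorm_pole_le v0 (lexx _)) _.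
apply: (@le_trans _ _ (\sum_(l < N.+1) (cabs v)^-1 * 2^-1 ^+ l)).
  apply: ler_sum => l _; rewrite exprS -mulrA -exprMn ler_wpM2l ?invr_ge0 ?(ltW v0) //.
  rewrite lerXn2r ?nnegrE ?mulr_ge0 ?invr_ge0 ?(ltW v0) ?(ltW rho0) //.
  by rewrite mulrC ler_pdivrMr // mulrC ler_pdivlMr // mulr_natr.
rewrite -mulr_sumr mulrC ler_wpM2r ?invr_ge0 ?(ltW v0) //.
suff -> : \sum_(l < N.+1) 2^-1 ^+ l = 2 - 2^-1 ^+ N :> R.
  by rewrite gerBl exprn_ge0.
elim: N => [|n IH]; first by rewrite big_ord1 !expr0; ring.
by rewrite big_ord_recr /= IH exprS; field.
Qed.

(* 1/v = 1/w + (w - v)/(w v) *)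
Lemma pole_sub v w : v != 0 -> w != 0 ->
  jeq (pole v) (pole w + (w - v) *: (pole w * pole v)).
Proof.
move=> v0 w0.
have H : jeq (pole v * ((w%:P - 'X) * pole w) - pole w * ((v%:P - 'X) * pole v))
   (pole v * 1 - pole w * 1).
  by apply: jeqB; apply: jeqM => //; exact: poleK.
have {H} : jeq ((w - v) *: (pole w * pole v)) (pole v - pole w).
  rewrite (_ : (w - v) *: _ = pole v * ((w%:P - 'X) * pole w) - pole w * ((v%:P - 'X) * pole v)).
    by rewrite -[X in jeq _ (X - _)]mulr1 -[X in jeq _ (_ - X)]mulr1.
  by rewrite -mul_polyC polyCB; ring.
by move=> H l lN; rewrite coefD H // coefB addrC subrK.
Qed.

(** * Families of jets approximable by polynomials *)

Section Approximation.
Variable X : set C.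
Hypothesis cX : compact X.

(** A single polynomial has to match the prescribed jets at all points of X, hence a function
    together with its derivatives up to order N. *)
Definition approx u := forall e : R, 0 < e ->
  exists h, forall z, X z -> jnorm (jet h z - u z) <= e.

Definition jbounded u := exists2 M : R, 0 < M & forall z, X z -> jnorm (u z) <= M.

Lemma jet_bounded h : jbounded (jet h).
Proof.
have [r r0 Xr] := compact_cabs_bounded cX.
have [M M0 HM] := jnorm_jet_bound h r.
by exists M => // z /Xr/ltW; exact: HM.
Qed.

Lemma approx_bounded u : approx u -> jbounded u.
Proof.
move=> /(_ 1 ltr01)[h hu]; have [M M0 HM] := jet_bounded h.
exists (M + 1); first exact: addr_gt0.
move=> z Xz; rewrite -[u z](subKr (jet h z)).
by apply: le_trans (jnormD _ _) _; rewrite jnormN lerD ?HM ?hu.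
Qed.

Lemma approx_jet h : approx (jet h).
Proof. by move=> e e0; exists h => z _; rewrite subrr jnormC cabs0 ltW. Qed.

Lemma approx_lim u :
  (forall e, 0 < e -> exists2 t, approx t & forall z, X z -> jnorm (t z - u z) <= e) ->
  approx u.
Proof.
move=> H e e0; have e2 : 0 < e / 2 by rewrite divr_gt0.
have [t /(_ _ e2)[h ht] tu] := H _ e2.
exists h => z Xz; apply: le_trans (jnorm_triangle (t z) _ _) _.
by rewrite [e]splitr lerD ?ht ?tu.
Qed.

Lemma approx_jeq u t : (forall z, X z -> jeq (u z) (t z)) -> approx u -> approx t.
Proof.
move=> ut au e /au[h hu]; exists h => z Xz; rewrite -(jnorm_jeq (p := jet h z - u z)) ?hu //.
by apply: jeqB => //; exact: ut.
Qed.

Lemma approxD u t : approx u -> approx t -> approx (fun z => u z + t z).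
Proof.
move=> au at_ e e0; have e2 : 0 < e / 2 by rewrite divr_gt0.
have [g gu] := au _ e2; have [h ht] := at_ _ e2.
exists (g + h) => z Xz; rewrite jetD opprD addrACA.
by apply: le_trans (jnormD _ _) _; rewrite [e]splitr lerD ?gu ?ht.
Qed.

Lemma approxM u t : approx u -> approx t -> approx (fun z => u z * t z).
Proof.
move=> au at_ e e0.
have [M M0 HM] := approx_bounded at_.
have [g gu] := au (e / 2 / M) (divr_gt0 (divr_gt0 e0 (ltr0Sn _ _)) M0).
(* The bound P depends on g, so the accuracy required for t is fixed only after g is chosen. *)
have [P P0 HP] := jet_bounded g.
have [h ht] := at_ (e / 2 / P) (divr_gt0 (divr_gt0 e0 (ltr0Sn _ _)) P0).
exists (g * h) => z Xz; rewrite jetM.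
have -> : jet g z * jet h z - u z * t z =
    jet g z * (jet h z - t z) + (jet g z - u z) * t z by ring.
apply: le_trans (jnormD _ _) _; rewrite [e]splitr lerD //;
  apply: le_trans (jnormM _ _) _.
- apply: (@le_trans _ _ (P * (e / 2 / P))); last by rewrite mulrC divfK // gt_eqF.
  by apply: ler_pM; rewrite ?jnorm_ge0 ?HP ?ht.
- apply: (@le_trans _ _ ((e / 2 / M) * M)); last by rewrite divfK // gt_eqF.
  by apply: ler_pM; rewrite ?jnorm_ge0 ?HM ?gu.
Qed.

Lemma approxZ c u : approx u -> approx (fun z => c *: u z).
Proof.
move=> au; have := approxM (approx_jet c%:P) au.
by apply: approx_jeq => z _ l _; rewrite jetC mul_polyC.
Qed.

Lemma approx_sum (I : Type) (r : seq I) (F : I -> C -> {poly C}) :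
  (forall i, approx (F i)) -> approx (fun z => \sum_(i <- r) F i z).
Proof.
move=> aF; elim: r => [|i r IH].
  by apply: approx_jeq (approx_jet 0) => z _ l _; rewrite big_nil jetC.
by apply: approx_jeq (approxD (aF i) IH) => z _ l _; rewrite big_cons.
Qed.

(** Iterating u = s + t u expresses u by an approximable partial sum plus t^n u. Only boundedness of
    u is needed to make this remainder small. *)
Lemma approx_neumann u s t : approx s -> approx t -> jbounded u ->
  (forall z, X z -> jnorm (t z) <= 2^-1) ->
  (forall z, X z -> jeq (u z) (s z + t z * u z)) -> approx u.
Proof.
move=> as_ at_ [M M0 HM] t2 ust.
have partial n : exists2 v, approx v &
    forall z, X z -> jeq (u z) (v z + t z ^+ n * u z).
  elim: n => [|n [v av uv]].
    exists (jet 0); first exact: approx_jet.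
    by move=> z _ l _; rewrite jetC add0r expr0 mul1r.
  exists (fun z => v z * t z + s z); first by apply: approxD => //; exact: approxM.
  move=> z Xz; apply: jeq_trans (ust z Xz) _.
  have H := jeqM (fun l _ => erefl (t z)`_l) (uv z Xz).
  move=> l lN; rewrite coefD H // -coefD.
  have -> // : s z + t z * (v z + t z ^+ n * u z) = v z * t z + s z + t z ^+ n.+1 * u z.
  by rewrite exprS; ring.
apply: approx_lim => e e0.
have [n ne] : exists n, 2^-1 ^+ n * M <= e.
  have [n nM] : exists n, M / e <= 2 ^+ n.
    exists (Num.bound (M / e)); apply/ltW.
    apply: lt_trans (archi_boundP _) _; first by rewrite divr_ge0 ?ltW.
    by rewrite -natrX ltr_nat ltn_expl.
  exists n; rewrite exprVn mulrC ler_pdivrMr ?exprn_gt0 // mulrC.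
  by rewrite -ler_pdivrMr.
have [v av uv] := partial n; exists v => // z Xz.
have -> : jnorm (v z - u z) = jnorm (t z ^+ n * u z).
  rewrite jnormB; apply: jnorm_jeq => l lN.
  by rewrite coefB uv // coefD addrAC subrr add0r.
apply: le_trans (jnormM _ _) _; apply: le_trans ne; apply: ler_pM; rewrite ?jnorm_ge0 ?HM //.
apply: le_trans (jnormXn _ _) _.
by apply: lerXn2r; rewrite ?nnegrE ?jnorm_ge0 ?invr_ge0 ?t2.
Qed.

Lemma pole_bounded w : ~ X w -> jbounded (fun z => pole (w - z)).
Proof.
move=> Xw; have [||d d0 Xd] := @compact_closed_dist _ X [set w] cX.
- by apply: accessible_closed_set1; apply: hausdorff_accessible; exact: norm_hausdorff.
- by apply/seteqP; split => // z [Xz zw]; apply: Xw; rewrite -zw.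
exists (\sum_(l < N.+1) d^-1 ^+ l.+1 * rho ^+ l + 1).
  rewrite ltr_pwDr // sumr_ge0 // => i _.
  by rewrite mulr_ge0 ?exprn_ge0 ?invr_ge0 // ltW.
move=> z Xz; apply: le_trans (jnorm_pole_le d0 _) _; last by rewrite lerDl.
by rewrite cabsB Xd.
Qed.

(** 1/(w - z) solves u = s + t u with s = 1/(v - z) and t = (v - w)/(v - z), which is small when v
    is close to w compared with its distance to X. *)
Lemma approx_pole_step w v d : 0 < d -> (forall z, X z -> d <= cabs (v - z)) ->
  cabs (v - w) * (\sum_(l < N.+1) d^-1 ^+ l.+1 * rho ^+ l) <= 2^-1 -> ~ X w ->
  approx (fun z => pole (v - z)) -> approx (fun z => pole (w - z)).
Proof.
move=> d0 Xd vw Xw av.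
apply: (@approx_neumann _ (fun z => pole (v - z)) (fun z => (v - w) *: pole (v - z))) => //.
- exact: approxZ.
- exact: pole_bounded.
- move=> z Xz; apply: le_trans (jnormZ _ _) _; apply: le_trans vw.
  by rewrite ler_wpM2l ?cabs_ge0 // jnorm_pole_le // Xd.
- move=> z Xz; apply: jeq_trans (pole_sub (w := v - z) _ _) _.
  + by rewrite subr_eq0; apply/eqP => wz; apply: Xw; rewrite wz.
  + by rewrite -cabs_gt0; apply: lt_le_trans (Xd z Xz).
  + by move=> l _; rewrite -scalerAl (_ : v - z - (w - z) = v - w) //; ring.
Qed.

(** 1/(w - z) solves u = 1/w + (z/w) u, where z/w has norm at most 1/2 once |w| is twice the bound M
    on the jets of z. *)
Lemma approx_pole_far : exists2 r : R, 0 < r &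
  forall w, r <= cabs w -> approx (fun z => pole (w - z)).
Proof.
have [r r0 Xr] := compact_cabs_bounded cX.
have [M M0 HM] := jet_bounded 'X.
exists (Num.max r (M *+ 2)); first by rewrite lt_max r0.
move=> w; rewrite ge_max => /andP[rw Mw].
have w0 : 0 < cabs w by apply: lt_le_trans rw.
have Xw : ~ X w by move=> /Xr; rewrite ltNge rw.
apply: (@approx_neumann _ (jet (w^-1)%:P) (jet (w^-1 *: 'X))).
- exact: approx_jet.
- exact: approx_jet.
- exact: pole_bounded.
- move=> z Xz; rewrite -mul_polyC jetM jetC mul_polyC; apply: le_trans (jnormZ _ _) _.
  rewrite cabsV mulrC ler_pdivrMr //.
  by apply: le_trans (HM z Xz) _; rewrite mulrC ler_pdivlMr // mulr_natr.
- move=> z Xz; have wz : w - z != 0 by rewrite subr_eq0; apply/eqP => wz; apply: Xw; rewrite wz.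
  move=> l lN; have := jeqM (poleK wz) (fun l _ => erefl (w^-1)%:P`_l) lN.
  rewrite -mul_polyC jetM !jetC jetX mul1r coefD => <-; rewrite -coefD.
  have ww : w%:P * (w^-1)%:P = 1 :> {poly C} by rewrite -polyCM mulfV // -cabs_gt0.
  rewrite -[pole (w - z) in LHS]mul1r -ww polyCB.
  have -> // : w%:P * w^-1%:P * pole (w - z) =
    (w%:P - z%:P - 'X) * pole (w - z) * w^-1%:P + w^-1%:P * ('X + z%:P) * pole (w - z) by ring.
Qed.

(** The poles off X for which approximation fails form a set that is open and relatively closed, by
    the step between close poles, and bounded, by the case of far poles; so [filled] makes it
    empty. *)
Lemma approx_pole : filled X -> forall w, ~ X w -> approx (fun z => pole (w - z)).
Proof.
move=> fX.
have clX : closed X by apply: compact_closed cX; exact: norm_hausdorff.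
have dist w : ~ X w -> exists2 d : R, 0 < d & forall z, X z -> d *+ 2 <= cabs (w - z).
  move=> Xw; have [||d d0 Xd] := @compact_closed_dist _ X [set w] cX.
  - by apply: accessible_closed_set1; apply: hausdorff_accessible; exact: norm_hausdorff.
  - by apply/seteqP; split => // z [Xz zw]; apply: Xw; rewrite -zw.
  exists (d / 2); first by rewrite divr_gt0.
  by move=> z Xz; rewrite -[_ *+ 2]mulr_natr divfK // cabsB Xd.
have near_pole w : ~ X w -> exists2 e : R, 0 < e & forall v, cabs (v - w) < e ->
    ~ X v /\ (approx (fun z => pole (w - z)) <-> approx (fun z => pole (v - z))).
  move=> Xw; have [d d0 Xd] := dist w Xw.
  set B := \sum_(l < N.+1) d^-1 ^+ l.+1 * rho ^+ l.
  have B0 : 0 < B + 1.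
    by rewrite ltr_wpDl // sumr_ge0 // => l _; rewrite mulr_ge0 ?exprn_ge0 ?invr_ge0 // ltW.
  (* As X is at distance at least 2 d from w, both w and any v within d of it are at distance at
     least d from X, and the step applies in both directions. *)
  exists (Num.min d (2^-1 / (B + 1))).
    by rewrite lt_min d0 divr_gt0 // invr_gt0.
  move=> v; rewrite lt_min => /andP[vd vB].
  have Xdv z : X z -> d <= cabs (v - z).
    move=> Xz; have := Xd z Xz; have := cabs_triangle w z v; rewrite (cabsB w v) mulr2n; lra.
  have Xdw z : X z -> d <= cabs (w - z).
    by move=> Xz; apply: le_trans (Xd z Xz); rewrite mulr2n lerDl ltW.
  have Xv : ~ X v by move=> /Xdv; rewrite subrr cabs0 leNgt d0.
  have vB' : cabs (v - w) * B <= 2^-1.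
    apply: (@le_trans _ _ (cabs (v - w) * (B + 1))); last by rewrite -ler_pdivlMr // ltW.
    by rewrite ler_wpM2l ?cabs_ge0 // lerDl.
  split => //; split; last exact: (approx_pole_step d0).
  by apply: (approx_pole_step d0) => //; rewrite cabsB.
pose U := [set w | ~ X w /\ ~ approx (fun z => pole (w - z))].
have U0 : U = set0.
  apply: fX.
  - apply/open_cabs => w [Xw aw]; have [e e0 He] := near_pole w Xw.
    by exists e => // v /He[Xv av]; split => // /av.
  - apply/open_cabs => w [Xw Uw]; have [e e0 He] := near_pole w Xw.
    exists e => // v /He[Xv av]; split => // -[_ nav]; apply: Uw; split => //.
    by move=> /av.
  - by move=> w [].
  - have [r r0 Hr] := approx_pole_far; exists r => w [_ aw].
    by rewrite leNgt; apply/negP => /ltW/Hr.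
move=> w Xw; apply: contrapT => aw.
by have : U w by []; rewrite U0.
Qed.

End Approximation.

End Jets.

(** * A discrete Cauchy formula *)

Section LatticeSums.
Context {R : realType}.
Implicit Types (f : nat -> R).

Definition dist (i j : nat) : nat := ((i - j) + (j - i))%N.

(** Each distance to j0 occurs at most twice. *)
Lemma ler_sum_dist f n j0 : (j0 < n)%N -> (forall i, 0 <= f i) ->
  \sum_(j < n) f (dist j j0) <= 2 * \sum_(i < n) f i.
Proof.
move=> jn f0; rewrite -(big_mkord xpredT (fun j => f (dist j j0))) /=.
rewrite -(big_mkord xpredT f).
have mono a b : (a <= b)%N -> \sum_(0 <= i < a) f i <= \sum_(0 <= i < b) f i.
  move=> ab; rewrite [leRHS](big_cat_nat (leq0n a) ab) /= lerDl.
  by apply: sumr_ge0 => i _.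
rewrite (big_cat_nat (leq0n j0) (ltnW jn)) /= mulr2n mulrDl !mul1r lerD //.
  rewrite big_nat_rev /= add0n.
  rewrite (eq_big_nat _ _ (F2 := fun i => f i.+1)); last first.
    by move=> i /andP[_ ij]; congr (f _); rewrite /dist; lia.
  apply: le_trans (mono j0.+1 n jn).
  by rewrite big_nat_recl // lerDr.
rewrite -{1}[j0]add0n big_addn.
rewrite (eq_big_nat _ _ (F2 := f)); last first.
  by move=> i /andP[_ ij]; congr (f _); rewrite /dist; lia.
exact: mono (leq_subr _ _).
Qed.

(** One-dimensional weights whose products dominate the fourth-order decay of a square's
    contribution; this splits the lattice sum into two single sums. *)
Definition far_weight (M i : nat) : R := if (M < i)%N then (i%:R ^+ 2)^-1 else 0.
Definition near_weight (i : nat) : R := (1 + i%:R ^+ 2)^-1.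

Lemma far_weight_ge0 M i : 0 <= far_weight M i.
Proof. by rewrite /far_weight; case: ifP => // _; rewrite invr_ge0 exprn_ge0. Qed.

Lemma near_weight_ge0 i : 0 <= near_weight i.
Proof. by rewrite invr_ge0 addr_ge0 ?exprn_ge0. Qed.

(** Telescoping, as 1/i^2 <= 1/(i - 1) - 1/i; the maximum with M in g makes the sum start at 1/M. *)
Lemma sum_far_weight M n : (0 < M)%N -> \sum_(i < n) far_weight M i <= M%:R^-1.
Proof.
move=> M0; pose g i : R := (maxn i.-1 M)%:R^-1.
have g0 i : 0 <= g i by rewrite invr_ge0.
have step i : far_weight M i <= g i - g i.+1.
  rewrite /far_weight /g; case: ifP => Mi; last first.
    by rewrite subr_ge0 lef_pV2 ?posrE ?ltr0n ?ler_nat; lia.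
  have -> : maxn i.-1 M = i.-1 by lia.
  have -> : maxn i.+1.-1 M = i by rewrite /=; lia.
  case: i Mi => // i Mi /=.
  have i0 : 0 < i%:R :> R by rewrite ltr0n; lia.
  rewrite -natr1; move: (i%:R) i0 => x x0.
  have -> : x^-1 - (x + 1)^-1 = (x * (x + 1))^-1.
    by field; rewrite !gt_eqF // addr_gt0.
  rewrite lef_pV2 ?posrE ?exprn_gt0 ?mulr_gt0 ?addr_gt0 //.
  by rewrite expr2 ler_wpM2r ?lerDl // addr_ge0 // ltW.
apply: (@le_trans _ _ (\sum_(i < n) (g i - g i.+1))); first by apply: ler_sum.
rewrite -(big_mkord xpredT (fun i => g i - g i.+1)).
rewrite (eq_bigr (fun i => - (g i.+1 - g i))); last by move=> i _; rewrite opprB.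
rewrite sumrN telescope_sumr // opprB; apply: (@le_trans _ _ (g 0%N)).
  by rewrite gerBl.
by rewrite /g max0n.
Qed.

(** The first two terms give 1 and 1/2, and the others at most 1 by comparison with
    [far_weight 1]. *)
Lemma sum_near_weight n : \sum_(i < n) near_weight i <= 3.
Proof.
(* Two more terms allow the first two to be split off whatever n is. *)
apply: (@le_trans _ _ (\sum_(i < n.+2) near_weight i)).
  rewrite !big_ord_recr /= -addrA lerDl addr_ge0 ?near_weight_ge0 //.
rewrite 2!big_ord_recl /near_weight /=.
have -> : (1 + 0%:R ^+ 2)^-1 = 1 :> R by rewrite expr0n addr0 invr1.
have -> : (1 + 1%:R ^+ 2)^-1 = 2^-1 :> R by rewrite expr1n.
have H : \sum_(i < n) near_weight i.+2 <= 1.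
  apply: (@le_trans _ _ (\sum_(i < n.+2) far_weight 1 i)).
    rewrite 2!big_ord_recl {1 2}/far_weight /= !add0r; apply: ler_sum => i _.
    rewrite /far_weight /near_weight /= /bump /= !add1n /=.
    by rewrite lef_pV2 ?posrE ?lerDr ?addr_gt0 ?exprn_gt0 ?ltr0n.
  by apply: le_trans (sum_far_weight _ _) _ => //; rewrite invr1.
move: H; rewrite /near_weight; lra.
Qed.

Lemma sum_dist_far M n j0 : (j0 < n)%N -> (0 < M)%N ->
  \sum_(j < n) far_weight M (dist j j0) <= 2 / M%:R.
Proof.
move=> jn M0; apply: le_trans (ler_sum_dist jn _) _; first exact: far_weight_ge0.
by rewrite ler_wpM2l // sum_far_weight.
Qed.

Lemma sum_dist_near n j0 : (j0 < n)%N -> \sum_(j < n) near_weight (dist j j0) <= 6.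
Proof.
move=> jn; apply: le_trans (ler_sum_dist jn _) _; first exact: near_weight_ge0.
by rewrite (_ : 6 = 2 * 3 :> R) ?ler_wpM2l ?sum_near_weight //; ring.
Qed.

(** For s > M put x = s^2 >= 1 and y = t^2: then (x + y)^2 >= x (1 + y). The case t > M is
    symmetric. *)
Lemma weight_bound M s t : (M < s)%N || (M < t)%N ->
  ((s%:R ^+ 2 + t%:R ^+ 2) ^+ 2)^-1 <=
  far_weight M s * near_weight t + near_weight s * far_weight M t :> R.
Proof.
have H a b : (M < a)%N ->
    ((a%:R ^+ 2 + b%:R ^+ 2) ^+ 2)^-1 <= far_weight M a * near_weight b :> R.
  move=> Ma; have a1 : 1 <= a%:R :> R by rewrite ler1n; lia.
  have a0 : 0 < a%:R :> R by apply: lt_le_trans a1.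
  have b0 : 0 <= b%:R :> R by [].
  rewrite /far_weight Ma /near_weight -invfM lef_pV2 ?posrE; last first.
  - by rewrite mulr_gt0 ?exprn_gt0 // ltr_pwDl ?exprn_ge0.
  - by rewrite exprn_gt0 // ltr_pwDl ?exprn_ge0 ?exprn_gt0.
  have : 1 <= a%:R ^+ 2 :> R by rewrite exprn_ege1.
  have : 0 <= b%:R ^+ 2 :> R by rewrite exprn_ge0.
  move: (a%:R ^+ 2) (b%:R ^+ 2) => x y y0 x1; nra.
case/orP => Ms; first by rewrite (le_trans (H _ _ Ms)) // lerDl mulr_ge0 ?far_weight_ge0 ?near_weight_ge0.
rewrite addrC (le_trans (H _ _ Ms)) // [leLHS]mulrC lerDr mulr_ge0 ?far_weight_ge0 ?near_weight_ge0 //.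
Qed.

Lemma sum_lattice M n j0 k0 : (0 < M)%N -> (j0 < n)%N -> (k0 < n)%N ->
  \sum_(j < n) \sum_(k < n)
    (far_weight M (dist j j0) * near_weight (dist k k0) +
     near_weight (dist j j0) * far_weight M (dist k k0)) <= 24 / M%:R :> R.
Proof.
move=> M0 jn kn.
under eq_bigr do rewrite big_split -!mulr_sumr.
rewrite big_split -!mulr_suml /=.
have -> : 24 / M%:R = 2 / M%:R * 6 + 6 * (2 / M%:R) :> R.
  by field; rewrite pnatr_eq0 -lt0n.
rewrite lerD // ler_pM ?sum_dist_far ?sum_dist_near ?sumr_ge0 //;
  by move=> i _; rewrite ?far_weight_ge0 ?near_weight_ge0.
Qed.

End LatticeSums.

(** * The contribution of one grid square *)

Section Squares.
Context {R : realType}.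
Local Notation C := R[i].
Variables (N : nat) (h : R).
Hypothesis h0 : 0 < h.

Local Notation P := (pole N).
Local Notation norm := (jnorm N h).
Local Notation jeq := (jeq N).
Let ii : C := (0 +i* 1)%C.
Let hx : C := ((h / 2) +i* 0)%C.
Let hy : C := (0 +i* (h / 2))%C.

(* Midpoint rule for the integral over the sides of the square with centre
   c and side h of dz / (h (z - zeta - t)), where w = c - zeta. *)
Definition square (w : C) : {poly C} :=
  P (w - hy) - P (w + hy) + ii *: P (w + hx) - ii *: P (w - hx).

Let hyE : hy = ii * hx.
Proof. by apply/eqP; rewrite eq_complex /=; apply/andP; split; apply/eqP; ring. Qed.

Let ii2 : ii * ii = -1.
Proof. by apply/eqP; rewrite eq_complex /=; apply/andP; split; apply/eqP; ring. Qed.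

Let cabs_hx : cabs hx = h / 2.
Proof. by rewrite (cabs_real (h / 2)) ger0_norm // divr_ge0 // ltW. Qed.

Let cabs_ii : cabs ii = 1.
Proof. by rewrite /cabs /= expr0n expr1n add0r sqrtr1. Qed.

Let cabs_hy : cabs hy = h / 2.
Proof. by rewrite hyE cabsM cabs_ii mul1r cabs_hx. Qed.

(** With u = w - t the four terms add up to 2 i hx/(u^2 + hx^2) - 2 i hx/(u^2 - hx^2) = -4 i
    hx^3/(u^4 - hx^4). This decay of order four is what makes the sum over a planar lattice of
    squares small. *)
Lemma square_closed_form w : w - hy != 0 -> w + hy != 0 -> w - hx != 0 -> w + hx != 0 ->
  jeq (square w)
    ((- ii * hx ^+ 3 *+ 4) *: (P (w - hy) * P (w + hy) * P (w - hx) * P (w + hx))).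
Proof.
move=> /poleK-/(_ N) H1 /poleK-/(_ N) H2 /poleK-/(_ N) H3 /poleK-/(_ N) H4.
set A1 := (_ - 'X) in H1; set A2 := (_ - 'X) in H2.
set A3 := (_ - 'X) in H3; set A4 := (_ - 'X) in H4.
set P1 := P _ in H1 *; set P2 := P _ in H2 *.
set P3 := P _ in H3 *; set P4 := P _ in H4 *.
(* Each pole is multiplied by the factors [(v - 'X) * P v] of the other three, which are 1 up to
   order N: a common denominator. *)
have E (a b c d : {poly C}) : jeq a 1 -> jeq b 1 -> jeq c 1 -> jeq (d * (a * b * c)) d.
  move=> Ha Hb Hc; apply: jeq_trans (jeqM (fun l _ => erefl d`_l) (jeqM (jeqM Ha Hb) Hc)) _.
  by rewrite !mulr1.
have F1 := jeq_sym (E _ _ _ P1 H2 H3 H4).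
have F2 := jeq_sym (E _ _ _ P2 H1 H3 H4).
have F3 := jeq_sym (E _ _ _ P3 H1 H2 H4).
have F4 := jeq_sym (E _ _ _ P4 H1 H2 H3).
move=> l lN; rewrite /square -/P1 -/P2 -/P3 -/P4.
rewrite coefB coefD coefB !coefZ F1 // F2 // F3 // F4 // -!coefZ -coefB -coefD -coefB.
apply: (congr1 (fun p : {poly C} => p`_l)); rewrite -!mul_polyC /A1 /A2 /A3 /A4 polyCMn.
rewrite polyCM polyC_exp hyE !polyCD !polyCN !polyCM.
have i2 : ii%:P * ii%:P = -1 :> {poly C} by rewrite -polyCM ii2 polyCN.
move: (w%:P) (ii%:P) (hx%:P) i2 => {H1 H2 H3 H4 F1 F2 F3 F4} W I X i2.
ring: i2.
Qed.

(** The side midpoints are at distance h/2 from w, so each pole has norm at most 4/|w|. With 4 hx^3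
    = h^3/2 this gives 4^4/2 = 128. *)
Lemma square_bound w : h *+ 4 <= cabs w ->
  norm (square w) <= 128 * h ^+ 3 / cabs w ^+ 4.
Proof.
move=> hw; have w0 : 0 < cabs w by apply: lt_le_trans hw; rewrite pmulrn_lgt0.
have shift v : cabs v = h / 2 -> cabs w / 2 <= cabs (w + v) /\ h *+ 2 <= cabs (w + v).
  move=> vh; have := cabs_triangle w 0 (- v); rewrite !subr0 opprK cabsN vh.
  move: hw; rewrite -[h *+ 4]mulr_natr -[h *+ 2]mulr_natr; lra.
have shiftP v : cabs v = h / 2 -> w + v != 0 /\ norm (P (w + v)) <= 4 / cabs w.
  move=> /shift[wv hv]; have wv0 : 0 < cabs (w + v) by apply: lt_le_trans wv; rewrite divr_gt0.
  split; first by rewrite -cabs_gt0.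
  apply: le_trans (jnorm_pole _ h0 hv) _.
  by rewrite ler_pdivrMr // mulrAC ler_pdivlMr //; lra.
have [|w1 n1] := shiftP (- hy); first by rewrite cabsN.
have [|w2 n2] := shiftP hy; first by [].
have [|w3 n3] := shiftP (- hx); first by rewrite cabsN.
have [|w4 n4] := shiftP hx; first by [].
rewrite (jnorm_jeq h (square_closed_form w1 w2 w3 w4)).
apply: le_trans (jnormZ _ h0 _ _) _.
have -> : cabs (- ii * hx ^+ 3 *+ 4) = h ^+ 3 / 2.
  by rewrite -mulr_natr cabsM cabs_nat cabsM cabsN cabs_ii cabsX cabs_hx; field.
have -> : 128 * h ^+ 3 / cabs w ^+ 4 = h ^+ 3 / 2 *
   (4 / cabs w * (4 / cabs w) * (4 / cabs w) * (4 / cabs w)).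
  by field; rewrite gt_eqF.
rewrite ler_wpM2l ?divr_ge0 ?exprn_ge0 ?(ltW h0) //.
do 3! (apply: le_trans (jnormM _ h0 _ _) _; apply: ler_pM; rewrite ?jnorm_ge0 //).
Qed.

End Squares.

(** * The sum over a full block of squares *)

Section Block.
Context {R : realType}.
Local Notation C := R[i].
Variables (N : nat) (h : R).
Hypothesis h0 : 0 < h.

Local Notation P := (pole N).
Local Notation norm := (jnorm N h).
Local Notation jeq := (jeq N).
Let ii : C := (0 +i* 1)%C.

(** A side shared by two squares occurs with opposite signs; there remain the bottom and top of the
    block in the first sum, its right and left sides in the second. *)
Lemma sum_squares_telescope m n (w : C) :
  \sum_(j < m) \sum_(k < n) square N h (w + (h * j%:R +i* (h * k%:R))%C) =
  \sum_(j < m) (P (w + (h * j%:R +i* (- (h / 2)))%C) -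
                P (w + (h * j%:R +i* (h * n%:R - h / 2))%C)) +
  ii *: \sum_(k < n) (P (w + ((h * m%:R - h / 2) +i* (h * k%:R))%C) -
                      P (w + ((- (h / 2)) +i* (h * k%:R))%C)).
Proof.
pose G j k := P (w + (h * j%:R +i* (h * k%:R - h / 2))%C).
pose F j k := P (w + ((h * j%:R - h / 2) +i* (h * k%:R))%C).
have squareE (j k : nat) : square N h (w + (h * j%:R +i* (h * k%:R))%C) =
    - (G j k.+1 - G j k) + ii *: (F j.+1 k - F j k).
  rewrite /square opprB scalerBr /G /F -!addrA; congr (_ + (- _ + (ii *: _ - ii *: _))); congr P;
    apply/eqP; rewrite eq_complex /= -?(natr1 _ k) -?(natr1 _ j);
    apply/andP; split; apply/eqP; case: (w) => x y /=; (by field).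
transitivity (\sum_(j < m) (G j 0 - G j n) + ii *: \sum_(k < n) (F m k - F 0 k)).
  rewrite scaler_sumr [X in _ + X](_ : _ = \sum_(k < n) \sum_(j < m) ii *: (F j.+1 k - F j k)); last first.
    apply: eq_bigr => k _; rewrite -scaler_sumr.
    by rewrite -(big_mkord xpredT (fun j => F j.+1 k - F j k)) telescope_sumr.
  rewrite [X in _ = _ + X]exchange_big -big_split /=; apply: eq_bigr => j _.
  under eq_bigr do rewrite squareE.
  rewrite big_split sumrN /=; congr (_ + _).
  by rewrite -(big_mkord xpredT (fun k => G j k.+1 - G j k)) telescope_sumr // opprB.
by congr (_ + ii *: _); apply: eq_bigr => j _; rewrite /G /F !mulr0 !sub0r.
Qed.

(** The difference is (h/v) (t - a)/(a + v - t), with norm at most (1/M) (2 h) (4/(M h)). *)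
Lemma pole_const (M : R) (a v : C) : 4 <= M -> cabs a <= h -> M * h <= cabs v ->
  norm ((h%:C)%C *: P (a + v) - ((h%:C)%C / v)%:P) <= 8 / M ^+ 2.
Proof.
move=> M4 ah Mv.
have M0 : 0 < M by lra.
have v0 : 0 < cabs v by apply: lt_le_trans Mv; rewrite mulr_gt0.
have vn0 : v != 0 by rewrite -cabs_gt0.
have avl : M * h / 2 <= cabs (a + v).
  have := cabs_triangle v 0 (- a); rewrite !subr0 opprK cabsN addrC [v + a]addrC => H.
  have : 4 * h <= M * h by rewrite ler_wpM2r // ltW.
  by lra.
have av2 : h *+ 2 <= cabs (a + v).
  apply: le_trans avl; rewrite -[h *+ 2]mulr_natr.
  have : 4 * h <= M * h by rewrite ler_wpM2r // ltW.
  by lra.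
have av0 : 0 < cabs (a + v) by apply: lt_le_trans av2; rewrite pmulrn_lgt0.
have avn0 : a + v != 0 by rewrite -cabs_gt0.
have H : jeq (((a + v)%:P - 'X) * P (a + v)) 1 by exact: poleK.
set c := (h%:C)%C / v.
have E : jeq ((h%:C)%C *: P (a + v) - c%:P) (c%:P * (('X - a%:P) * P (a + v))).
  have -> : (h%:C)%C *: P (a + v) - c%:P = c%:P * (v%:P * P (a + v) - 1).
    by rewrite mulrBr mulr1 mulrA -polyCM divfK // mul_polyC.
  apply: jeq_trans (jeqM (fun l _ => erefl c%:P`_l)
    (jeqB (fun l _ => erefl _) (jeq_sym H))) _.
  by move=> l _; rewrite polyCD; congr ((_ : {poly C})`_l); ring.
rewrite (jnorm_jeq h E).
have hM : cabs c <= 1 / M.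
  rewrite /c cabsM cabsV cabs_real gtr0_norm // ler_pdivrMr // mul1r [leRHS]mulrC.
  by rewrite ler_pdivlMr // mulrC.
have hP : norm (P (a + v)) <= 4 / (M * h).
  apply: le_trans (jnorm_pole _ h0 av2) _.
  rewrite ler_pdivrMr // [leRHS]mulrAC ler_pdivlMr ?mulr_gt0 //; lra.
have hX : norm ('X - a%:P) <= 2 * h.
  apply: le_trans (jnormD _ h0 _ _) _; rewrite jnormN jnormC.
  have := jnormX N h0; lra.
apply: le_trans (jnormM _ h0 _ _) _; rewrite jnormC.
have -> : 8 / M ^+ 2 = 1 / M * (2 * h * (4 / (M * h))).
  by field; rewrite !gt_eqF.
apply: ler_pM; rewrite ?cabs_ge0 ?jnorm_ge0 //.
by apply: le_trans (jnormM _ h0 _ _) _; apply: ler_pM; rewrite ?jnorm_ge0.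
Qed.

(** The midpoint sum for dz/z over the boundary of a square with half side M + 1/2: a discrete 2 pi
    i. *)
Definition kappa (M : nat) : C := (0 +i* (4 * (M%:R + 2^-1) *
  \sum_(j < M.*2.+1) ((j%:R - M%:R) ^+ 2 + (M%:R + 2^-1) ^+ 2)^-1))%C.

(** With mu = M + 1/2 there are 2 mu terms, each at least 1/(2 mu^2) because |j - M| <= mu. *)
Lemma kappa_ge4 M : 4 <= cabs (kappa M).
Proof.
apply: le_trans (cabs_Im _); apply: le_trans (ler_norm _) => /=.
set mu : R := M%:R + 2^-1.
have mu0 : 0 < mu by rewrite ltr_wpDl.
have muE : M.*2.+1%:R = 2 * mu :> R.
  by rewrite /mu -addn1 -muln2 natrD natrM; field.
apply: (@le_trans _ _ (4 * mu * \sum_(j < M.*2.+1) (2 * mu ^+ 2)^-1)).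
  rewrite sumr_const card_ord -[_^-1 *+ _]mulr_natr muE.
  by rewrite (_ : 4 * mu * _ = 4) //; field; rewrite gt_eqF.
rewrite ler_pM2l ?mulr_gt0 //; apply: ler_sum => j _.
rewrite lef_pV2 ?posrE; last 2 first.
- by rewrite mulr_gt0 ?exprn_gt0.
- by rewrite ltr_wpDl ?sqr_ge0 ?exprn_gt0.
rewrite mulr2n mulrDl mul1r lerD2r -ler_sqrt ?sqr_ge0 // !sqrtr_sqr.
rewrite [`|mu|]gtr0_norm // ler_norml.
have : j%:R <= 2 * mu - 1 :> R.
  by rewrite -muE -natr1 addrK ler_nat -ltnS.
by have : 0 <= j%:R :> R by []; rewrite /mu; lra.
Qed.

(** Contributions of the midpoints at offset s on the bottom, top, right and left sides of the
    block: the real parts cancel. *)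
Lemma reciprocal_sum (s mu : R) : 0 < mu ->
  (h%:C)%C / (h * s +i* (- (h * mu)))%C - (h%:C)%C / (h * s +i* (h * mu))%C +
  ii * ((h%:C)%C / (h * mu +i* (h * s))%C - (h%:C)%C / ((- (h * mu)) +i* (h * s))%C) =
  (0 +i* (4 * mu / (s ^+ 2 + mu ^+ 2)))%C.
Proof.
move=> mu0; have hn0 : h != 0 by rewrite gt_eqF.
have d0 : s ^+ 2 + mu ^+ 2 != 0 by rewrite gt_eqF // ltr_wpDl ?sqr_ge0 ?exprn_gt0.
have d1 : (h * s) ^+ 2 + (h * mu) ^+ 2 != 0 by rewrite !exprMn -mulrDr mulf_neq0 ?expf_neq0.
have inv (x y : R) : ((x +i* y)%C : C)^-1 = ((x / (x ^+ 2 + y ^+ 2)) +i* (- y / (x ^+ 2 + y ^+ 2)))%C.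
  by apply/eqP; rewrite eq_complex /= mulNr !eqxx.
rewrite !inv !sqrrN [(h * mu) ^+ 2 + _]addrC opprK.
apply/eqP; rewrite eq_complex /=; apply/andP; split; apply/eqP.
  by field.
by field; rewrite d0 d1.
Qed.

(** After telescoping, 4 (2 M + 1) <= 12 M boundary poles remain, and replacing each by its constant
    term at the centre costs 8/M^2. *)
Lemma block_sum (M : nat) (a : C) : (4 <= M)%N -> cabs a <= h ->
  norm ((h%:C)%C *: (\sum_(j < M.*2.+1) \sum_(k < M.*2.+1)
      square N h (a + ((- (h * M%:R)) +i* (- (h * M%:R)))%C + (h * j%:R +i* (h * k%:R))%C))
    - (kappa M)%:P) <= 96 / M%:R.
Proof.
move=> M4 ah; set mu : R := M%:R + 2^-1.
have M4R : 4 <= M%:R :> R by rewrite ler_nat.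
have muM : M%:R <= mu by rewrite lerDl.
have mu0 : 0 < mu by lra.
have m2 : M.*2.+1%:R = M%:R * 2 + 1 :> R by rewrite -natr1 -muln2 natrM.
(* Side midpoints on the bottom, top, right and left of the block, relative to its centre. *)
pose v1 j : C := (h * (j%:R - M%:R) +i* (- (h * mu)))%C.
pose v2 j : C := (h * (j%:R - M%:R) +i* (h * mu))%C.
pose v3 j : C := (h * mu +i* (h * (j%:R - M%:R)))%C.
pose v4 j : C := ((- (h * mu)) +i* (h * (j%:R - M%:R)))%C.
pose d v : {poly C} := (h%:C)%C *: P (a + v) - ((h%:C)%C / v)%:P.
have kE : (kappa M)%:P = \sum_(j < M.*2.+1)
   (((h%:C)%C / v1 j)%:P - ((h%:C)%C / v2 j)%:P + ii *: (((h%:C)%C / v3 j)%:P - ((h%:C)%C / v4 j)%:P)).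
  rewrite (eq_bigr (fun j : 'I_(M.*2.+1) => ((0 +i* (4 * mu / ((j%:R - M%:R) ^+ 2 + mu ^+ 2)))%C : C)%:P)); last first.
    by move=> j _; rewrite -mul_polyC -!polyCB -polyCM -polyCD reciprocal_sum.
  rewrite -rmorph_sum; congr _%:P; rewrite /kappa -/mu.
  apply/eqP; rewrite eq_complex !raddf_sum /=.
  by rewrite big1 ?eqxx //= mulr_sumr; apply/eqP; apply: eq_bigr.
have E : (h%:C)%C *: (\sum_(j < M.*2.+1) \sum_(k < M.*2.+1)
      square N h (a + ((- (h * M%:R)) +i* (- (h * M%:R)))%C + (h * j%:R +i* (h * k%:R))%C))
    - (kappa M)%:P = \sum_(j < M.*2.+1) (d (v1 j) - d (v2 j) + ii *: (d (v3 j) - d (v4 j))).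
  rewrite sum_squares_telescope kE scaler_sumr -big_split scaler_sumr -sumrB /=.
  apply: eq_bigr => j _.
  have -> : a + ((- (h * M%:R)) +i* (- (h * M%:R)))%C + (h * j%:R +i* (- (h / 2)))%C = a + v1 j.
    by apply/eqP; rewrite eq_complex /v1 /mu; case: (a) => x y /=; apply/andP; split; apply/eqP; ring.
  have -> : a + ((- (h * M%:R)) +i* (- (h * M%:R)))%C + (h * j%:R +i* (h * M.*2.+1%:R - h / 2))%C = a + v2 j.
    apply/eqP; rewrite eq_complex /v2 /mu m2; case: (a) => x y /=; apply/andP; split; apply/eqP; by field.
  have -> : a + ((- (h * M%:R)) +i* (- (h * M%:R)))%C + ((h * M.*2.+1%:R - h / 2) +i* (h * j%:R))%C = a + v3 j.
    apply/eqP; rewrite eq_complex /v3 /mu m2; case: (a) => x y /=; apply/andP; split; apply/eqP; by field.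
  have -> : a + ((- (h * M%:R)) +i* (- (h * M%:R)))%C + ((- (h / 2)) +i* (h * j%:R))%C = a + v4 j.
    by apply/eqP; rewrite eq_complex /v4 /mu; case: (a) => x y /=; apply/andP; split; apply/eqP; ring.
  by rewrite /d -!mul_polyC; ring.
have dv v : M%:R * h <= cabs v -> norm (d v) <= 8 / M%:R ^+ 2 by exact: pole_const.
have hmu : M%:R * h <= `|h * mu| by rewrite ger0_norm ?mulr_ge0 ?(ltW h0) ?(ltW mu0) // mulrC ler_pM2l.
have cii : cabs ii = 1 by rewrite /cabs /= expr0n expr1n add0r sqrtr1.
rewrite E; apply: le_trans (jnorm_sum _ h0 _ _ _) _.
apply: (@le_trans _ _ (\sum_(j < M.*2.+1) 32 / M%:R ^+ 2)).
  apply: ler_sum => j _; apply: le_trans (jnormD _ h0 _ _) _.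
  have H1 : norm (d (v1 j)) <= 8 / M%:R ^+ 2.
    by apply: dv; apply: le_trans (cabs_Im _); rewrite /= normrN.
  have H2 : norm (d (v2 j)) <= 8 / M%:R ^+ 2.
    by apply: dv; apply: le_trans (cabs_Im _).
  have H3 : norm (d (v3 j)) <= 8 / M%:R ^+ 2.
    by apply: dv; apply: le_trans (cabs_Re _).
  have H4 : norm (d (v4 j)) <= 8 / M%:R ^+ 2.
    by apply: dv; apply: le_trans (cabs_Re _); rewrite /= normrN.
  have := jnormD N h0 (d (v1 j)) (- d (v2 j)); rewrite jnormN.
  have := jnormD N h0 (d (v3 j)) (- d (v4 j)); rewrite jnormN.
  have := jnormZ N h0 ii (d (v3 j) - d (v4 j)); rewrite cii mul1r.
  move: (M%:R ^+ 2)^-1 H1 H2 H3 H4 => x; lra.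
rewrite sumr_const card_ord -[_ / _ *+ _]mulr_natr m2.
rewrite (_ : 96 / M%:R = 32 / M%:R ^+ 2 * (3 * M%:R)); last by field; rewrite gt_eqF //; lra.
rewrite ler_wpM2l ?divr_ge0 ?exprn_ge0 //; lra.
Qed.

End Block.

(** Abel summation: a sum of differences becomes a sum over the indices where the coefficient
    jumps. *)
Lemma summation_by_parts (K : nzRingType) (V : lmodType K) (x : nat -> K)
    (Q : nat -> V) n :
  \sum_(k < n) x k.+1 *: (Q k - Q k.+1) =
  \sum_(k < n) (x k.+1 - x k) *: Q k + x 0 *: Q 0 - x n *: Q n.
Proof.
elim: n => [|n IH]; first by rewrite !big_ord0 add0r subrr.
rewrite !big_ord_recr IH /= scalerBr scalerBl.
rewrite !addrA; congr (_ - _).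
by rewrite addrAC [RHS]addrAC; congr (_ + _); rewrite addrAC.
Qed.

Lemma sum_window (K : nzRingType) (V : lmodType K) (F : nat -> V) n M j0 :
  (M <= j0)%N -> (j0 + M < n)%N ->
  \sum_(j < n) ((dist j j0 <= M)%N)%:R *: F j =
  \sum_(i < M.*2.+1) F (j0 - M + i)%N.
Proof.
move=> Mj jn.
rewrite -(big_mkord xpredT (fun j => ((dist j j0 <= M)%N)%:R *: F j)).
rewrite -(big_mkord xpredT (fun i => F (j0 - M + i)%N)).
have l1 : (j0 - M <= n)%N by lia.
have l2 : (j0 - M <= j0 + M.+1)%N by lia.
have l3 : (j0 + M.+1 <= n)%N by lia.
rewrite (big_cat_nat (leq0n _) l1) (big_cat_nat l2 l3) /=.
rewrite [X in X + _]big_nat_cond big1 => [|j /andP[/andP[_ jj] _]]; last first.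
  by rewrite (_ : (_ <= M)%N = false) ?scale0r //; rewrite /dist; lia.
rewrite [X in _ + (_ + X)]big_nat_cond [X in _ + (_ + X)]big1 => [|j /andP[/andP[jj _] _]]; last first.
  by rewrite (_ : (_ <= M)%N = false) ?scale0r //; rewrite /dist; lia.
rewrite add0r addr0 -{1}[(j0 - M)%N]add0n big_addn.
have -> : (j0 + M.+1 - (j0 - M) = M.*2.+1)%N by lia.
apply: eq_big_nat => i /andP[_ ij].
rewrite (_ : (_ <= M)%N = true) ?scale1r 1?addnC //; rewrite /dist; lia.
Qed.

Section Separation.
Context {R : realType}.
Local Notation C := R[i].
Variables (N : nat) (h : R).
Hypothesis h0 : 0 < h.
Local Notation norm := (jnorm N h).

Definition grid (o : R) (j k : nat) : C := ((o + h * j%:R) +i* (o + h * k%:R))%C.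

(* The coordinates of zeta, in units of h, are within 1/2 of those of (j0,k0). *)
Lemma far_sum (o : R) (n M j0 k0 : nat) (psi : nat -> nat -> bool) (zeta : C) :
  (8 <= M)%N -> (j0 < n)%N -> (k0 < n)%N ->
  `|complex.Re (grid o j0 k0 - zeta)| <= h / 2 ->
  `|complex.Im (grid o j0 k0 - zeta)| <= h / 2 ->
  (forall j k, psi j k -> (M < dist j j0)%N || (M < dist k k0)%N) ->
  norm (\sum_(j < n) \sum_(k < n) (psi j k)%:R *: square N h (grid o j k - zeta))
    <= 128 * 16 * 24 / (M%:R * h).
Proof.
move=> M8 jn kn aRe aIm psifar.
have M0 : (0 < M)%N by lia.
have MR0 : 0 < M%:R :> R by rewrite ltr0n.
pose W j k : R := far_weight M (dist j j0) * near_weight (dist k k0) +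
     near_weight (dist j j0) * far_weight M (dist k k0).
(* A nonzero integer distance is at least 1, so the rounding error h/2 costs at most half of it. *)
have coord (j i : nat) (a : R) : `|a| <= h / 2 ->
    h * (dist j i)%:R / 2 <= `|a + h * (j%:R - i%:R)|.
  move=> ah; have [->|ji] := eqVneq (dist j i) 0%N; first by rewrite mulr0 mul0r.
  have d1 : 1 <= (dist j i)%:R :> R by rewrite ler1n lt0n.
  have dE : (dist j i)%:R = `|j%:R - i%:R| :> R.
    have [ij|/ltnW ij] := leqP i j.
      rewrite (_ : dist j i = (j - i)%N) ?natrB //; last by rewrite /dist; lia.
      by rewrite ger0_norm // subr_ge0 ler_nat.
    rewrite (_ : dist j i = (i - j)%N) ?natrB //; last by rewrite /dist; lia.
    by rewrite ler0_norm ?opprB // subr_le0 ler_nat.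
  have : h * (dist j i)%:R - h / 2 <= `|a + h * (j%:R - i%:R)|.
    have := lerB_dist (h * (j%:R - i%:R)) (- a).
    rewrite normrN opprK normrM (gtr0_norm h0) -dE [_ + a]addrC; lra.
  have : h <= h * (dist j i)%:R by rewrite ler_peMr // ltW.
  lra.
(* The bound 128 h^3/|w|^4 is combined with |w|^2 >= h^2 (s^2 + t^2)/4, whence the factor 16; M >= 8
   guarantees |w| >= 4 h. *)
have termle (j k : nat) : norm ((psi j k)%:R *: square N h (grid o j k - zeta)) <=
    128 * 16 / h * W j k.
  have W0 : 0 <= W j k by rewrite addr_ge0 ?mulr_ge0 ?far_weight_ge0 ?near_weight_ge0.
  case E : (psi j k); last first.
    rewrite scale0r (jnormC _ _ 0) cabs0 mulr_ge0 // divr_ge0 // ltW //.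
  rewrite scale1r; have farjk := psifar j k E.
  set s := dist j j0 in farjk; set t := dist k k0 in farjk.
  set w := grid o j k - zeta.
  have wRe : h * s%:R / 2 <= `|complex.Re w|.
    rewrite (_ : complex.Re w = complex.Re (grid o j0 k0 - zeta) + h * (j%:R - j0%:R)).
      exact: coord.
    by rewrite /w; case: (zeta) => x y /=; ring.
  have wIm : h * t%:R / 2 <= `|complex.Im w|.
    rewrite (_ : complex.Im w = complex.Im (grid o j0 k0 - zeta) + h * (k%:R - k0%:R)).
      exact: coord.
    by rewrite /w; case: (zeta) => x y /=; ring.
  have w4 : h *+ 4 <= cabs w.
    have big q : (M < q)%N -> h *+ 4 <= h * q%:R / 2.
      move=> Mq; rewrite -[h *+ 4]mulr_natr -mulrA ler_pM2l // ler_pdivlMr // -natrM ler_nat; lia.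
    case/orP: farjk => /big Hq.
      by apply: le_trans Hq _; apply: le_trans wRe _; exact: cabs_Re.
    by apply: le_trans Hq _; apply: le_trans wIm _; exact: cabs_Im.
  have w0 : 0 < cabs w by apply: lt_le_trans w4; rewrite pmulrn_lgt0.
  apply: le_trans (square_bound _ h0 w4) _.
  have st0 : 0 < s%:R ^+ 2 + t%:R ^+ 2 :> R.
    case/orP: farjk => q; [rewrite ltr_pwDl ?exprn_ge0 // | rewrite ltr_wpDl ?exprn_ge0 //];
    by rewrite exprn_gt0 // ltr0n; lia.
  have w2 : h ^+ 2 * (s%:R ^+ 2 + t%:R ^+ 2) / 4 <= cabs w ^+ 2.
    have -> : cabs w ^+ 2 = complex.Re w ^+ 2 + complex.Im w ^+ 2.
      by rewrite /cabs; case: (w) => x y /=; rewrite sqr_sqrtr // addr_ge0 ?sqr_ge0.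
    have H1 : (h * s%:R / 2) ^+ 2 <= complex.Re w ^+ 2.
      by rewrite -[leRHS]real_normK ?num_real // lerXn2r ?nnegrE // divr_ge0 ?mulr_ge0 // ltW.
    have H2 : (h * t%:R / 2) ^+ 2 <= complex.Im w ^+ 2.
      by rewrite -[leRHS]real_normK ?num_real // lerXn2r ?nnegrE // divr_ge0 ?mulr_ge0 // ltW.
    apply: le_trans (lerD H1 H2); rewrite le_eqVlt; apply/orP; left; apply/eqP; by field.
  apply: (@le_trans _ _ (128 * 16 / h * ((s%:R ^+ 2 + t%:R ^+ 2) ^+ 2)^-1)); last first.
    by rewrite ler_pM2l ?divr_gt0 //; exact: weight_bound.
  have -> : cabs w ^+ 4 = (cabs w ^+ 2) ^+ 2 by rewrite -exprM.
  have -> : 128 * 16 / h * ((s%:R ^+ 2 + t%:R ^+ 2) ^+ 2)^-1 =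
     128 * h ^+ 3 / (h ^+ 2 * (s%:R ^+ 2 + t%:R ^+ 2) / 4) ^+ 2.
    by field; rewrite !gt_eqF.
  rewrite ler_pM2l ?mulr_gt0 ?exprn_gt0 // lef_pV2 ?posrE ?exprn_gt0 ?divr_gt0 ?mulr_gt0 ?exprn_gt0 //.
  by rewrite lerXn2r ?nnegrE ?exprn_ge0 ?(ltW w0) ?divr_ge0 ?mulr_ge0 ?exprn_ge0 ?(ltW h0) ?(ltW st0).
apply: (@le_trans _ _ (\sum_(j < n) \sum_(k < n) 128 * 16 / h * W j k)).
  apply: le_trans (jnorm_sum _ h0 _ _ _) _; apply: ler_sum => j _.
  by apply: le_trans (jnorm_sum _ h0 _ _ _) _; apply: ler_sum => k _.
under eq_bigr do rewrite -mulr_sumr.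
rewrite -mulr_sumr; have -> : 128 * 16 * 24 / (M%:R * h) = 128 * 16 / h * (24 / M%:R).
  by field; rewrite !gt_eqF.
by rewrite ler_pM2l ?divr_gt0 //; exact: sum_lattice.
Qed.

End Separation.

(** * Sums over selected squares as sums of poles *)

Section Cauchy.
Context {R : realType}.
Local Notation C := R[i].
Variables (N : nat) (h : R) (X : set C).
Hypotheses (h0 : 0 < h) (cX : compact X) (fX : filled X).

(** After summation by parts the pole at [b k] survives only where x jumps, and there it lies off
    X. *)
Lemma approx_parts (x : nat -> C) (b : nat -> C) n : x 0%N = 0 -> x n = 0 ->
  (forall k, (k < n)%N -> x k.+1 != x k -> ~ X (b k)) ->
  approx N h X (fun z => \sum_(k < n) x k.+1 *: (pole N (b k - z) - pole N (b k.+1 - z))).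
Proof.
move=> x0 xn xb.
apply: (@approx_jeq _ _ _ _ (fun z => \sum_(k < n) (x k.+1 - x k) *: pole N (b k - z))).
  move=> z _ l _; rewrite (summation_by_parts x (fun k => pole N (b k - z))).
  by rewrite x0 xn !scale0r addr0 subr0.
apply: (approx_sum h0 _ (F := fun (k : 'I_n) z => (x k.+1 - x k) *: pole N (b k - z))) => k.
have [xx|xx] := eqVneq (x k.+1) (x k).
  apply: (@approx_jeq _ _ _ _ (jet 0)); last exact: approx_jet.
  by move=> z _ l _; rewrite xx subrr scale0r jetC.
by apply: approxZ => //; apply: approx_pole => //; exact: xb.
Qed.

(** Each square is split into its bottom and top poles and its left and right poles. Along every
    column and row, summation by parts leaves only the poles on sides across which [chi] changes. *)
Lemma approx_squares (o : R) n (chi : R -> R -> bool) :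
  (forall y, ~~ chi (o - h) y) -> (forall x, ~~ chi x (o - h)) ->
  (forall y, ~~ chi (o + h * n%:R - h) y) -> (forall x, ~~ chi x (o + h * n%:R - h)) ->
  (forall x y, chi x y != chi x (y - h) -> ~ X (x +i* (y - h / 2))%C) ->
  (forall x y, chi x y != chi (x - h) y -> ~ X ((x - h / 2) +i* y)%C) ->
  approx N h X (fun z => \sum_(j < n) \sum_(k < n)
    (chi (o + h * j%:R) (o + h * k%:R))%:R *: square N h (grid h o j k - z)).
Proof.
move=> c1 c2 c3 c4 cy cx.
(* Shifted by one: [c 0] is the line just before the grid and [c n] its last line, and [chi]
   vanishes on both. *)
pose c (k : nat) : R := o + h * k%:R - h.
have cS k : c k.+1 = o + h * k%:R by rewrite /c -natr1; ring.
have c0 : c 0%N = o - h by rewrite /c mulr0 addr0.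
have cS1 k : c k.+1 - h = c k by rewrite cS.
pose B x (k : nat) : C := (x +i* (c k + h / 2))%C.
pose A y (j : nat) : C := ((c j + h / 2) +i* y)%C.
have V x : approx N h X (fun z => \sum_(k < n) (chi x (c k.+1))%:R *:
    (pole N (B x k - z) - pole N (B x k.+1 - z))).
  apply: (approx_parts (x := fun k => (chi x (c k))%:R)).
  - by rewrite c0 (negbTE (c2 x)).
  - by rewrite (negbTE (c4 x)).
  - move=> k kn H; rewrite /B.
    rewrite (_ : c k + h / 2 = c k.+1 - h / 2); last by rewrite -cS1; field.
    by apply: cy; rewrite cS1; apply: contra H => /eqP ->.
have H y : approx N h X (fun z => \sum_(j < n) (chi (c j.+1) y)%:R *:
    (pole N (A y j - z) - pole N (A y j.+1 - z))).
  apply: (approx_parts (x := fun k => (chi (c k) y)%:R)).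
  - by rewrite c0 (negbTE (c1 y)).
  - by rewrite (negbTE (c3 y)).
  - move=> k kn H; rewrite /A.
    rewrite (_ : c k + h / 2 = c k.+1 - h / 2); last by rewrite -cS1; field.
    by apply: cx; rewrite cS1; apply: contra H => /eqP ->.
have V' := approx_sum h0 (index_enum 'I_n) (fun j => V (c j.+1)).
have H' := approx_sum h0 (index_enum 'I_n) (fun k => H (c k.+1)).
apply: approx_jeq _ (approxD h0 V' (approxZ h0 cX (- (0 +i* 1)%C) H')).
move=> z _ l _ /=; apply: (congr1 (fun p : {poly C} => p`_l)).
rewrite [X in _ + _ *: X]exchange_big scaler_sumr -big_split /=; apply: eq_bigr => j _.
rewrite scaler_sumr -big_split /=; apply: eq_bigr => k _.
rewrite !cS [- _ *: _]scalerA [- _ * _]mulrC -scalerA -scalerDr; congr (_ *: _).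
rewrite /square /A /B /grid scaleNr -scalerN opprB scalerBr addrA.
congr (pole N _ - pole N _ + _ *: pole N _ - _ *: pole N _).
all: apply/eqP; rewrite eq_complex; case: z => x y /=; apply/andP; split; apply/eqP; rewrite ?cS /c; by field.
Qed.

End Cauchy.

(** * Rough separation of L from K *)

Section Separation.
Context {R : realType}.
Local Notation C := R[i].
Variables (L K : set C) (N : nat).
Hypotheses (cL : compact L) (cK : compact K) (LK : L `&` K = set0).
Hypotheses (fL : filled L) (fK : filled K).

Lemma nearest_index (h y : R) : 0 < h -> 0 <= y ->
  exists2 j : nat, `|h * j%:R - y| <= h / 2 & y / h - 2^-1 <= j%:R <= y / h + 2^-1.
Proof.
move=> h0 y0; have yh : 0 <= y / h + 2^-1 by rewrite addr_ge0 ?divr_ge0 // ltW.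
have /andP[l1] := Num.Theory.truncn_itv yh.
rewrite -(natr1 (Num.truncn _)) => l2; exists (Num.truncn (y / h + 2^-1)).
  move: l2 l1; set j := (Num.truncn _)%:R => l2 l1.
  have -> : h * j - y = h * (j - y / h) by field; rewrite gt_eqF.
  rewrite normrM gtr0_norm // ler_pM2l // ler_norml; lra.
rewrite l1 andbT; lra.
Qed.

(* The grid, and the squares lying near L, are chosen so that the squares
   around a point of L form a full block, while those around a point of K
   are all far away. *)
Lemma rough_separation : exists2 h : R, 0 < h & exists e : {poly C},
  (forall z, L z -> jnorm N h (jet e z - 1) <= 10^-1) /\
  (forall z, K z -> jnorm N h (jet e z) <= 10^-1).
Proof.
have clK : closed K by apply: compact_closed cK; exact: norm_hausdorff.
have [D D0 LKD] := compact_closed_dist cL clK LK.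
have [rL rL0 HL] := compact_cabs_bounded cL.
have [rK rK0 HK] := compact_cabs_bounded cK.
pose r := Num.max rL rK.
have r0 : 0 < r by rewrite lt_max rL0.
have rL' z : L z -> cabs z < r by move=> /HL zr; rewrite lt_max zr.
have rK' z : K z -> cabs z < r by move=> /HK zr; rewrite lt_max zr orbT.
(* M is taken so large that the errors 96/M of the block and 128 * 16 * 24/M of the far squares add
   up to at most 1/10. *)
pose bound : R := 10 * (96 + 128 * 16 * 24).
pose M := maxn 8 (Num.bound bound).
have M8 : (8 <= M)%N by exact: leq_maxl.
have MR : bound <= M%:R.
  apply/ltW; apply: lt_le_trans (archi_boundP _) _; last by rewrite ler_nat leq_maxr.
  by rewrite /bound mulr_ge0 ?addr_ge0 ?mulr_ge0.
clearbody M.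
have M0 : 0 < M%:R :> R by rewrite ltr0n; lia.
pose d := D / 4.
have d0 : 0 < d by rewrite divr_gt0.
(* With this step the whole block around a point lies within d of that point. *)
pose h := d / (4 * (M%:R + 2)).
have h0 : 0 < h by rewrite divr_gt0 // mulr_gt0 // addr_gt0.
have hd : h * (M%:R + 2) = d / 4.
  by rewrite /h; field; rewrite gt_eqF // addr_gt0.
have hM : h * M%:R = d / 4 - 2 * h by move: hd; rewrite mulrDr; lra.
have hMge : 0 < h * M%:R by rewrite mulr_gt0.
(* The margin 2 d makes the selection empty at the rim and leaves room for blocks around all points
   of L and K. *)
pose r' := r + d *+ 2.
have r'0 : 0 < r' by rewrite addr_gt0 // pmulrn_lgt0.
pose n := Num.bound (r' *+ 2 / h).
have nh : r' *+ 2 < h * n%:R.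
  rewrite mulrC -ltr_pdivrMr //; apply: archi_boundP.
  by rewrite divr_ge0 ?mulrn_wge0 // ltW.
clearbody n.
pose o := - r'.
(* Selected are the squares with centre within d of L, where d is a quarter of the distance D to
   K. *)
pose chi x y := `[< exists2 z, L z & cabs ((x +i* y)%C - z) <= d >].
have chiRe x y : r + d <= `|x| -> ~~ chi x y.
  move=> xr; apply/asboolP => -[z Lz zd].
  have := cabs_Re ((x +i* y)%C - z); case: z Lz zd => a b Lz zd /= H.
  have := rL' _ Lz; have := cabs_Re (a +i* b)%C => /=.
  have := lerB_dist x a; lra.
have chiIm x y : r + d <= `|y| -> ~~ chi x y.
  move=> xr; apply/asboolP => -[z Lz zd].
  have := cabs_Im ((x +i* y)%C - z); case: z Lz zd => a b Lz zd /= H.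
  have := rL' _ Lz; have := cabs_Im (a +i* b)%C => /=.
  have := lerB_dist y b; lra.
(* Both squares sharing a side have their centres within h of its midpoint w. If w is on L both are
   selected, if w is on K neither is; so the selection changes only across sides with midpoint off
   both sets. *)
have edge_ends w c : cabs (w - c) <= h -> (L `|` K) w ->
    chi (complex.Re c) (complex.Im c) = `[< L w >].
  move=> wc; have -> : chi (complex.Re c) (complex.Im c) = `[< exists2 z, L z & cabs (c - z) <= d >].
    by case: (c).
  case=> [Lw|Kw].
    rewrite !asboolT //; exists w => //; rewrite cabsB; lra.
  rewrite !asboolF //; first by move=> Lw; have : (L `&` K) w by []; rewrite LK.
  case=> z Lz cz; have := LKD _ _ Lz Kw; have := cabs_triangle z w c.
  rewrite (cabsB z c) (cabsB c w) -[D](@divfK _ 4) // -/d; lra.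
pose X := L `|` K.
have cX : compact X by exact: compactU.
have fX : filled X by exact: filled_setU.
pose S z : {poly C} := \sum_(j < n) \sum_(k < n)
    (chi (o + h * j%:R) (o + h * k%:R))%:R *: square N h (grid h o j k - z).
have aS : approx N h X S.
  apply: approx_squares => //.
  - by move=> y; apply: chiRe; rewrite ler0_norm /o /r' mulr2n; lra.
  - by move=> y; apply: chiIm; rewrite ler0_norm /o /r' mulr2n; lra.
  - by move=> y; apply: chiRe; rewrite ger0_norm /o; move: nh; rewrite /r' !mulr2n; lra.
  - by move=> y; apply: chiIm; rewrite ger0_norm /o; move: nh; rewrite /r' !mulr2n; lra.
  - move=> x y /eqP H Xw; apply: H.
    have := edge_ends (x +i* (y - h / 2))%C (x +i* y)%C _ Xw.
    have := edge_ends (x +i* (y - h / 2))%C (x +i* (y - h))%C _ Xw => /= -> => [->//|].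
      apply: le_trans (cabs_ReIm _) _ => /=.
      rewrite subrr normr0 add0r (_ : y - h / 2 - y = - (h / 2)); last by ring.
      rewrite normrN ger0_norm; lra.
    apply: le_trans (cabs_ReIm _) _ => /=.
    rewrite subrr normr0 add0r (_ : y - h / 2 - (y - h) = h / 2); last by field.
    rewrite ger0_norm; lra.
  - move=> x y /eqP H Xw; apply: H.
    have := edge_ends ((x - h / 2) +i* y)%C (x +i* y)%C _ Xw.
    have := edge_ends ((x - h / 2) +i* y)%C ((x - h) +i* y)%C _ Xw => /= -> => [->//|].
      apply: le_trans (cabs_ReIm _) _ => /=.
      rewrite subrr normr0 addr0 (_ : x - h / 2 - x = - (h / 2)); last by ring.
      rewrite normrN ger0_norm; lra.
    apply: le_trans (cabs_ReIm _) _ => /=.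
    rewrite subrr normr0 addr0 (_ : x - h / 2 - (x - h) = h / 2); last by field.
    rewrite ger0_norm; lra.
have idx t : `|t| < r -> exists j0 : nat,
    [/\ `|o + h * j0%:R - t| <= h / 2, (M <= j0)%N & (j0 + M < n)%N].
  rewrite ltr_norml => /andP[t1 t2].
  have [|j0 j1 /andP[j2 j3]] := @nearest_index h (t + r') h0.
    by rewrite /r' [d *+ 2]mulr2n; lra.
  exists j0; split.
  - by rewrite (_ : o + h * j0%:R - t = h * j0%:R - (t + r')) // /o; ring.
  - rewrite -(ler_nat R); apply: le_trans j2.
    rewrite lerBrDr ler_pdivlMr // mulrDl mulrC hM /r' [d *+ 2]mulr2n; lra.
  - rewrite -(ltr_nat R) natrD -(ltr_pM2l h0); apply: le_lt_trans nh.
    have : h * j0%:R <= t + r' + h / 2.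
      apply: (@le_trans _ _ (h * ((t + r') / h + 2^-1))); first by rewrite ler_pM2l.
      by rewrite le_eqVlt; apply/orP; left; apply/eqP; field; rewrite gt_eqF.
    by rewrite mulrDr hM /r' [(_ + _) *+ 2]mulr2n [d *+ 2]mulr2n; lra.
have idx2 z : cabs z < r -> exists j0 k0 : nat, [/\ (M <= j0)%N, (j0 + M < n)%N,
    (M <= k0)%N, (k0 + M < n)%N & `|complex.Re (grid h o j0 k0 - z)| <= h / 2 /\
    `|complex.Im (grid h o j0 k0 - z)| <= h / 2].
  move=> zr; have [j0 [j1 j2 j3]] := idx _ (le_lt_trans (cabs_Re z) zr).
  have [k0 [k1 k2 k3]] := idx _ (le_lt_trans (cabs_Im z) zr).
  by exists j0, k0; split => //; move: j1 k1; case: (z).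
pose near j k j0 k0 := (dist j j0 <= M)%N && (dist k k0 <= M)%N.
have nearP z j k j0 k0 : `|complex.Re (grid h o j0 k0 - z)| <= h / 2 ->
    `|complex.Im (grid h o j0 k0 - z)| <= h / 2 -> near j k j0 k0 ->
    cabs (grid h o j k - z) <= d.
  move=> a1 a2 /andP[jj kk]; apply: le_trans (cabs_ReIm _) _.
  have step (i i0 : nat) (a : R) : `|a| <= h / 2 -> (dist i i0 <= M)%N ->
      `|a + h * (i%:R - i0%:R)| <= d / 2.
    move=> ah ii; apply: le_trans (ler_normD _ _) _.
    have : h * `|i%:R - i0%:R| <= h * M%:R.
      have u1 : (i <= M + i0)%N by move: ii; rewrite /dist; clear; lia.
      have u2 : (i0 <= M + i)%N by move: ii; rewrite /dist; clear; lia.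
      move: u1 u2; rewrite -!(ler_nat R) !natrD ler_pM2l // ler_norml => u1 u2.
      by apply/andP; split; lra.
    rewrite normrM (gtr0_norm h0); lra.
  have -> : complex.Re (grid h o j k - z) = complex.Re (grid h o j0 k0 - z) + h * (j%:R - j0%:R).
    by case: (z) => x y /=; ring.
  have -> : complex.Im (grid h o j k - z) = complex.Im (grid h o j0 k0 - z) + h * (k%:R - k0%:R).
    by case: (z) => x y /=; ring.
  have := step _ _ _ a1 jj; have := step _ _ _ a2 kk; lra.
have nfar j k j0 k0 : ~~ near j k j0 k0 -> (M < dist j j0)%N || (M < dist k k0)%N.
  by rewrite negb_and -!ltnNge.
have k4 := kappa_ge4 (R := R) M.
have k0 : kappa M != 0 :> C by rewrite -cabs_gt0; apply: lt_le_trans k4.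
have errM : (96 + 128 * 16 * 24) / M%:R <= 10^-1 :> R.
  by rewrite ler_pdivrMr //; move: MR; rewrite /bound; lra.
(* Near L the block sum makes h S close to [kappa], so this factor normalises S to 1. *)
pose g : C := (h%:C)%C / kappa M.
have aE : approx N h X (fun z => g *: S z) by exact: approxZ.
(* 1/20 for the approximation; the rest costs 1/40, which is 1/10 divided by |kappa| >= 4. *)
have [|e He] := aE (20^-1); first by rewrite invr_gt0.
exists h => //; exists e; split => z Xz.
  have zr := rL' z Xz; have [j0 [k1 [j1 j2 k2 k3 [aR aI]]]] := idx2 z zr.
  apply: le_trans (jnorm_triangle _ h0 (g *: S z) _ _) _.
  suff : jnorm N h (g *: S z - 1) <= 40^-1.
    have := He z (or_introl Xz); lra.
  set a := grid h o j0 k1 - z.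
  have ah : cabs a <= h by apply: le_trans (cabs_ReIm _) _; lra.
  (* The selected squares outside the block around z; those of the block are all selected. *)
  pose far := \sum_(j < n) \sum_(k < n)
    (chi (o + h * j%:R) (o + h * k%:R) && ~~ near j k j0 k1)%:R *: square N h (grid h o j k - z).
  pose blk := \sum_(j < M.*2.+1) \sum_(k < M.*2.+1)
      square N h (a + ((- (h * M%:R)) +i* (- (h * M%:R)))%C + (h * j%:R +i* (h * k%:R))%C).
  have SE : S z = blk + far.
    have -> : blk = \sum_(j < n) \sum_(k < n) (near j k j0 k1)%:R *: square N h (grid h o j k - z).
      transitivity (\sum_(j < n) (dist j j0 <= M)%N%:R *: (\sum_(k < n) (dist k k1 <= M)%N%:R *: square N h (grid h o j k - z))).
        rewrite (sum_window (fun j => \sum_(k < n) (dist k k1 <= M)%N%:R *: square N h (grid h o j k - z))) //.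
        apply: eq_bigr => j _.
        rewrite (sum_window (fun k => square N h (grid h o (j0 - M + j) k - z))) //.
        apply: eq_bigr => k _; congr square; rewrite /a /grid !natrD !natrB //.
        by apply/eqP; rewrite eq_complex; case: (z) => x y /=; apply/andP; split; apply/eqP; ring.
      apply: eq_bigr => j _; rewrite scaler_sumr; apply: eq_bigr => k _.
      by rewrite scalerA -natrM mulnb.
    rewrite /S /far -big_split; apply: eq_bigr => j _; rewrite -big_split; apply: eq_bigr => k _ /=.
    rewrite -scalerDl; congr (_ *: _).
    case E: (near j k j0 k1); last by rewrite andbT add0r.
    rewrite andbF addr0; congr (_%:R); rewrite /chi asboolT //.
    by exists z => //; exact: nearP E.
  have -> : g *: S z - 1 = (kappa M)^-1 *: (((h%:C)%C *: blk - (kappa M)%:P) + (h%:C)%C *: far).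
    rewrite SE /g scalerDr scalerDr scalerBr !scalerA [(kappa M)^-1 * _]mulrC.
    rewrite (_ : (kappa M)^-1 *: (kappa M)%:P = 1); first by rewrite addrAC.
    by rewrite -mul_polyC -polyCM mulVf.
  apply: le_trans (jnormZ _ h0 _ _) _.
  have farle : jnorm N h far <= 128 * 16 * 24 / (M%:R * h).
    apply: (@far_sum _ N h h0 o n M j0 k1 (fun j k => chi (o + h * j%:R) (o + h * k%:R) && ~~ near j k j0 k1)) => //;
      [exact: leq_ltn_trans (leq_addr M _) j2|exact: leq_ltn_trans (leq_addr M _) k3|].
    by move=> j k /andP[_ /nfar].
  have blkle := @block_sum _ N h h0 M a (leq_trans (isT : (4 <= 8)%N) M8) ah.
  rewrite cabsV (_ : 40^-1 = 4^-1 * 10^-1 :> R); last by field.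
  apply: ler_pM; rewrite ?invr_ge0 ?cabs_ge0 ?jnorm_ge0 //.
    by rewrite lef_pV2 ?posrE // cabs_gt0.
  apply: le_trans (jnormD _ h0 _ _) _; apply: le_trans errM.
  rewrite [leRHS]mulrDl lerD //.
  apply: le_trans (jnormZ _ h0 _ _) _; rewrite cabs_real gtr0_norm //.
  apply: (@le_trans _ _ (h * (128 * 16 * 24 / (M%:R * h)))); first by rewrite ler_pM2l.
  by rewrite le_eqVlt; apply/orP; left; apply/eqP; field; rewrite !gt_eqF.
have zr := rK' z Xz; have [j0 [k1 [j1 j2 k2 k3 [aR aI]]]] := idx2 z zr.
have -> : jet e z = (jet e z - g *: S z) + g *: S z by rewrite subrK.
apply: le_trans (jnormD _ h0 _ _) _.
suff : jnorm N h (g *: S z) <= 40^-1.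
  have := He z (or_intror Xz); lra.
apply: le_trans (jnormZ _ h0 _ _) _.
have farle : jnorm N h (S z) <= 128 * 16 * 24 / (M%:R * h).
  apply: (@far_sum _ N h h0 o n M j0 k1 (fun j k => chi (o + h * j%:R) (o + h * k%:R))) => //;
      [exact: leq_ltn_trans (leq_addr M _) j2|exact: leq_ltn_trans (leq_addr M _) k3|].
  (* A selected square in the block around z would have its centre within d of both L and z, against
     D = 4 d. *)
  move=> j k Hchi; apply: nfar; apply/negP => /(nearP z) => /(_ aR aI) Hz.
  move/asboolP: Hchi => [w Lw]; rewrite -/(grid h o j k) => wz.
  have := LKD _ _ Lw Xz; have := cabs_triangle w z (grid h o j k).
  rewrite (cabsB w (grid h o j k)) -[D](@divfK _ 4) // -/d; lra.
apply: (@le_trans _ _ (h / 4 * (128 * 16 * 24 / (M%:R * h)))).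
  apply: ler_pM; rewrite ?cabs_ge0 ?jnorm_ge0 //.
  rewrite /g cabsM cabsV cabs_real gtr0_norm // ler_pM2l // lef_pV2 ?posrE // cabs_gt0 //.
have -> : h / 4 * (128 * 16 * 24 / (M%:R * h)) = 4^-1 * (128 * 16 * 24 / M%:R).
  by field; rewrite !gt_eqF.
have : 128 * 16 * 24 / M%:R <= (96 + 128 * 16 * 24) / M%:R :> R.
  by rewrite ler_pM2r ?invr_gt0 // lerDr.
move: errM; set u := _ / M%:R; set v := _ / M%:R; lra.
Qed.

End Separation.

(** * Runge approximation on a disjoint union *)

Section Runge.
Context {R : realType}.
Local Notation C := R[i].
Implicit Types (p q : {poly C}) (z w : C) (X L K : set C).

(** The price of returning to weight 1 depends on h, so the separation has to be sharpened
    beforehand in weight h. *)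
Lemma jnorm_weight N (h : R) p : 0 < h ->
  jnorm N 1 p <= (\sum_(l < N.+1) h^-1 ^+ l) * jnorm N h p.
Proof.
move=> h0; rewrite mulr_suml; apply: ler_sum => l _.
rewrite expr1n mulr1 exprVn mulrC ler_pdivlMr ?exprn_gt0 //.
by apply: jnorm_coef => //; rewrite -ltnS.
Qed.

(* x |-> 3 x^2 - 2 x^3 fixes 0 and 1 and has vanishing derivative there, so
   that iterating it sharpens the rough separation. *)
Lemma separation L K N (eps : R) : compact L -> compact K -> L `&` K = set0 ->
  filled L -> filled K -> 0 < eps -> exists e : {poly C},
  (forall z, L z -> jnorm N 1 (jet e z - 1) <= eps) /\
  (forall z, K z -> jnorm N 1 (jet e z) <= eps).
Proof.
move=> cL cK LK fL fK eps0.
have [h h0 [e0 [eL0 eK0]]] := rough_separation N cL cK LK fL fK.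
(* The factor 3 - 2 p has norm at most 3 + 2/10, and (3 + 2/10)/10 <= 1/3. *)
have contract p : jnorm N h p <= 10^-1 ->
    jnorm N h (p ^+ 2 * (3%:P - (p + p))) <= 3^-1 * jnorm N h p.
  move=> p10; apply: le_trans (jnormM _ h0 _ _) _.
  have p0 := jnorm_ge0 N h0 p.
  have H1 : jnorm N h (p ^+ 2) <= 10^-1 * jnorm N h p.
    apply: le_trans (jnormXn _ h0 _ _) _; rewrite expr2.
    by rewrite ler_wpM2r.
  have H2 : jnorm N h (3%:P - (p + p)) <= 3 + 10^-1 *+ 2.
    apply: le_trans (jnormD _ h0 _ _) _; rewrite jnormN jnormC cabs_nat lerD2l.
    by apply: le_trans (jnormD _ h0 _ _) _; rewrite mulr2n; apply: lerD.
  apply: (@le_trans _ _ (10^-1 * jnorm N h p * (3 + 10^-1 *+ 2))).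
    by apply: ler_pM; rewrite ?jnorm_ge0.
  rewrite -[10^-1 *+ 2]mulr_natr; lra.
have three : 3%:P = 1 + 1 + 1 :> {poly C} by rewrite -!polyCD; congr _%:P; ring.
have iter n : exists e : {poly C},
  (forall z, L z -> jnorm N h (jet e z - 1) <= 10^-1 * 3^-1 ^+ n) /\
  (forall z, K z -> jnorm N h (jet e z) <= 10^-1 * 3^-1 ^+ n).
  elim: n => [|n [e [eL eK]]]; first by exists e0; rewrite expr0 mulr1.
  have small x : x <= 10^-1 * 3^-1 ^+ n -> x <= 10^-1 :> R.
    move=> /le_trans; apply; rewrite ler_piMr // exprn_ile1 // invf_le1 //; lra.
  exists (e ^+ 2 * (3%:P - (e + e))); split => z Xz.
    rewrite jnormB; set x := jet e z.
    (* For s(x) = x^2 (3 - 2 x) one has 1 - s(x) = s(1 - x), so errors near 1 contract like errors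
       near 0. *)
    have -> : 1 - jet (e ^+ 2 * (3%:P - (e + e))) z = (1 - x) ^+ 2 * (3%:P - (1 - x + (1 - x))).
      by rewrite /jet comp_polyM comp_polyB comp_polyC comp_polyD expr2 comp_polyM -/(jet e z) -/x three; ring.
    have xs := eL z Xz; rewrite jnormB in xs.
    apply: le_trans (contract _ (small _ xs)) _.
    by rewrite exprS mulrCA ler_pM2l // invr_gt0.
  have -> : jet (e ^+ 2 * (3%:P - (e + e))) z = jet e z ^+ 2 * (3%:P - (jet e z + jet e z)).
    by rewrite /jet comp_polyM comp_polyB comp_polyC comp_polyD expr2 comp_polyM.
  have xs := eK z Xz.
  apply: le_trans (contract _ (small _ xs)) _.
  by rewrite exprS mulrCA ler_pM2l // invr_gt0.
set c := \sum_(l < N.+1) h^-1 ^+ l.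
have c0 : 0 <= c by apply: sumr_ge0 => l _; apply: exprn_ge0; rewrite invr_ge0 ltW.
have [n nc] : exists n, c * (10^-1 * 3^-1 ^+ n) <= eps.
  exists (Num.bound (c / eps)); set n := Num.bound _.
  have : c / eps <= 3 ^+ n.
    apply/ltW; apply: lt_trans (archi_boundP _) _; first by apply: divr_ge0 => //; exact: ltW.
    by rewrite -natrX ltr_nat ltn_expl.
  rewrite ler_pdivrMr // => H; rewrite exprVn mulrA ler_pdivrMr ?exprn_gt0 // [leRHS]mulrC.
  by apply: le_trans H; rewrite ler_piMr // invf_le1 // ler1n.
have [e [eL eK]] := iter n; exists e; split => z Xz.
  by apply: le_trans (jnorm_weight _ _ h0) _; apply: le_trans nc; rewrite ler_wpM2l // eL.
by apply: le_trans (jnorm_weight _ _ h0) _; apply: le_trans nc; rewrite ler_wpM2l // eK.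
Qed.

(** Take g = P + e (g0 - P), where g0 approximates u on L and e is near 1 on L and near 0 on K. The
    bound B on the jets of g0 - P over both sets fixes the tolerance for e. *)
Lemma runge_union L K N (u : C -> {poly C}) (P : {poly C}) (eps : R) :
  compact L -> compact K -> L `&` K = set0 -> filled L -> filled K ->
  approx N 1 L u -> 0 < eps -> exists g : {poly C},
  (forall z, L z -> jnorm N 1 (jet g z - u z) <= eps) /\
  (forall z, K z -> jnorm N 1 (jet g z - jet P z) <= eps).
Proof.
move=> cL cK LK fL fK au eps0.
have [|g0 Hg0] := au (eps / 2); first by rewrite divr_gt0.
have [BL BL0 HBL] := @jet_bounded _ N 1 ltr01 L cL (g0 - P).
have [BK BK0 HBK] := @jet_bounded _ N 1 ltr01 K cK (g0 - P).
pose B := Num.max BL BK.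
have B0 : 0 < B by rewrite lt_max BL0.
have [|e [eL eK]] := separation N (eps := eps / 2 / B) cL cK LK fL fK.
  by rewrite !divr_gt0.
exists (P + e * (g0 - P)); split => z Xz.
  apply: le_trans (jnorm_triangle _ ltr01 (jet g0 z) _ _) _.
  rewrite [eps]splitr lerD ?Hg0 //.
  have -> : jet (P + e * (g0 - P)) z - jet g0 z = (jet e z - 1) * jet (g0 - P) z.
    by rewrite jetD jetM /jet comp_polyB -!/(jet _ _); ring.
  apply: le_trans (jnormM _ ltr01 _ _) _.
  rewrite -[leRHS](@divfK _ B) ?gt_eqF //; apply: ler_pM; rewrite ?jnorm_ge0 ?eL //.
  by rewrite (le_trans (HBL z Xz)) // le_max lexx.
have -> : jet (P + e * (g0 - P)) z - jet P z = jet e z * jet (g0 - P) z.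
  by rewrite jetD jetM addrAC subrr add0r.
apply: le_trans (jnormM _ ltr01 _ _) _.
apply: (@le_trans _ _ (eps / 2 / B * B)); last by rewrite divfK ?gt_eqF //; lra.
apply: ler_pM; rewrite ?jnorm_ge0 ?eK //.
by rewrite (le_trans (HBK z Xz)) // le_max lexx orbT.
Qed.

(* Expansion of A/B at z, from the factors 1/(w - b) of 1/B. *)
Definition qjet N (A B : {poly C}) (z : C) : {poly C} :=
  jet A z * ((lead_coef B)^-1%:P *
    \prod_(b <- sval (closed_field_poly_normal B)) - pole N (b - z)).

(** [pole] expands 1/(b - z - t), so each linear factor of B contributes its negative; multiplying
    by the jet of B leaves a product of [poleK] identities. *)
Lemma qjetP N (A B : {poly C}) z : B.[z] != 0 ->
  jeq N (qjet N A B z * jet B z) (jet A z).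
Proof.
move=> Bz; rewrite /qjet; case: (closed_field_poly_normal B) => r /= Br.
have lB : lead_coef B != 0.
  by apply: contra Bz; rewrite lead_coef_eq0 => /eqP ->; rewrite horner0.
have rz b : b \in r -> b - z != 0.
  move=> br; apply: contra Bz; rewrite subr_eq0 => /eqP bz; rewrite Br hornerZ horner_prod.
  by rewrite (big_rem b) //= bz hornerXsubC subrr mul0r mulr0.
have jetB : jet B z = (lead_coef B)%:P * \prod_(b <- r) ('X - (b - z)%:P).
  rewrite {1}Br -mul_polyC jetM jetC; congr (_ * _).
  rewrite /jet rmorph_prod; apply: eq_bigr => b _ /=.
  by rewrite comp_polyB comp_polyX comp_polyC polyCB; ring.
have -> : jet A z * ((lead_coef B)^-1%:P * \prod_(b <- r) - pole N (b - z)) * jet B z =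
    jet A z * \prod_(b <- r) (((b - z)%:P - 'X) * pole N (b - z)).
  rewrite jetB [X in _ = _ * X](eq_bigr (fun b => (- pole N (b - z)) * ('X - (b - z)%:P))).
    rewrite big_split /= -[RHS]mulr1.
    have <- : (lead_coef B)^-1%:P * (lead_coef B)%:P = 1 :> {poly C}.
      by rewrite -polyCM mulVf.
    by ring.
  by move=> b _; ring.
apply: jeq_trans (jeqM (fun l _ => erefl (jet A z)`_l) (q' := 1) _) _; last by rewrite mulr1.
elim: r rz {Br jetB} => [|b r IH] rz; first by rewrite big_nil.
rewrite big_cons; apply: jeq_trans (jeqM (poleK (rz b _)) (IH _)) _.
- by rewrite mem_head.
- by move=> c cr; apply: rz; rewrite in_cons cr orbT.
- by rewrite mulr1.
Qed.

Lemma approx_qjet N X (A B : {poly C}) : compact X -> filled X ->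
  (forall z, X z -> B.[z] != 0) -> approx N 1 X (qjet N A B).
Proof.
move=> cX fX XB; rewrite /qjet; case: (closed_field_poly_normal B) => r /= Br.
apply: approxM => //; first exact: approx_jet.
apply: approxM => //.
  by apply: approx_jeq (approx_jet N 1 X (lead_coef B)^-1%:P) => z _ l _; rewrite jetC.
have rX b : b \in r -> ~ X b.
  move=> br /XB; rewrite Br hornerZ horner_prod (big_rem b) //= hornerXsubC subrr mul0r mulr0.
  by rewrite eqxx.
elim: r rX {Br} => [|b r IH] rX.
  by apply: approx_jeq (approx_jet N 1 X 1) => z _ l _; rewrite big_nil jetC.
have H : approx N 1 X (fun z => - pole N (b - z) * \prod_(b <- r) - pole N (b - z)).
  apply: approxM => //; last by apply: IH => c cr; apply: rX; rewrite in_cons cr orbT.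
  have := approxZ ltr01 cX (-1) (approx_pole N ltr01 cX fX (rX b (mem_head _ _))).
  by apply: approx_jeq => z _ l _; rewrite scaleN1r.
by apply: approx_jeq H => z _ l _; rewrite big_cons.
Qed.

End Runge.

(** * Derivatives and continuous extensions *)

Section Derivatives.
Context {R : realType}.
Local Notation C := R[i].
Implicit Types (p q : {poly C}) (z w : C) (W : set C) (u t : C -> {poly C}).

(* u z is, up to degree N, the Taylor expansion at z of z |-> (u z)`_0: for an
   expansion, differentiating in z is the same as differentiating in 'X. *)
Definition taylor_family N W u := forall z l, W z -> (l < N)%N ->
  is_derive z 1 (fun w => (u w)`_l) ((u z)^`())`_l.

Lemma taylor_familyC N W p : (forall l, (l < N)%N -> (p^`())`_l = 0) ->
  taylor_family N W (fun=> p).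
Proof. by move=> p0 z l _ lN; rewrite p0 //; exact: is_derive_cst. Qed.

Lemma taylor_familyD N W u t : taylor_family N W u -> taylor_family N W t ->
  taylor_family N W (fun z => u z + t z).
Proof.
move=> Hu Ht z l Wz lN; rewrite derivD coefD.
rewrite (_ : (fun w => _) = (fun w => (u w)`_l) + (fun w => (t w)`_l)).
  by apply: is_deriveD; [exact: Hu|exact: Ht].
by apply/funext => w; rewrite coefD.
Qed.

(** Differentiation in z and in the variable both obey the product rule, so agreement on the factors
    suffices. *)
Lemma taylor_familyM N W u t : taylor_family N W u -> taylor_family N W t ->
  taylor_family N W (fun z => u z * t z).
Proof.
move=> Hu Ht z l Wz lN; rewrite derivM.
rewrite (_ : (fun w => _) = \sum_(i < l.+1) (fun w => (u w)`_i * (t w)`_(l - i))).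
  apply: is_derive_eq.
    apply: is_derive_sum => i.
    apply: is_deriveM.
      by apply: Hu => //; apply: leq_ltn_trans lN; rewrite -ltnS.
    by apply: Ht => //; apply: leq_ltn_trans lN; exact: leq_subr.
  rewrite coefD !coefM -big_split; apply: eq_bigr => i _ /=.
  by rewrite addrC; congr (_ + _); exact: mulrC.
by apply/funext => w; rewrite coefM fct_sumE.
Qed.

Lemma taylor_family_jet N W p : taylor_family N W (jet p).
Proof.
elim/poly_ind: p => [|p c IH].
  by move=> z l Wz lN; rewrite (_ : jet 0 = fun=> 0) ?deriv0 ?coef0;
    [exact: is_derive_cst|apply/funext => w; rewrite jetC].
rewrite (_ : jet _ = fun z => jet p z * ('X + z%:P) + c%:P); last first.
  by apply/funext => z; rewrite jetD jetM jetX jetC.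
apply: taylor_familyD; last by apply: taylor_familyC => l _; rewrite derivC coef0.
apply: taylor_familyM => // z l _ _; rewrite derivD derivX derivC addr0 coef1.
case: l => [|l] /=.
  rewrite (_ : (fun w => _) = id); first exact: is_derive_id.
  by apply/funext => w; rewrite coefD coefX coefC /= add0r.
rewrite (_ : (fun w => _) = fun=> 'X`_l.+1); first exact: is_derive_cst.
by apply/funext => w; rewrite coefD coefC /= addr0.
Qed.

Lemma is_deriveV_shift (b z : C) : b - z != 0 ->
  is_derive z 1 (fun w : C => (b - w)^-1) ((b - z)^-1 ^+ 2).
Proof.
move=> bz; have H : is_derive z 1 (fun w : C => b - w) (-1).
  have := @is_deriveB C C C (cst b) id z 1 0 1 (is_derive_cst _ _ _) (is_derive_id _ _).
  by rewrite sub0r.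
have dV : derivable (fun w : C => (b - w)^-1) z 1.
  by apply: (@derivableV _ _ (fun w : C => b - w)) => //; exact: ex_derive H.
apply: DeriveDef => //.
have := @deriveV _ _ (fun w : C => b - w) z 1 bz (@ex_derive _ _ _ _ _ _ _ H).
rewrite (@derive_val _ _ _ _ _ _ _ H) => ->.
by rewrite scaleNr scalerN opprK exprVn; exact: mulr1.
Qed.

Lemma taylor_family_pole N W b : (forall z, W z -> b - z != 0) ->
  taylor_family N W (fun z => pole N (b - z)).
Proof.
move=> Wb z l Wz lN; rewrite coef_deriv coef_pole //.
rewrite (_ : (fun w => _) = (fun w => (b - w)^-1) ^+ l.+1); last first.
  by apply/funext => w; rewrite coef_pole ?(ltnW lN) // exprfctE.
apply: is_derive_eq; first by apply: is_deriveX; apply: is_deriveV_shift; exact: Wb.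
by rewrite -[LHS]/(_ * _) -mulrA -exprD addn2 mulr_natl.
Qed.

Lemma taylor_family_qjet N W A B : (forall z, W z -> B.[z] != 0) ->
  taylor_family N W (qjet N A B).
Proof.
move=> WB; rewrite /qjet; case: (closed_field_poly_normal B) => r /= Br.
apply: taylor_familyM; first exact: taylor_family_jet.
apply: taylor_familyM; first by apply: taylor_familyC => l _; rewrite derivC coef0.
have rX b : b \in r -> forall z, W z -> b - z != 0.
  move=> br z /WB; apply: contra; rewrite subr_eq0 => /eqP bz.
  by rewrite Br hornerZ horner_prod (big_rem b) //= hornerXsubC bz subrr mul0r mulr0.
elim: r rX {Br} => [|b r IH] rX.
  rewrite (_ : (fun z => _) = fun=> 1); last by apply/funext => z; rewrite big_nil.
  by apply: taylor_familyC => l _; rewrite derivC coef0.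
rewrite (_ : (fun z => _) = fun z => ((-1)%:P * pole N (b - z)) * \prod_(b <- r) - pole N (b - z)).
  apply: taylor_familyM; last by apply: IH => c cr; apply: rX; rewrite in_cons cr orbT.
  apply: taylor_familyM; first by apply: taylor_familyC => l _; rewrite derivC coef0.
  by apply: taylor_family_pole; apply: rX; rewrite mem_head.
by apply/funext => z; rewrite big_cons polyCN mulN1r.
Qed.

(** By induction, each differentiation passing to the next coefficient; derivability of the l-th
    derivative uses coefficient l + 1, hence l < N. *)
Lemma derive1n_taylor_family N W u (f : C -> C) : open W -> taylor_family N W u ->
  (forall z, W z -> f z = (u z)`_0) ->
  forall l z, (l <= N)%N -> W z ->
    derive1n l f z = l`!%:R * (u z)`_l /\
    ((l < N)%N -> is_derive z 1 (derive1n l f) (l.+1`!%:R * (u z)`_l.+1)).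
Proof.
move=> oW Hu fu.
have step l (g : C -> C) z : (forall w, W w -> g w = l`!%:R * (u w)`_l) -> W z -> (l < N)%N ->
    is_derive z 1 g (l.+1`!%:R * (u z)`_l.+1).
  move=> gu Wz lN.
  apply: (@near_eq_is_derive _ _ _ (fun w => l`!%:R * (u w)`_l)).
    by move: (open_nbhs_nbhs (conj oW Wz)); apply: filterS => w Ww; rewrite gu.
  have H := @is_deriveM C C (cst l`!%:R) (fun w => (u w)`_l) z 1 _ _ (is_derive_cst _ _ _) (Hu z l Wz lN).
  apply: is_derive_eq H _; rewrite scaler0 addr0 coef_deriv -[LHS]/(_ * _).
  by rewrite factS natrM -[(u z)`_l.+1 *+ _]mulr_natl mulrCA mulrA.
elim=> [|l IH] z lN Wz.
  by rewrite mul1r -fu //; split => // N0; apply: (step 0%N) => // w Ww; rewrite derive1n0 fu // mul1r.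
have E w : W w -> derive1n l.+1 f w = l.+1`!%:R * (u w)`_l.+1.
  move=> Ww; rewrite derive1nS derive1E.
  by have [_ /(_ lN) H] := IH w (ltnW lN) Ww; rewrite (@derive_val _ _ _ _ _ _ _ H).
by split; [exact: E|move=> lN'; exact: step].
Qed.

End Derivatives.

Section DerivativesRat.
Context {R : realType}.
Local Notation C := R[i].
Implicit Types (p q A B : {poly C}) (z w : C) (W : set C).

Lemma jet_coef0 p z : (jet p z)`_0 = p.[z].
Proof. by rewrite /jet -horner_coef0 horner_comp !hornerE. Qed.

Lemma qjet_coef0 N A B z : B.[z] != 0 -> (qjet N A B z)`_0 = A.[z] / B.[z].
Proof.
move=> Bz; have := qjetP A Bz (leq0n N).
by rewrite coef0M !jet_coef0 => <-; rewrite mulfK.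
Qed.

Lemma derive1n_rat N A B W (f : C -> C) z l : open W -> (forall w, W w -> B.[w] != 0) ->
  (forall w, W w -> f w = A.[w] / B.[w]) -> W z -> (l <= N)%N ->
  derive1n l f z = l`!%:R * (qjet N A B z)`_l.
Proof.
move=> oW WB fAB Wz lN.
have H := derive1n_taylor_family oW (taylor_family_qjet A WB) (f := f) _ lN Wz.
by have [|//] := H; move=> w Ww; rewrite fAB // qjet_coef0 // WB.
Qed.

Lemma jet_deriv p z : (jet p z)^`() = jet p^`() z.
Proof. by rewrite /jet deriv_comp derivD derivX derivC addr0 mulr1. Qed.

Lemma is_derive_horner p z : is_derive z 1 (horner p) p^`().[z].
Proof.
have := taylor_family_jet (N := 1) (W := setT) p (z := z) (l := 0) Logic.I isT.
rewrite jet_deriv jet_coef0 (_ : (fun w => _) = horner p) //.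
by apply/funext => w; exact: jet_coef0.
Qed.

Lemma horner_continuous p : continuous (horner p : C -> C).
Proof.
move=> z; apply/differentiable_continuous/derivable1_diffP.
exact: (@ex_derive _ _ _ _ _ _ _ (is_derive_horner p z)).
Qed.

Lemma open_nonroot B : open [set z : C | B.[z] != 0].
Proof.
have := @horner_continuous B => /continuousP /(_ (~` [set 0])).
rewrite (_ : _ @^-1` _ = [set z | B.[z] != 0]); last first.
  by apply/seteqP; split => z /= /eqP.
apply; apply: closed_openC; apply: accessible_closed_set1.
exact: hausdorff_accessible (@norm_hausdorff _ _).
Qed.

Lemma derive1n_ratfun N A B z l : B.[z] != 0 -> (l <= N)%N ->
  derive1n l (ratfun (A, B)) z = l`!%:R * (qjet N A B z)`_l.
Proof.
move=> Bz lN.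
exact: (derive1n_rat (@open_nonroot B)).
Qed.

Lemma derive1n_poly p W (f : C -> C) z l : open W -> (forall w, W w -> f w = p.[w]) ->
  W z -> derive1n l f z = l`!%:R * (jet p z)`_l.
Proof.
move=> oW fp Wz.
have H := derive1n_taylor_family oW (taylor_family_jet (N := l) p) (f := f) _ (leqnn l) Wz.
by have [|//] := H; move=> w Ww; rewrite fp // jet_coef0.
Qed.

Lemma derive1n_horner p z l : derive1n l (horner p) z = l`!%:R * (jet p z)`_l.
Proof. exact: (@derive1n_poly p setT (horner p) z l openT (fun _ _ => erefl) Logic.I). Qed.

Lemma derive1n_horner_deriv p l : derive1n l (horner p) = horner (derivn l p).
Proof.
elim: l => [|l IH]; first by rewrite derivn0.
apply/funext => z; rewrite derive1nS IH derivnS derive1E.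
by rewrite (@derive_val _ _ _ _ _ _ _ (is_derive_horner _ z)).
Qed.

Lemma jet_derivn p z l : l`!%:R * (jet p z)`_l = (derivn l p).[z].
Proof. by rewrite -derive1n_horner derive1n_horner_deriv. Qed.

End DerivativesRat.

(** * Continuous extension to the closure *)

Section Extension.
Context {R : realType}.
Local Notation C := R[i].
Implicit Types (p q A B : {poly C}) (z w : C) (E W : set C).

(** Completeness is inherited from the real line through the real and imaginary parts, which do not
    increase distances. *)
Lemma complex_cauchy_cvg (F : set_system C) : ProperFilter F ->
  (forall e : R, 0 < e -> exists x, F [set y | cabs (y - x) < e]) ->
  exists l : C, F --> l.
Proof.
move=> FF Fc.
have part (g : C -> R) : (forall x y, `|g x - g y| <= cabs (x - y)) -> cvg (g @ F).
  move=> gl; apply: R_complete; apply: cauchy_exP => e e0.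
  have [x Fx] := Fc e e0; exists (g x); rewrite nbhs_simpl /=.
  apply: filterS Fx => y /= yx; rewrite /ball /=.
  by apply: le_lt_trans (gl _ _) _; rewrite cabsB.
have cRe : cvg (@complex.Re R @ F).
  by apply: part => x y; apply: le_trans (cabs_Re _); case: x y => [? ?] [? ?].
have cIm : cvg (@complex.Im R @ F).
  by apply: part => x y; apply: le_trans (cabs_Im _); case: x y => [? ?] [? ?].
exists (lim (@complex.Re R @ F) +i* lim (@complex.Im R @ F))%C.
move=> A /nbhs_cabs[e e0 He]; have e2 : 0 < e / 2 by rewrite divr_gt0.
move/cvgrPdist_lt: cRe => /(_ _ e2) Hre; move/cvgrPdist_lt: cIm => /(_ _ e2) Him.
near=> y; apply: He; apply: le_lt_trans (cabs_ReIm _) _.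
have H1 : `|lim (@complex.Re R @ F) - complex.Re y| < e / 2 by near: y.
have H2 : `|lim (@complex.Im R @ F) - complex.Im y| < e / 2 by near: y.
rewrite distrC in H1; rewrite distrC in H2; rewrite [e]splitr.
by move: H1 H2; case: (y) => a b /= H1 H2; exact: ltrD.
Unshelve. all: by end_near. Qed.

Definition ucont_on E (D : C -> C) := forall e : R, 0 < e -> exists2 d : R, 0 < d &
  forall x y, E x -> E y -> cabs (x - y) < d -> cabs (D x - D y) < e.

(** Apart from the diagonal, the uniformity of [subspace E] only sees pairs inside E. *)
Lemma unif_continuous_subspaceP E (D : C -> C) :
  unif_continuous (D : subspace E -> C) <-> ucont_on E D.
Proof.
split=> [uD e e0|uD A].
  have ent : entourage [set xy : C * C | cabs (xy.1 - xy.2) < e].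
    rewrite -entourage_ballE; exists (e%:C)%C => /=; first by rewrite ltcR.
    by move=> [x y]; rewrite /= -ball_normE /= cabs_norm ltcR.
  have [B + HB] := uD _ ent; rewrite -entourage_ballE => -[d /= d0 dB].
  have dE : d = ((complex.Re d)%:C)%C by rewrite RRe_real // gtr0_real.
  exists (complex.Re d); first by rewrite -ltcR -dE.
  move=> x y Ex Ey xy; apply: (HB (x, y)) => /=; right; split=> //; split=> //.
  by apply: dB => /=; rewrite -ball_normE /= cabs_norm dE ltcR.
rewrite -entourage_ballE => -[e /= e0 eA].
have eE : e = ((complex.Re e)%:C)%C by rewrite RRe_real // gtr0_real.
have er0 : 0 < complex.Re e by rewrite -ltcR -eE.
have [d d0 Hd] := uD _ er0.
exists [set xy : C * C | cabs (xy.1 - xy.2) < d].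
  rewrite -entourage_ballE; exists (d%:C)%C => /=; first by rewrite ltcR.
  by move=> [x y]; rewrite /= -ball_normE /= cabs_norm ltcR.
move=> [x y] /= [->|[Ex [Ey xy]]].
  by apply: eA => /=; exact: ballxx.
by apply: eA => /=; rewrite -ball_normE /= cabs_norm eE ltcR Hd.
Qed.

Definition extension E (D : C -> C) z : C := lim (D @ within E (nbhs z)).

Lemma closure_cabs E z : closure E z ->
  forall e : R, 0 < e -> exists2 x, E x & cabs (x - z) < e.
Proof.
move=> Ez e e0; have [|x [Ex xz]] := Ez [set x | cabs (x - z) < e].
  by apply/nbhs_cabs; exists e.
by exists x.
Qed.

Lemma within_proper E z : closure E z -> ProperFilter (within E (nbhs z)).
Proof. move=> Ez; exact: (@within_nbhs_proper C E z Ez). Qed.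

Lemma extension_eq E (D G : C -> C) z : closure E z -> {for z, continuous G} ->
  (forall x, E x -> D x = G x) -> extension E D z = G z.
Proof.
move=> Ez cG DG; have FF : ProperFilter (within E (nbhs z)) by exact: within_proper.
apply: cvg_lim; first exact: norm_hausdorff.
apply/cvg_cabs => e e0.
have /cvg_cabs/(_ e e0) H := cG.
by rewrite /within; near_simpl; apply: filterS H => x Hx Ex; rewrite DG.
Qed.

(** The radius d serves all z of the closure at once, which is what makes the extension uniformly
    continuous. *)
Lemma extension_near E (D : C -> C) : ucont_on E D ->
  forall e : R, 0 < e -> exists2 d : R, 0 < d &
  forall z x, closure E z -> E x -> cabs (x - z) < d -> cabs (D x - extension E D z) <= e.
Proof.
move=> uD e e0; have [d d0 Hd] := uD e e0.
exists (d / 2); first by rewrite divr_gt0.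
move=> z x Ez Ex xz; have FF : ProperFilter (within E (nbhs z)) by exact: within_proper.
have nearE (r : R) : 0 < r -> \forall y \near within E (nbhs z), E y /\ cabs (y - z) < r.
  by move=> r0; apply/nbhs_cabs; exists r.
have [l Dl] : exists l : C, D @ within E (nbhs z) --> l.
  apply: complex_cauchy_cvg => r r0; have [r' r'0 Hr] := uD r r0.
  have [y Ey yz] := closure_cabs Ez (divr_gt0 r'0 (ltr0Sn _ 1)).
  exists (D y); have := nearE (r' / 2) (divr_gt0 r'0 (ltr0Sn _ 1)).
  apply: filterS => w [Ew wz] /=; apply: Hr => //.
  by apply: le_lt_trans (cabs_triangle _ _ z) _; rewrite [r']splitr ltrD // cabsB.
have -> : extension E D z = l by apply: cvg_lim Dl; exact: norm_hausdorff.
apply/ler_addgt0Pr => r r0; move/cvg_cabs: Dl => /(_ r r0) H.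
have [y [Hy [Ey yz]]] := @filter_ex _ _ FF _ (@filterI _ _ FF _ _ H (nearE (d / 2) (divr_gt0 d0 (ltr0Sn _ 1)))).
apply: le_trans (cabs_triangle _ _ (D y)) _; rewrite lerD // ltW // Hd //.
by apply: le_lt_trans (cabs_triangle _ _ z) _; rewrite [d]splitr ltrD // cabsB.
Qed.

Lemma extension_ucont E (D : C -> C) : ucont_on E D -> ucont_on (closure E) (extension E D).
Proof.
move=> uD e e0; have e3 : 0 < e / 3 by rewrite divr_gt0.
have [d d0 Hd] := extension_near uD e3.
exists (d / 2); first by rewrite divr_gt0.
move=> z w Ez Ew zw.
have [x Ex xz] := closure_cabs Ez (divr_gt0 d0 (ltr0Sn _ 1)).
have xw : cabs (x - w) < d.
  by apply: le_lt_trans (cabs_triangle _ _ z) _; rewrite [d]splitr ltrD.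
have xz' : cabs (x - z) < d by apply: (lt_le_trans xz); rewrite ler_pdivrMr //; lra.
have H1 := Hd z x Ez Ex xz'.
have H2 := Hd w x Ew Ex xw.
move: (extension E D z) (extension E D w) H1 H2 => a b H1 H2.
apply: le_lt_trans (cabs_triangle _ _ (D x)) _; rewrite [cabs (a - _)]cabsB.
by apply: le_lt_trans (lerD H1 H2) _; lra.
Qed.

Lemma horner_lipschitz p (r : R) : exists2 M : R, 0 < M &
  forall z w, cabs z <= r -> cabs w <= r -> cabs (p.[z] - p.[w]) <= M * cabs (z - w).
Proof.
elim/poly_ind: p => [|p c [M M0 HM]].
  by exists 1 => // z w _ _; rewrite !horner0 subrr cabs0 mul1r cabs_ge0.
have [B B0 HB] := jnorm_jet_bound 0 ltr01 p r.
exists (M * `|r| + B); first by rewrite ltr_wpDl // mulr_ge0 // ltW.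
move=> z w zr wr; rewrite !hornerMXaddC.
have -> : p.[z] * z + c - (p.[w] * w + c) = (p.[z] - p.[w]) * z + p.[w] * (z - w) by ring.
apply: le_trans (cabsD _ _) _; rewrite !cabsM [leRHS]mulrDl lerD //.
  rewrite mulrAC; apply: ler_pM; rewrite ?cabs_ge0 ?HM //.
  exact: le_trans zr (ler_norm _).
apply: ler_pM; rewrite ?cabs_ge0 //.
by have := HB w wr; rewrite /jnorm big_ord1 mulr1 jet_coef0.
Qed.

Lemma horner_ucont p E (r : R) : (forall z, E z -> cabs z <= r) -> ucont_on E (horner p).
Proof.
move=> Er e e0; have [M M0 HM] := horner_lipschitz p r.
exists (e / M); first by rewrite divr_gt0.
move=> x y Ex Ey xy; apply: le_lt_trans (HM _ _ (Er _ Ex) (Er _ Ey)) _.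
by rewrite mulrC -ltr_pdivlMr.
Qed.

Lemma is_derive_cabs (f : C -> C) z df :
  (forall e : R, 0 < e -> exists2 d : R, 0 < d & forall w, cabs (w - z) < d ->
     cabs (f w - f z - df * (w - z)) <= e * cabs (w - z)) -> is_derive z 1 f df.
Proof.
move=> H.
have cv : (fun h => h^-1 *: ((f \o shift z) (h *: (1 : C)) - f z)) @ 0^' --> df.
  apply/cvg_cabs => e e0; have e2 : 0 < e / 2 by rewrite divr_gt0.
  have [d d0 Hd] := H _ e2.
  apply/nbhs_cabs; exists d => // h hd h0.
  have := Hd (h + z); rewrite addrK => /(_ _) {}Hd.
  have hn0 : 0 < cabs h by rewrite cabs_gt0.
  rewrite /= -[h *: 1]/(h * 1) mulr1 -[_ *: _]/(_ * _).
  have -> : h^-1 * (f (h + z) - f z) - df = h^-1 * (f (h + z) - f z - df * h).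
    by field; rewrite -cabs_gt0.
  rewrite cabsM cabsV mulrC ltr_pdivrMr //; apply: le_lt_trans (Hd _) _.
    by move: hd; rewrite subr0.
  by rewrite ltr_pM2r //; lra.
by apply: DeriveDef; [apply/cvg_ex; exists df|apply: cvg_lim cv; exact: norm_hausdorff].
Qed.

Lemma cabs_is_derive (f : C -> C) z df : is_derive z 1 f df ->
  forall e : R, 0 < e -> exists2 d : R, 0 < d & forall w, cabs (w - z) < d ->
     cabs (f w - f z - df * (w - z)) <= e * cabs (w - z).
Proof.
move=> [dv dE] e e0.
have cv : (fun h => h^-1 *: ((f \o shift z) (h *: (1 : C)) - f z)) @ 0^' --> df.
  by rewrite -dE; exact: dv.
move/cvg_cabs: cv => /(_ e e0)/nbhs_cabs[d d0 Hd]; exists d => // w wz.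
have [->|wn] := eqVneq w z; first by rewrite !subrr mulr0 subrr cabs0 mulr0.
have w0 : w - z != 0 by rewrite subr_eq0.
have := Hd (w - z); rewrite subr0 => /(_ wz w0) /=.
rewrite -[(w - z) *: 1]/((w - z) * 1) mulr1 -[_ *: _]/(_ * _) subrK => H.
have -> : f w - f z - df * (w - z) = ((w - z)^-1 * (f w - f z) - df) * (w - z).
  by field.
by rewrite cabsM ler_wpM2r ?cabs_ge0 // ltW.
Qed.

(* Mean value theorem for the real polynomial t |-> Re (conj d p(z + t v)),
   where d = p(z + v) - p(z). *)
Lemma horner_mean_value p z v (M : R) :
  (forall t : R, 0 <= t <= 1 -> cabs p^`().[z + (t%:C)%C * v] <= M) ->
  cabs (p.[z + v] - p.[z]) <= M * cabs v.
Proof.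
move=> HM; set d := p.[z + v] - p.[z].
pose Q : {poly C} := (d^*)%C *: (p \Po (z%:P + v *: 'X)).
pose q := map_poly (@complex.Re R) Q.
have qE t : q.[t] = complex.Re ((d^*)%C * p.[z + (t%:C)%C * v]).
  have -> : (d^*)%C * p.[z + (t%:C)%C * v] = Q.[(t%:C)%C].
    by rewrite /Q hornerZ horner_comp !hornerE [v * _]mulrC.
  rewrite /q (@horner_coef_wide _ (size Q)) ?size_poly //.
  rewrite horner_coef raddf_sum; apply: eq_bigr => i _.
  rewrite coef_map_id0 // -rmorphXn /=; case: (Q`_i) => a b /=; by rewrite mulr0 subr0.
have dq t : q^`().[t] = complex.Re ((d^*)%C * p^`().[z + (t%:C)%C * v] * v).
  have -> : (d^*)%C * p^`().[z + (t%:C)%C * v] * v = Q^`().[(t%:C)%C].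
    rewrite /Q derivZ deriv_comp derivD derivC add0r derivZ derivX alg_polyC.
    rewrite hornerZ hornerM horner_comp hornerD !hornerC hornerZ hornerX [v * (_%:C)%C]mulrC; ring.
  rewrite /q (_ : (map_poly _ Q)^`() = map_poly (@complex.Re R) Q^`()); last first.
    by apply/polyP => i; rewrite coef_deriv !coef_map_id0 // coef_deriv raddfMn.
  rewrite (@horner_coef_wide _ (size Q^`())) ?size_poly //.
  rewrite horner_coef raddf_sum; apply: eq_bigr => i _.
  rewrite coef_map_id0 // -rmorphXn /=; case: (Q^`()`_i) => a b /=; by rewrite mulr0 subr0.
have [c c01 qc] := @poly_mvt _ 0 1 q ltr01.
have dd : q.[1] - q.[0] = cabs d ^+ 2.
  rewrite !qE mul0r addr0 mul1r -raddfB -mulrBr -/d.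
  by rewrite /cabs; case: (d) => a b /=; rewrite sqr_sqrtr ?addr_ge0 ?sqr_ge0 //; ring.
have [->|dn0] := eqVneq d 0.
  rewrite cabs0 mulr_ge0 ?cabs_ge0 //.
  by apply: le_trans (HM 0 _); rewrite ?cabs_ge0 ?lexx ?ler01.
have d0 : 0 < cabs d by rewrite cabs_gt0.
rewrite -(ler_pM2l d0) -expr2 -dd qc subr0 mulr1 dq.
apply: le_trans (ler_norm _) _; apply: le_trans (cabs_Re _) _.
rewrite !cabsM -mulrA.
have -> : cabs (d^*)%C = cabs d by rewrite /cabs; case: (d) => a b /=; rewrite sqrrN.
rewrite ler_pM2l // ler_wpM2r ?cabs_ge0 // HM //.
by move: c01; rewrite in_itv /= => /andP[c0 c1]; rewrite !ltW.
Qed.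

End Extension.

(** * Polynomials and their limits in the function space *)

Section Tspace.
Context {R : realType}.
Local Notation C := R[i].
Variables (Omega : set C) (L : nat -> set C).
Hypothesis Omega_open : open Omega.
Hypothesis L_compact : forall n, compact (L n).
Hypothesis L_closure : forall n, closure (L n `&` Omega) = L n.
Hypothesis L_exhaust : forall A : set C, compact A -> A `<=` Omega -> exists n, A `<=` L n.
Local Notation T := (Tinf Omega L).
Implicit Types (p h A B : {poly C}) (z w : C) (f g : T).

Lemma dextE n f l z : dext Omega (L n) f l z = extension (L n `&` Omega) (derive1n l f) z.
Proof. by []. Qed.

Lemma Tinf_ucont f n l : ucont_on (L n `&` Omega) (derive1n l f).
Proof. by apply/unif_continuous_subspaceP; exact: Tfun_unif. Qed.

Lemma dext_ucont f n l : ucont_on (L n) (dext Omega (L n) f l).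
Proof. by have := extension_ucont (Tinf_ucont f n l); rewrite L_closure. Qed.

Lemma dext_near f n l (e : R) : 0 < e -> exists2 d : R, 0 < d &
  forall z x, L n z -> L n x -> Omega x -> cabs (x - z) < d ->
    cabs (derive1n l f x - dext Omega (L n) f l z) <= e.
Proof.
move=> e0; have [d d0 Hd] := extension_near (Tinf_ucont f n l) e0.
by exists d => // z x Lz Lx Ox; apply: Hd => //; rewrite L_closure.
Qed.

Lemma L_bounded n : exists2 r : R, 0 < r & forall z, L n z -> cabs z <= r.
Proof.
have [r r0 Hr] := compact_cabs_bounded (@L_compact n).
by exists r => // z /Hr/ltW.
Qed.

Lemma Omega_L z : Omega z -> exists n, L n z.
Proof.
move=> Oz; have [|_ ->|n Hn] := @L_exhaust [set z]; first exact: compact_set1.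
  by [].
by exists n; exact: Hn.
Qed.

Definition cut p : C -> C := fun z => if `[< Omega z >] then p.[z] else 0.

Lemma cut_in p z : Omega z -> cut p z = p.[z].
Proof. by move=> Oz; rewrite /cut asboolT. Qed.

Lemma derive1n_cut p l z : Omega z -> derive1n l (cut p) z = (derivn l p).[z].
Proof.
move=> Oz; rewrite (derive1n_poly l Omega_open (@cut_in p) Oz).
exact: jet_derivn.
Qed.

Lemma cut_out p z : ~ Omega z -> cut p z = 0.
Proof. by move=> Oz; rewrite /cut asboolF. Qed.

Lemma cut_derivable p z : Omega z -> derivable (cut p) z 1.
Proof.
move=> Oz; apply: (@ex_derive _ _ _ _ _ _ (p^`().[z])).
apply: (@near_eq_is_derive _ _ _ (horner p)); last exact: is_derive_horner.
by move: (open_nbhs_nbhs (conj Omega_open Oz)); apply: filterS => w Ow; rewrite cut_in.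
Qed.

Lemma cut_unif p l n : unif_continuous (derive1n l (cut p) : subspace (L n `&` Omega) -> C).
Proof.
apply/unif_continuous_subspaceP => e e0.
have [r r0 Hr] := L_bounded n.
have [d d0 Hd] := horner_ucont (derivn l p) Hr e0.
exists d => // x y [Lx Ox] [Ly Oy] xy.
by rewrite !derive1n_cut // Hd.
Qed.

Definition polyT p : T :=
  MkTinf (@cut_out p) (@cut_derivable p) (@cut_unif p).

Lemma dext_polyT p n l z : L n z -> dext Omega (L n) (polyT p) l z = (derivn l p).[z].
Proof.
move=> Lz; rewrite dextE; apply: extension_eq; first by rewrite L_closure.
  exact: horner_continuous.
by move=> x [_ Ox]; exact: derive1n_cut.
Qed.

Lemma polyT_rational p : rationals Omega L (polyT p).
Proof.
exists p, 1; split; first by move=> n z _; rewrite hornerC oner_eq0.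
by move=> z Oz; rewrite hornerC divr1 -cut_in.
Qed.

(** The fraction is holomorphic around every point of [L n], so the extended derivatives are simply
    its own. *)
Lemma dext_rational f A B n N l z : (forall n z, L n z -> B.[z] != 0) ->
  (forall z, Omega z -> f z = A.[z] / B.[z]) -> L n z -> (l <= N)%N ->
  dext Omega (L n) f l z = l`!%:R * (qjet N A B z)`_l.
Proof.
move=> LB fAB Lz lN; rewrite -derive1n_ratfun //; last exact: LB Lz.
rewrite dextE; apply: extension_eq; first by rewrite L_closure.
  have := @derive1n_taylor_family R l.+1 [set w | B.[w] != 0] (qjet l.+1 A B) (ratfun (A, B))
    (@open_nonroot _ B) (taylor_family_qjet A (fun _ => id)) _ l z (leqnSn l) (LB _ _ Lz).
  case=> [w Bw|_ /(_ (ltnSn l)) H]; first by rewrite qjet_coef0.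
  apply/differentiable_continuous/derivable1_diffP.
  exact: (@ex_derive _ _ _ _ _ _ _ H).
move=> x [Lx Ox].
have OB w : Omega w -> B.[w] != 0 by move=> /Omega_L[k /LB].
rewrite (derive1n_rat (N := l) Omega_open OB fAB Ox) //.
by rewrite -derive1n_ratfun // OB.
Qed.

Lemma sup0_le (A : set C) (g : C -> \bar R) (x : \bar R) : (0 <= x)%E ->
  (forall z, A z -> (g z <= x)%E) -> (Defs.sup0 A g <= x)%E.
Proof.
by move=> x0 H; apply: ge_ereal_sup => _ [->//|[z Az <-]]; exact: H.
Qed.

Lemma sup0_ub (A : set C) (g : C -> \bar R) z : A z -> (g z <= Defs.sup0 A g)%E.
Proof. by move=> Az; apply: ereal_sup_ubound; right; exists z. Qed.

Lemma sup0_ge0 (A : set C) (g : C -> \bar R) : (0 <= Defs.sup0 A g)%E.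
Proof. by apply: ereal_sup_ubound; left. Qed.

Lemma Tdist_le n l f g (e : R) : 0 <= e ->
  (forall z, L n z -> cabs (dext Omega (L n) f l z - dext Omega (L n) g l z) <= e) ->
  (Tdist n l f g <= e%:E)%E.
Proof. by move=> e0 H; apply: sup0_le => [|z Lz]; rewrite lee_fin // H. Qed.

Lemma Tdist_lt n l f g (e : R) z : (Tdist n l f g < e%:E)%E -> L n z ->
  cabs (dext Omega (L n) f l z - dext Omega (L n) g l z) < e.
Proof.
move=> H Lz; rewrite -lte_fin; apply: le_lt_trans H.
exact: (@sup0_ub _ (fun z => (cabs (dext Omega (L n) f l z - dext Omega (L n) g l z))%:E)).
Qed.

(** A small closed box around z is a compact subset of Omega, hence contained in some [L n]. *)
Lemma Omega_nbhd z : Omega z -> exists n, exists2 r : R, 0 < r &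
  forall w, cabs (w - z) < r -> Omega w /\ L n w.
Proof.
move=> /(iffLR (open_cabs _) Omega_open)[e e0 He].
pose r := e / 4; have r0 : 0 < r by rewrite divr_gt0.
pose A : set C := (fun w => w + z) @` [set w : C | `|complex.Re w| <= r /\ `|complex.Im w| <= r].
have cA : compact A.
  apply: continuous_compact; last exact: compact_box.
  apply: continuous_subspaceT => w; apply/(@cvg_cabs R C (nbhs w) _) => d d0.
  by apply/nbhs_cabs; exists d => // v vw; rewrite opprD addrACA subrr addr0.
have AO : A `<=` Omega.
  move=> _ [w [w1 w2] <-]; apply: He; rewrite addrK.
  by apply: le_lt_trans (cabs_ReIm _) _; rewrite /r in w1 w2; lra.
have [n An] := L_exhaust cA AO; exists n, r => // w wr.
have Aw : A w.
  exists (w - z); last by rewrite subrK.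
  by split; apply/ltW; apply: le_lt_trans wr; [exact: cabs_Re|exact: cabs_Im].
by split; [exact: AO|exact: An].
Qed.

Section Limit.
Variable h : nat -> {poly C}.
Hypothesis h_cauchy : forall n l (e : R), 0 < e -> exists J, forall i j,
  (J <= i)%N -> (J <= j)%N -> forall z, L n z ->
  cabs ((derivn l (h i)).[z] - (derivn l (h j)).[z]) <= e.

(** The limit is quantified before the condition on z so that choice yields total functions; off the
    sets [L n] its value is arbitrary. *)
Lemma pointwise_limit l z : exists g : C, (exists n, L n z) ->
  forall e : R, 0 < e -> exists J, forall j, (J <= j)%N -> cabs ((derivn l (h j)).[z] - g) <= e.
Proof.
case: (pselect (exists n, L n z)) => [[n Lz]|nL]; last by exists 0 => /nL.
have [|g hg] := @complex_cauchy_cvg R ((fun j => (derivn l (h j)).[z]) @ \oo) _.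
  move=> e e0; have [J HJ] := h_cauchy n l (divr_gt0 e0 (ltr0Sn _ 1)).
  exists (derivn l (h J)).[z]; exists J => // j /= Jj.
  by apply: le_lt_trans (HJ j J Jj (leqnn J) z Lz) _; lra.
exists g => _ e e0; move/cvg_cabs: hg => /(_ e e0)[J _ HJ].
by exists J => j /HJ/ltW.
Qed.

(** The limits [G l] of the l-th derivatives satisfy (G l)' = G (l + 1) on Omega, by uniform
    convergence on a disc inside some [L n]; so [G 0] has all the required derivatives. *)
Lemma uniform_limit : exists f : T, forall n l (e : R), 0 < e -> exists J, forall j,
  (J <= j)%N -> forall z, L n z ->
  cabs (dext Omega (L n) f l z - (derivn l (h j)).[z]) <= e.
Proof.
have [G HG] : exists G : nat -> C -> C, forall l z, (exists n, L n z) ->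
    forall e : R, 0 < e -> exists J, forall j, (J <= j)%N -> cabs ((derivn l (h j)).[z] - G l z) <= e.
  have [G0 HG0] := choice (fun lz : nat * C => pointwise_limit lz.1 lz.2).
  by exists (fun l z => G0 (l, z)) => l z; exact: (HG0 (l, z)).
have unif n l (e : R) : 0 < e -> exists J, forall j, (J <= j)%N -> forall z, L n z ->
    cabs ((derivn l (h j)).[z] - G l z) <= e.
  move=> e0; have [J HJ] := h_cauchy n l e0.
  exists J => j Jj z Lz; apply/ler_addgt0Pr => d d0.
  have [I HI] := HG l z (ex_intro _ n Lz) d d0.
  apply: le_trans (cabs_triangle _ _ (derivn l (h (maxn I J))).[z]) _.
  by rewrite lerD ?HJ ?HI ?leq_maxl ?leq_maxr.
have dG l z : Omega z -> is_derive z 1 (G l) (G l.+1 z).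
  move=> Oz; have [n [r r0 Hr]] := Omega_nbhd Oz.
  apply: is_derive_cabs => e e0; have e3 : 0 < e / 3 by rewrite divr_gt0.
  have [J1 HJ1] := h_cauchy n l.+1 e3; have [J2 HJ2] := unif n l.+1 _ e3.
  pose j := maxn J1 J2; pose p i := derivn l (h i).
  have [d d0 Hd] := cabs_is_derive (is_derive_horner (p j) z) e3.
  exists (Num.min d r); first by rewrite lt_min d0.
  move=> w; rewrite lt_min => /andP[wd wr].
  have Lw : L n w by have [] := Hr w wr.
  have Lz : L n z by have [] := Hr z; rewrite ?subrr ?cabs0.
  (* The mean value inequality for [p i - p j] with j fixed, where i is then taken large. It needs
     the segment from z to w inside [L n], which the disc around z provides. *)
  have H1 : cabs (G l w - G l z - ((p j).[w] - (p j).[z])) <= e / 3 * cabs (w - z).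
    apply/ler_addgt0Pr => t t0; have t2 : 0 < t / 2 by rewrite divr_gt0.
    have [I1 HI1] := HG l w (ex_intro _ n Lw) _ t2.
    have [I2 HI2] := HG l z (ex_intro _ n Lz) _ t2.
    pose i := maxn J1 (maxn I1 I2).
    have A1 : cabs ((p i).[w] - G l w) <= t / 2 by apply: HI1; rewrite /i; lia.
    have A2 : cabs ((p i).[z] - G l z) <= t / 2 by apply: HI2; rewrite /i; lia.
    have A3 : cabs ((p i - p j).[z + (w - z)] - (p i - p j).[z]) <= e / 3 * cabs (w - z).
      apply: horner_mean_value => s /andP[s0 s1].
      rewrite derivB hornerD hornerN /p -!derivnS; apply: HJ1; rewrite ?leq_maxl //.
      apply: (Hr _ _).2; rewrite addrC addKr cabsM cabs_real ger0_norm //.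
      by apply: le_lt_trans wr; rewrite ler_piMl ?cabs_ge0.
    move: A3; rewrite [z + _]addrC subrK !hornerD !hornerN => A3.
    have -> : G l w - G l z - ((p j).[w] - (p j).[z]) =
       ((p i).[w] - (p j).[w] - ((p i).[z] - (p j).[z])) +
       (((p i).[z] - G l z) - ((p i).[w] - G l w)) by ring.
    apply: le_trans (cabsD _ _) _; rewrite lerD //.
    by apply: le_trans (cabsD _ _) _; rewrite cabsN [t]splitr lerD.
  have H2 : cabs ((p j).[w] - (p j).[z] - (p j)^`().[z] * (w - z)) <= e / 3 * cabs (w - z).
    exact: Hd.
  have H3 : cabs (((p j)^`().[z] - G l.+1 z) * (w - z)) <= e / 3 * cabs (w - z).
    by rewrite cabsM ler_wpM2r ?cabs_ge0 // /p -derivnS HJ2 // leq_maxr.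
  have -> : G l w - G l z - G l.+1 z * (w - z) =
     (G l w - G l z - ((p j).[w] - (p j).[z])) +
     ((p j).[w] - (p j).[z] - (p j)^`().[z] * (w - z)) + ((p j)^`().[z] - G l.+1 z) * (w - z).
    by ring.
  have -> : e * cabs (w - z) = e / 3 * cabs (w - z) + e / 3 * cabs (w - z) + e / 3 * cabs (w - z).
    by field.
  apply: le_trans (cabsD _ _) _; rewrite lerD //.
  by apply: le_trans (cabsD _ _) _; rewrite lerD.
pose f0 : C -> C := fun z => if `[< Omega z >] then G 0%N z else 0.
have f0E z : Omega z -> f0 z = G 0%N z by move=> Oz; rewrite /f0 asboolT.
have f0n l z : Omega z -> derive1n l f0 z = G l z.
  elim: l z => [|l IH] z Oz; first exact: f0E.
  rewrite derive1nS derive1E; apply: (@derive_val _ _ _ _ _ _ _ _).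
  apply: (@near_eq_is_derive _ _ _ (G l)); last exact: dG.
  by move: (open_nbhs_nbhs (conj Omega_open Oz)); apply: filterS => w Ow; rewrite IH.
have f0_out z : ~ Omega z -> f0 z = 0 by move=> Oz; rewrite /f0 asboolF.
have f0_holo z : Omega z -> derivable f0 z 1.
  move=> Oz; apply: (@ex_derive _ _ _ _ _ _ (G 1%N z)).
  apply: (@near_eq_is_derive _ _ _ (G 0%N)); last exact: dG.
  by move: (open_nbhs_nbhs (conj Omega_open Oz)); apply: filterS => w Ow; rewrite f0E.
have hu n l j : ucont_on (L n) (horner (derivn l (h j))).
  by have [r r0 Hr] := L_bounded n; exact: horner_ucont Hr.
have f0_unif l n : unif_continuous (derive1n l f0 : subspace (L n `&` Omega) -> C).
  apply/unif_continuous_subspaceP => e e0; have e3 : 0 < e / 3 by rewrite divr_gt0.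
  have [J HJ] := unif n l _ e3; have [d d0 Hd] := hu n l J _ e3.
  exists d => // x y [Lx Ox] [Ly Oy] xy; rewrite !f0n //.
  apply: le_lt_trans (cabs_triangle _ _ (derivn l (h J)).[x]) _.
  have := cabs_triangle (derivn l (h J)).[x] (G l y) (derivn l (h J)).[y].
  have := HJ J (leqnn J) x Lx; have := HJ J (leqnn J) y Ly; have := Hd x y Lx Ly xy.
  rewrite [cabs (_ - G l x)]cabsB.
  move: (derivn l (h J)).[x] (derivn l (h J)).[y] (G l x) (G l y) => a b c g; lra.
exists (MkTinf f0_out f0_holo f0_unif) => n l e e0.
have e3 : 0 < e / 3 by rewrite divr_gt0.
have [J HJ] := unif n l _ e3; exists J => j Jj z Lz.
set f := MkTinf _ _ _.
have [d1 d10 Hd1] := dext_near f n l e3; have [d2 d20 Hd2] := hu n l j _ e3.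
have d0 : 0 < Num.min d1 d2 by rewrite lt_min d10.
have cz : closure (L n `&` Omega) z by rewrite L_closure.
(* At a boundary point both sides are compared at a nearby point x of Omega. *)
have [x [Lx Ox]] := closure_cabs cz d0; rewrite lt_min => /andP[x1 x2].
have := Hd1 z x Lz Lx Ox x1; rewrite (_ : derive1n l f x = G l x); last exact: f0n.
have := HJ j Jj x Lx; have := Hd2 x z Lx Lz x2.
move: (dext _ _ _ _ _) (derivn l (h j)).[x] (derivn l (h j)).[z] (G l x) => a b c g H1 H2 H3.
have := cabs_triangle a c g; have := cabs_triangle g c b.
by rewrite (cabsB a g) (cabsB g b); lra.
Qed.

End Limit.

End Tspace.

(** * Pade approximants *)

Section Pade.
Context {R : realType}.
Local Notation C := R[i].
Implicit Types (a : nat -> C) (A B : {poly C}) (zeta z : C) (p q : nat).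

Lemma jeq_cancel N (x y b : {poly C}) : b`_0 != 0 -> jeq N (x * b) (y * b) -> jeq N x y.
Proof.
move=> b0 xy; elim/ltn_ind => k IH kN.
have := xy k kN; rewrite !coefM !big_ord_recr /= subnn.
have -> : \sum_(i < k) x`_i * b`_(k - i) = \sum_(i < k) y`_i * b`_(k - i).
  by apply: eq_bigr => i _; rewrite IH // ltnW // (leq_trans (ltn_ord i)).
by move=> /addrI/mulIf; apply.
Qed.

Definition trunc_series N a : {poly C} := \poly_(k < N.+1) a k.

(** Clearing the denominator makes the conditions linear in A and B; since B(zeta) = 1, the
    denominator can be cancelled again. *)
Lemma is_padeE a zeta p q A B : is_pade a zeta p q (A, B) <->
  [/\ (size A <= p.+1)%N, (size B <= q.+1)%N, B.[zeta] = 1 &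
    jeq (p + q) (trunc_series (p + q) a * jet B zeta) (jet A zeta)].
Proof.
split=> -[/= sA sB B1 H]; split=> //.
  have B0 : B.[zeta] != 0 by rewrite B1 oner_eq0.
  apply: jeq_trans (jeqM _ (fun l _ => erefl (jet B zeta)`_l)) (qjetP A B0).
  move=> k kN; rewrite coef_poly ltnS kN -H // (derive1n_ratfun A B0 kN).
  by rewrite mulrC mulKf // pnatr_eq0 -lt0n fact_gt0.
move=> k kN; have B0 : B.[zeta] != 0 by rewrite B1 oner_eq0.
rewrite (derive1n_ratfun A B0 kN) mulrC mulKf ?pnatr_eq0 -?lt0n ?fact_gt0 //.
have -> : a k = (trunc_series (p + q) a)`_k by rewrite coef_poly ltnS kN.
apply: (@jeq_cancel (p + q) _ _ (jet B zeta)) => //; first by rewrite jet_coef0.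
by apply: jeq_trans (qjetP A B0) (jeq_sym H).
Qed.

(* In terms of b = B(zeta + t), the Hankel system determines the vector of
   coefficients b_(q - j), j < q, since b_0 = 1. *)
Definition pade_vec a p q : 'cV[C]_q :=
  - (\det (hankel a p q))^-1 *: (\adj (hankel a p q) *m \col_i a (p + i).+1).

Definition pade_den a p q : {poly C} :=
  1 + \sum_(j < q) pade_vec a p q j 0 *: 'X^(q - j).

Definition pade_num a p q : {poly C} :=
  \poly_(k < p.+1) (trunc_series (p + q) a * pade_den a p q)`_k.

(** At orders p + 1 to p + q the coefficients of series times denominator are the Hankel rows
    applied to b_(q - j), plus the term coming from b_0 = 1. For a Pade pair they must vanish, the
    numerator having degree at most p. *)
Lemma hankel_coef a p q (b : {poly C}) (i : 'I_q) : (size b <= q.+1)%N -> b`_0 = 1 ->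
  (trunc_series (p + q) a * b)`_(p + i).+1 =
  \sum_j hankel a p q i j * b`_(q - j) + a (p + i).+1.
Proof.
move=> sb b0; rewrite mulrC coefM.
have kN : ((p + i).+1 <= p + q)%N by rewrite ltn_add2l.
rewrite big_ord_recl subn0 b0 mul1r coef_poly ltnS kN addrC; congr (_ + _).
rewrite [RHS](reindex_inj rev_ord_inj) /=.
pose F (k : nat) := b`_k.+1 * coefz a ((p + i)%:Z - k%:Z).
transitivity (\sum_(k < (p + i).+1) F k).
  apply: eq_bigr => k _; rewrite /F /bump /= add1n subSS; congr (_ * _).
  rewrite coef_poly (_ : (_ < _)%N); last by lia.
  by have -> : (p + i)%:Z - k%:Z = Posz (p + i - k)%N by have := ltn_ord k; lia.
transitivity (\sum_(k < q) F k); last first.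
  apply: eq_bigr => k _; rewrite /F mxE mulrC; have kq := ltn_ord k; congr (coefz a _ * b`_ _) => /=; lia.
(* F vanishes beyond the degree of b and at negative indices of a, so the two ranges of summation
   are interchangeable. *)
have F0 k : (q <= k)%N || (p + i < k)%N -> F k = 0.
  rewrite /F => /orP[qk|pik]; first by rewrite nth_default ?mul0r // (leq_trans sb).
  by rewrite (_ : (p + i)%:Z - k%:Z = Negz (k - (p + i)).-1) ?mulr0 //; lia.
have ext m n : (m <= n)%N -> (forall k, (m <= k)%N -> F k = 0) ->
    \sum_(k < n) F k = \sum_(k < m) F k.
  move=> mn H; rewrite -(big_mkord xpredT F) (big_cat_nat (leq0n m) mn) /= big_mkord.
  by rewrite [X in _ + X]big_nat_cond [X in _ + X]big1 ?addr0 // => k /andP[/andP[mk _] _]; exact: H.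
case: (leqP (p + i).+1 q) => pq.
  by rewrite -(ext _ _ pq) // => k ik; apply: F0; rewrite ik orbT.
by rewrite (ext _ _ (ltnW pq)) // => k ik; apply: F0; rewrite ik.
Qed.

Lemma pade_den_coef0 a p q : (pade_den a p q)`_0 = 1.
Proof.
rewrite coefD coef1 coef_sum big1 ?addr0 // => j _.
by rewrite coefZ coefXn (_ : (0 == q - j)%N = false) ?mulr0 //; have := ltn_ord j; lia.
Qed.

Lemma size_pade_den a p q : (size (pade_den a p q) <= q.+1)%N.
Proof.
apply: leq_trans (size_polyD _ _) _; rewrite geq_max size_polyC oner_eq0 /=.
apply: leq_trans (size_sum _ _ _) _; apply/bigmax_leqP => j _.
by apply: leq_trans (size_scale_leq _ _) _; rewrite size_polyXn ltnS leq_subr.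
Qed.

Lemma pade_den_coef a p q (j : 'I_q) : (pade_den a p q)`_(q - j) = pade_vec a p q j 0.
Proof.
have jq := ltn_ord j.
rewrite coefD coef1 (_ : (q - j == 0)%N = false) ?add0r; last by lia.
rewrite coef_sum (bigD1 j) //= coefZ coefXn eqxx mulr1 big1 ?addr0 // => k kj.
have kq := ltn_ord k; rewrite coefZ coefXn (_ : (q - j == q - k)%N = false) ?mulr0 //.
by apply: contraNF kj => /eqP H; apply/eqP/val_inj => /=; lia.
Qed.

Lemma hankel_pade_vec a p q : in_D a p q ->
  hankel a p q *m pade_vec a p q = - \col_i a (p + i).+1.
Proof.
move=> D; rewrite /pade_vec -scalemxAr mulmxA mul_mx_adj.
by rewrite mul_scalar_mx scalerA mulNr mulVf // scaleN1r.
Qed.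

Lemma pade_shift_system a p q : in_D a p q ->
  jeq (p + q) (trunc_series (p + q) a * pade_den a p q) (pade_num a p q).
Proof.
move=> D k kN; rewrite [RHS]coef_poly ltnS; case: leqP => // pk.
have iq : (k - p.+1 < q)%N by lia.
have -> : k = (p + Ordinal iq).+1 by rewrite /=; lia.
rewrite hankel_coef ?size_pade_den ?pade_den_coef0 //.
have /matrixP/(_ (Ordinal iq) 0) := hankel_pade_vec D; rewrite !mxE => H.
rewrite (eq_bigr (fun j => hankel a p q (Ordinal iq) j * pade_vec a p q j 0)).
  by rewrite H addNr.
by move=> j _; rewrite pade_den_coef.
Qed.

Lemma jet_shift (b : {poly C}) zeta z : jet (b \Po ('X - zeta%:P)) z = jet b (z - zeta).
Proof.
rewrite /jet -comp_polyA comp_polyB comp_polyX comp_polyC.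
by rewrite polyCB addrA.
Qed.

Lemma shift_jet A zeta : jet A zeta \Po ('X - zeta%:P) = A.
Proof.
by rewrite /jet -comp_polyA comp_polyD comp_polyX comp_polyC subrK comp_polyXr.
Qed.

Lemma size_jet A zeta : size (jet A zeta) = size A.
Proof. by rewrite /jet size_comp_poly2 // size_XaddC. Qed.

Lemma size_shift A zeta : size (A \Po ('X - zeta%:P)) = size A.
Proof. by rewrite size_comp_poly2 // size_XsubC. Qed.

(** Orders p + 1 to p + q give the invertible Hankel system for B; orders up to p then give A. *)
Lemma is_pade_unique a zeta p q A B : in_D a p q -> is_pade a zeta p q (A, B) ->
  (A, B) = (pade_num a p q \Po ('X - zeta%:P), pade_den a p q \Po ('X - zeta%:P)).
Proof.
move=> D /is_padeE[sA sB B1 H].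
set b := jet B zeta.
have b0 : b`_0 = 1 by rewrite jet_coef0.
have sb : (size b <= q.+1)%N by rewrite size_jet.
have x : \col_(j < q) b`_(q - j) = pade_vec a p q.
  have Hx : hankel a p q *m (\col_(j < q) b`_(q - j)) = - \col_i a (p + i).+1.
    apply/matrixP => i k; rewrite !mxE.
    have kN : ((p + i).+1 <= p + q)%N by rewrite ltn_add2l.
    have := H _ kN; rewrite hankel_coef // [X in _ = X]nth_default; last first.
      by rewrite size_jet (leq_trans sA) // ltnS leq_addr.
    move/eqP; rewrite addr_eq0 => /eqP <-.
    by apply: eq_bigr => j _; rewrite !mxE.
  have Hu : hankel a p q \in unitmx by rewrite unitmxE unitfE.
  by apply: (can_inj (mulKmx Hu)); rewrite Hx hankel_pade_vec.
have bE : b = pade_den a p q.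
  apply/polyP => k; case: (posnP k) => [->|k0]; first by rewrite pade_den_coef0.
  case: (leqP k q) => kq; last first.
    by rewrite !nth_default // ?(leq_trans (size_pade_den _ _ _)) ?(leq_trans sb).
  have jq : (q - k < q)%N by lia.
  have -> : k = (q - Ordinal jq)%N by rewrite /=; lia.
  by rewrite pade_den_coef -x mxE.
have AE : jet A zeta = pade_num a p q.
  apply/polyP => k; rewrite coef_poly; case: (leqP k p) => kp; last first.
    by rewrite ltnS leqNgt kp nth_default // size_jet (leq_trans sA).
  rewrite ltnS kp -bE; apply: esym; apply: H.
  exact: leq_trans kp (leq_addr _ _).
by rewrite -AE -bE !shift_jet.
Qed.

Lemma is_pade_exists a zeta p q : in_D a p q ->
  is_pade a zeta p q (pade_num a p q \Po ('X - zeta%:P), pade_den a p q \Po ('X - zeta%:P)).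
Proof.
move=> D; apply/is_padeE; split.
- by rewrite size_shift size_poly.
- by rewrite size_shift size_pade_den.
- by rewrite horner_comp hornerXsubC subrr horner_coef0 pade_den_coef0.
- rewrite !jet_shift subrr /jet addr0 !comp_polyXr.
  exact: pade_shift_system.
Qed.

Lemma padeE a zeta p q : in_D a p q -> pade a zeta p q =
  (pade_num a p q \Po ('X - zeta%:P), pade_den a p q \Po ('X - zeta%:P)).
Proof.
move=> D; rewrite /pade; case: xgetP => [[A B] _ /= H|/(_ _ (is_pade_exists zeta D))//].
exact: is_pade_unique.
Qed.

(* The Hankel matrix of a polynomial of exact degree p is antitriangular, with
   the leading coefficient along the antidiagonal. *)
Lemma in_D_poly (g : {poly C}) zeta p q : size g = p.+1 ->
  in_D (fun k => (jet g zeta)`_k) p q.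
Proof.
move=> sg; set a := fun k => _; have lead : lead_coef g != 0.
  by rewrite lead_coef_eq0 -size_poly_eq0 sg.
have ap : a p = lead_coef g.
  have -> : a p = lead_coef (jet g zeta) by rewrite lead_coefE size_jet sg.
  by rewrite /jet lead_coef_comp ?size_XaddC // lead_coefXaddC expr1n mulr1.
have abig k : (p < k)%N -> a k = 0.
  by move=> pk; rewrite /a nth_default // size_jet sg.
rewrite /in_D.
(* Reversing the columns turns the antidiagonal into the diagonal, where every entry is a_p. *)
pose M : 'M[C]_q := \matrix_(i, j) hankel a p q i (rev_ord j).
have -> : hankel a p q = col_perm (perm (@rev_ord_inj q)) M.
  by apply/matrixP => i j; rewrite !mxE permE rev_ordK.
rewrite col_permE det_mulmx det_perm mulf_neq0 ?signr_eq0 //.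
have ME (i j : 'I_q) : M i j = coefz a (p%:Z + i%:Z - j%:Z).
  by rewrite !mxE; congr (coefz a _) => /=; have := ltn_ord j; lia.
rewrite -det_tr det_trig; last first.
  apply/is_trig_mxP => i j ij; rewrite mxE ME.
  have -> : p%:Z + j%:Z - i%:Z = Posz (p + (j - i))%N by lia.
  by apply: abig; lia.
rewrite prodf_seq_neq0; apply/allP => i _; rewrite implyTb mxE ME.
by rewrite addrK /= ap.
Qed.

(** The pair (g, 1) meets the defining conditions at every centre, and uniqueness applies because
    the Hankel determinant does not vanish. *)
Lemma pade_poly (g : {poly C}) zeta p q : size g = p.+1 ->
  pade (fun k => (jet g zeta)`_k) zeta p q = (g, 1).
Proof.
move=> sg; have D := in_D_poly zeta q sg.
rewrite (padeE zeta D); apply: esym; apply: is_pade_unique => //.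
apply/is_padeE; split => //=; first by rewrite sg.
- by rewrite size_polyC oner_eq0.
- by rewrite hornerC.
- rewrite jetC mulr1 => k kN; rewrite coef_poly ltnS kN //.
Qed.

End Pade.

(** * Continuity of Pade approximants and Taylor sums *)

Section Continuity.
Context {R : realType}.
Local Notation C := R[i].
Variables (T0 : Type) (F : set_system T0).
Hypothesis FF : Filter F.

(** The filter is arbitrary because function, centre and evaluation point will vary together. *)
Definition tends (f : T0 -> C) (l : C) :=
  forall e : R, 0 < e -> F [set t | cabs (f t - l) < e].

Lemma tendsP f l : tends f l <-> (f t @[t --> F] --> l).
Proof.
split=> H; first by apply: (iffRL (@cvg_cabs R T0 F FF f l)).
exact: (iffLR (@cvg_cabs R T0 F FF f l) H).
Qed.

Lemma tends_cst (c : C) : tends (fun=> c) c.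
Proof.
move=> e e0; apply: (@filterS _ F FF setT); last exact: filterT.
by move=> t _ /=; rewrite subrr cabs0.
Qed.

Lemma tends_near_eq (f g : T0 -> C) l : F [set t | f t = g t] -> tends g l -> tends f l.
Proof.
move=> fg gl e /gl; apply: (@filterS2 _ F FF) fg => t /= fg H.
by rewrite fg.
Qed.

Lemma tends_eq (f g : T0 -> C) l : (forall t, f t = g t) -> tends g l -> tends f l.
Proof. by move=> /funext ->. Qed.

Lemma tends_eq2 (f g : T0 -> C) l l' : (forall t, f t = g t) -> l = l' ->
  tends g l' -> tends f l.
Proof. by move=> /funext -> ->. Qed.

Lemma tendsD f g (a b : C) : tends f a -> tends g b -> tends (fun t => f t + g t) (a + b).
Proof.
move=> /tendsP fa /tendsP gb; apply/tendsP.
by apply: (@cvgD C C T0 F FF f g a b); [exact: fa|exact: gb].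
Qed.

Lemma tendsN f (a : C) : tends f a -> tends (fun t => - f t) (- a).
Proof. by move=> fa e /fa; apply: (@filterS _ F FF) => t /=; rewrite -opprD cabsN. Qed.

Lemma tendsB f g (a b : C) : tends f a -> tends g b -> tends (fun t => f t - g t) (a - b).
Proof. by move=> fa gb; apply: tendsD; [exact: fa|exact: tendsN]. Qed.

Lemma tendsM f g (a b : C) : tends f a -> tends g b -> tends (fun t => f t * g t) (a * b).
Proof.
move=> /tendsP fa /tendsP gb; apply/tendsP.
by apply: (@cvgM C T0 F FF f g a b); [exact: fa|exact: gb].
Qed.

Lemma tendsV f (a : C) : a != 0 -> tends f a -> tends (fun t => (f t)^-1) a^-1.
Proof.
move=> a0 /tendsP fa; apply/tendsP.
by apply: (@cvgV C T0 F FF f a); [exact: a0|exact: fa].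
Qed.

Lemma tends_sum (I : Type) (r : seq I) (f : I -> T0 -> C) (l : I -> C) :
  (forall i, tends (f i) (l i)) -> tends (fun t => \sum_(i <- r) f i t) (\sum_(i <- r) l i).
Proof.
move=> fl; elim: r => [|i r IH].
  by rewrite big_nil; apply: (tends_eq _ (tends_cst 0)) => t; rewrite big_nil.
by rewrite big_cons; apply: (tends_eq _ (tendsD (fl i) IH)) => t; rewrite big_cons.
Qed.

Lemma tends_prod (I : Type) (r : seq I) (f : I -> T0 -> C) (l : I -> C) :
  (forall i, tends (f i) (l i)) -> tends (fun t => \prod_(i <- r) f i t) (\prod_(i <- r) l i).
Proof.
move=> fl; elim: r => [|i r IH].
  by rewrite big_nil; apply: (tends_eq _ (tends_cst 1)) => t; rewrite big_nil.
by rewrite big_cons; apply: (tends_eq _ (tendsM (fl i) IH)) => t; rewrite big_cons.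
Qed.

Lemma tends_det n (M : T0 -> 'M[C]_n) (M0 : 'M[C]_n) :
  (forall i j, tends (fun t => M t i j) (M0 i j)) -> tends (fun t => \det (M t)) (\det M0).
Proof.
move=> HM; rewrite /determinant; apply: tends_sum => s.
by apply: tendsM; [exact: tends_cst|apply: tends_prod].
Qed.

Lemma tends_cofactor n (M : T0 -> 'M[C]_n) (M0 : 'M[C]_n) i j :
  (forall i j, tends (fun t => M t i j) (M0 i j)) ->
  tends (fun t => cofactor (M t) i j) (cofactor M0 i j).
Proof.
move=> HM; apply: tendsM; first exact: tends_cst.
by apply: tends_det => k l; rewrite !mxE; apply: (tends_eq _ (HM _ _)) => t; rewrite !mxE.
Qed.

Section PadeLimit.
Variables (a : T0 -> nat -> C) (a0 : nat -> C).
Hypothesis Ha : forall k, tends (fun t => a t k) (a0 k).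

Lemma tends_hankel p q i j : tends (fun t => hankel (a t) p q i j) (hankel a0 p q i j).
Proof.
rewrite mxE; apply: (@tends_eq _ (fun t => coefz (a t) (p%:Z - q%:Z + i%:Z + j%:Z + 1))).
  by move=> t; rewrite mxE.
by case: (_ + 1) => k; [exact: Ha|exact: tends_cst].
Qed.

Lemma tends_pade_vec p q j : in_D a0 p q ->
  tends (fun t => pade_vec (a t) p q j 0) (pade_vec a0 p q j 0).
Proof.
move=> D; have E (b : nat -> C) : pade_vec b p q j 0 =
    - (\det (hankel b p q))^-1 * \sum_k cofactor (hankel b p q) k j * b (p + k).+1.
  by rewrite !mxE; congr (_ * _); apply: eq_bigr => k _; rewrite !mxE.
have H1 := tendsN (tendsV D (tends_det (fun k l => @tends_hankel p q k l))).
have H2 k := tends_cofactor k j (fun m l => @tends_hankel p q m l).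
have H := tendsM H1 (tends_sum (index_enum 'I_q) (fun k => tendsM (H2 k) (Ha (p + k).+1))).
exact: (tends_eq2 (fun t => E (a t)) (E a0) H).
Qed.

Lemma tends_pade_den p q k : in_D a0 p q ->
  tends (fun t => (pade_den (a t) p q)`_k) (pade_den a0 p q)`_k.
Proof.
move=> D; have E (b : nat -> C) : (pade_den b p q)`_k =
    (1 : {poly C})`_k + \sum_(j < q) pade_vec b p q j 0 * ('X^(q - j) : {poly C})`_k.
  by rewrite coefD coef_sum; congr (_ + _); apply: eq_bigr => j _; rewrite coefZ.
have H := tendsD (tends_cst (1 : {poly C})`_k) (tends_sum (index_enum 'I_q)
  (fun j => tendsM (tends_pade_vec j D) (tends_cst ('X^(q - j) : {poly C})`_k))).
exact: (tends_eq2 (fun t => E (a t)) (E a0) H).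
Qed.

Lemma tends_trunc_series N k :
  tends (fun t => (trunc_series N (a t))`_k) (trunc_series N a0)`_k.
Proof.
rewrite coef_poly; apply: (@tends_eq _ (fun t => if (k < N.+1)%N then a t k else 0)).
  by move=> t; rewrite coef_poly.
by case: ifP => _; [exact: Ha|exact: tends_cst].
Qed.

Lemma tends_pade_num p q k : in_D a0 p q ->
  tends (fun t => (pade_num (a t) p q)`_k) (pade_num a0 p q)`_k.
Proof.
move=> D; have E (b : nat -> C) : (pade_num b p q)`_k = if (k < p.+1)%N then
    \sum_(i < k.+1) (trunc_series (p + q) b)`_i * (pade_den b p q)`_(k - i) else 0.
  by rewrite coef_poly coefM.
have H := tends_sum (index_enum 'I_k.+1)
  (fun i => tendsM (tends_trunc_series (p + q) i) (tends_pade_den (k - i) D)).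
have H' : tends (fun t => if (k < p.+1)%N then
      \sum_(i < k.+1) (trunc_series (p + q) (a t))`_i * (pade_den (a t) p q)`_(k - i) else 0)
    (if (k < p.+1)%N then
      \sum_(i < k.+1) (trunc_series (p + q) a0)`_i * (pade_den a0 p q)`_(k - i) else 0).
  by case: (k < p.+1)%N; [exact: H|exact: tends_cst].
exact: (tends_eq2 (fun t => E (a t)) (E a0) H').
Qed.

End PadeLimit.

Lemma tends_horner (P : {poly C}) w (w0 : C) : tends w w0 -> tends (fun t => P.[w t]) P.[w0].
Proof.
move=> Hw e e0; have /nbhs_cabs[d d0 Hd] : \forall x \near w0, cabs (P.[x] - P.[w0]) < e.
  by have /cvg_cabs := @horner_continuous R P w0; apply.
by apply: (@filterS _ F FF) (Hw d d0) => t /Hd.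
Qed.

(** The common bound m on the sizes makes each coefficient of the jet a fixed finite expression in
    the coefficients and the point. *)
Lemma tends_jet (x : T0 -> {poly C}) (x0 : {poly C}) (w : T0 -> C) (w0 : C) m k :
  (forall t, (size (x t) <= m)%N) -> (size x0 <= m)%N ->
  (forall i, tends (fun t => (x t)`_i) x0`_i) -> tends w w0 ->
  tends (fun t => (jet (x t) (w t))`_k) (jet x0 w0)`_k.
Proof.
move=> sx sx0 Hx Hw.
have E (y : {poly C}) v : (size y <= m)%N ->
    (jet y v)`_k = \sum_(i < m) y`_i * ((derivn k 'X^i).[v] / k`!%:R).
  move=> sy; rewrite /jet comp_polyE coef_sum.
  transitivity (\sum_(i < m) (y`_i *: ('X + v%:P) ^+ i)`_k).
    rewrite -(big_mkord xpredT (fun i => (y`_i *: ('X + v%:P) ^+ i)`_k)).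
    rewrite -(big_mkord xpredT (fun i => (y`_i *: ('X + v%:P) ^+ i)`_k)).
    rewrite [RHS](big_cat_nat (leq0n _) sy) /= [X in _ = _ + X]big_nat_cond.
    rewrite [X in _ = _ + X]big1 ?addr0 // => i /andP[/andP[si _] _].
    by rewrite coefZ (nth_default _ si) mul0r.
  apply: eq_bigr => i _; rewrite coefZ; congr (_ * _).
  have -> : ('X + v%:P) ^+ i = jet 'X^i v by rewrite /jet comp_Xn_poly.
  by rewrite -jet_derivn mulrC mulKf // pnatr_eq0 -lt0n fact_gt0.
have H := tends_sum (index_enum 'I_m) (fun i => tendsM (Hx i)
  (tendsM (tends_horner (derivn k 'X^i) Hw) (tends_cst (k`!%:R^-1)))).
exact: (tends_eq2 (fun t => E (x t) (w t) (sx t)) (E x0 w0 sx0) H).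
Qed.

Lemma tends_neq0 f (l : C) : tends f l -> l != 0 -> F [set t | f t != 0].
Proof.
move=> fl l0; have := fl (cabs l); rewrite cabs_gt0 => /(_ l0).
apply: (@filterS _ F FF) => t /=; apply: contraTneq => ->.
by rewrite sub0r cabsN ltxx.
Qed.

(** The coefficients of the quotient of y by b follow recursively from those of y and b, dividing
    only by the constant term of b. *)
Lemma tends_quotient N (Q b y : T0 -> {poly C}) (Q0 b0 y0 : {poly C}) :
  F [set t | jeq N (Q t * b t) (y t)] -> jeq N (Q0 * b0) y0 -> b0`_0 != 0 ->
  (forall k, tends (fun t => (b t)`_k) b0`_k) -> (forall k, tends (fun t => (y t)`_k) y0`_k) ->
  forall k, (k <= N)%N -> tends (fun t => (Q t)`_k) Q0`_k.
Proof.
move=> HQ HQ0 b00 Hb Hy; elim/ltn_ind => k IH kN.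
have E (q c v : {poly C}) : jeq N (q * c) v -> c`_0 != 0 ->
    q`_k = (v`_k - \sum_(i < k) q`_i * c`_(k - i)) / c`_0.
  by move=> qv c0; rewrite -qv // coefM big_ord_recr /= subnn addrAC subrr add0r mulfK.
rewrite (E _ _ _ HQ0 b00).
apply: (@tends_near_eq _ (fun t => ((y t)`_k - \sum_(i < k) (Q t)`_i * (b t)`_(k - i)) / (b t)`_0)).
  apply: (@filterS2 _ F FF) HQ (tends_neq0 (Hb 0%N) b00) => t /= Ht bt.
  by rewrite (E _ _ _ Ht bt).
have IH' (i : 'I_k) := IH i (ltn_ord i) (leq_trans (ltnW (ltn_ord i)) kN).
exact: tendsM (tendsB (Hy k) (tends_sum (index_enum 'I_k) (fun i => tendsM (IH' i) (Hb (k - i)%N))))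
  (tendsV b00 (Hb 0%N)).
Qed.

Section PadeValue.
Variables (a : T0 -> nat -> C) (a0 : nat -> C) (zeta z : T0 -> C) (zeta0 z0 : C).
Hypothesis Ha : forall k, tends (fun t => a t k) (a0 k).
Hypotheses (Hzeta : tends zeta zeta0) (Hz : tends z z0).

Lemma near_in_D p q : in_D a0 p q -> F [set t | in_D (a t) p q].
Proof.
move=> D; have H := tends_det (fun i j => tends_hankel Ha p (q := q) i j).
exact: tends_neq0 H D.
Qed.

(** The derivatives at z are coefficients of the quotient of the jets of numerator and denominator
    at z - zeta, both of which vary continuously while the Hankel determinant stays nonzero. *)
Lemma tends_pade p q l : in_D a0 p q -> (pade a0 zeta0 p q).2.[z0] != 0 ->
  F [set t | (pade (a t) (zeta t) p q).2.[z t] != 0] /\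
  tends (fun t => derive1n l (ratfun (pade (a t) (zeta t) p q)) (z t))
    (derive1n l (ratfun (pade a0 zeta0 p q)) z0).
Proof.
move=> D; have nD := near_in_D D.
have Hw : tends (fun t => z t - zeta t) (z0 - zeta0) by exact: tendsB.
have den k : tends (fun t => (jet (pade_den (a t) p q) (z t - zeta t))`_k)
    (jet (pade_den a0 p q) (z0 - zeta0))`_k.
  exact: tends_jet k (fun t => size_pade_den (a t) p q) (size_pade_den a0 p q)
    (fun i => tends_pade_den Ha i D) Hw.
have num k : tends (fun t => (jet (pade_num (a t) p q) (z t - zeta t))`_k)
    (jet (pade_num a0 p q) (z0 - zeta0))`_k.
  exact: tends_jet k (fun t => size_poly p.+1 _) (size_poly p.+1 _)
    (fun i => tends_pade_num Ha i D) Hw.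
have padeB (b : nat -> C) x y : in_D b p q ->
    (pade b x p q).2.[y] = (jet (pade_den b p q) (y - x))`_0.
  by move=> Db; rewrite (padeE x Db) /= -jet_coef0 jet_shift.
rewrite padeB // => B0.
have nB : F [set t | (pade (a t) (zeta t) p q).2.[z t] != 0].
  by apply: (@filterS2 _ F FF) nD (tends_neq0 (den 0%N) B0) => t /= Dt; rewrite padeB.
split=> //.
pose Q (b : nat -> C) x y := qjet l (pade b x p q).1 (pade b x p q).2 y.
have QE (b : nat -> C) x y : (pade b x p q).2.[y] != 0 ->
    derive1n l (ratfun (pade b x p q)) y = l`!%:R * (Q b x y)`_l.
  by rewrite /Q; case: (pade b x p q) => A B /= Bn; exact: derive1n_ratfun.
have QJ (b : nat -> C) x y : in_D b p q -> (pade b x p q).2.[y] != 0 ->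
    jeq l (Q b x y * jet (pade_den b p q) (y - x)) (jet (pade_num b p q) (y - x)).
  move=> Db Bn; have : jeq l _ _ := qjetP (pade b x p q).1 Bn.
  by rewrite /Q (padeE x Db) /= !jet_shift.
have Bn0 : (pade a0 zeta0 p q).2.[z0] != 0 by rewrite padeB.
rewrite (QE _ _ _ Bn0).
apply: (@tends_near_eq _ (fun t => l`!%:R * (Q (a t) (zeta t) (z t))`_l)).
  by apply: (@filterS _ F FF) nB => t /= Bt; rewrite QE.
have nQ : F [set t | jeq l (Q (a t) (zeta t) (z t) * jet (pade_den (a t) p q) (z t - zeta t))
    (jet (pade_num (a t) p q) (z t - zeta t))].
  by apply: (@filterS2 _ F FF) nD nB => t /= Dt Bt; exact: QJ.
exact: tendsM (tends_cst _) (tends_quotient nQ (QJ _ _ _ D Bn0) B0 den num (leqnn l)).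
Qed.

Lemma tends_taylor_sum N l :
  tends (fun t => derive1n l (taylor_sum (a t) (zeta t) N) (z t))
    (derive1n l (taylor_sum a0 zeta0 N) z0).
Proof.
have E (b : nat -> C) x y : derive1n l (taylor_sum b x N) y =
    l`!%:R * (jet (trunc_series N b) (y - x))`_l.
  rewrite (_ : taylor_sum b x N = horner (trunc_series N b \Po ('X - x%:P))).
    by rewrite derive1n_horner jet_shift.
  apply/funext => v; rewrite horner_comp hornerXsubC horner_poly.
  by apply: eq_bigr.
have H := tends_jet l (fun t => size_poly N.+1 (a t)) (size_poly N.+1 a0)
  (tends_trunc_series Ha N) (tendsB Hz Hzeta).
exact: (tends_eq2 (fun t => E (a t) (zeta t) (z t)) (E a0 zeta0 z0) (tendsM (tends_cst l`!%:R) H)).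
Qed.

End PadeValue.

End Continuity.

(** * Openness *)

Section Openness.
Context {R : realType}.
Local Notation C := R[i].
Variables (Omega : set C) (L : nat -> set C).
Hypothesis L_closure : forall n, closure (L n `&` Omega) = L n.
Local Notation T := (Tinf Omega L).
Implicit Types (f g : T).

Lemma Topen_nbhs (V : set T) : Topen V <-> forall f, V f -> exists N, exists2 e : R, 0 < e &
  forall g, (forall n l, (n <= N)%N -> (l <= N)%N -> forall z, L n z ->
    cabs (dext Omega (L n) g l z - dext Omega (L n) f l z) < e) -> V g.
Proof.
split=> H f /H[N [e e0 He]]; exists N.
  exists (e / 2); first by rewrite divr_gt0.
  move=> g Hg; apply: He => n l nN lN; apply: (@le_lt_trans _ _ (e / 2)%:E).
    by apply: Tdist_le => [|z Lz]; [rewrite divr_ge0 // ltW|exact/ltW/Hg].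
  by rewrite lte_fin ltr_pdivrMr // ltr_pMr // ltr1n.
exists e => // g Hg; apply: He => n l nN lN z Lz.
by apply: Tdist_lt Lz; exact: Hg.
Qed.

Lemma nbhs_Tinf f (A : set T) : nbhs f A <-> exists N, exists2 e : R, 0 < e &
  forall g, (forall n l, (n <= N)%N -> (l <= N)%N -> forall z, L n z ->
    cabs (dext Omega (L n) g l z - dext Omega (L n) f l z) < e) -> A g.
Proof.
split.
  rewrite nbhsE => -[B [oB Bf] BA].
  have /Topen_nbhs/(_ f Bf)[N [e e0 He]] : Topen B by exact: oB.
  by exists N, e => // g /He/BA.
move=> [N [e e0 He]].
(* The intermediate bound d < e makes B open; pointwise strict inequalities alone would allow the
   supremum to reach e. *)
pose B : set T := [set g | exists2 d : R, 0 <= d < e & forall n l, (n <= N)%N -> (l <= N)%N ->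
  forall z, L n z -> cabs (dext Omega (L n) g l z - dext Omega (L n) f l z) <= d].
have oB : open B.
  have : Topen B; last by [].
  apply/Topen_nbhs => g [d /andP[d0 de] Hd].
  exists N, ((e - d) / 2); first by rewrite divr_gt0 // subr_gt0.
  move=> k Hk; exists (d + (e - d) / 2).
    by apply/andP; split; [rewrite addr_ge0 // divr_ge0 // subr_ge0 ltW|lra].
  move=> n l nN lN z Lz.
  apply: le_trans (cabs_triangle _ _ (dext Omega (L n) g l z)) _.
  by rewrite addrC lerD ?Hd // ltW ?Hk.
rewrite nbhsE; exists B.
  split=> //; exists 0; first by rewrite lexx.
  by move=> n l _ _ z _; rewrite subrr cabs0.
move=> g [d /andP[d0 de] Hd]; apply: He => n l nN lN z Lz.
by apply: le_lt_trans de; exact: Hd.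
Qed.

Section Limits.
Variables (T0 : Type) (F : set_system T0).
Hypothesis FF : Filter F.
Variables (f : T) (g : T0 -> T) (n : nat).
Hypothesis gf : forall A, nbhs f A -> F [set t | A (g t)].

(** Joint continuity: uniform closeness of [g t] to f on [L n], together with uniform continuity of
    the extension of f. *)
Lemma tends_dext (x : T0 -> C) (x0 : C) l : F [set t | L n (x t)] -> L n x0 ->
  tends F x x0 -> tends F (fun t => dext Omega (L n) (g t) l (x t)) (dext Omega (L n) f l x0).
Proof.
move=> FL Lx0 Hx e e0; have e2 : 0 < e / 2 by rewrite divr_gt0.
have [d d0 Hd] := dext_ucont L_closure f n l e2.
pose A : set T := [set h | forall z, L n z ->
  cabs (dext Omega (L n) h l z - dext Omega (L n) f l z) < e / 2].
have nA : nbhs f A.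
  apply/nbhs_Tinf; exists (maxn n l), (e / 2) => // h Hh z Lz.
  by apply: Hh Lz; rewrite ?leq_maxl ?leq_maxr.
apply: (@filterS2 _ F FF) (gf nA) (@filterI _ F FF _ _ FL (Hx d d0)) => t /= At [Lt xt].
apply: le_lt_trans (cabs_triangle _ _ (dext Omega (L n) f l (x t))) _.
by rewrite [e]splitr ltrD ?At ?Hd.
Qed.

Lemma tends_taylor_coef (x : T0 -> C) (x0 : C) k : F [set t | L n (x t)] -> L n x0 ->
  tends F x x0 ->
  tends F (fun t => taylor_coef Omega (L n) (g t) (x t) k) (taylor_coef Omega (L n) f x0 k).
Proof.
move=> FL Lx0 Hx; rewrite /taylor_coef.
exact: (tendsM FF (tends_dext k FL Lx0 Hx) (tends_cst FF (k`!%:R^-1))).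
Qed.

End Limits.

Lemma pade_err_lt (a : nat -> C) zeta p q l z w (e : R) :
  (pade_err a zeta p q l z w < e%:E)%E <->
  (pade a zeta p q).2.[z] != 0 /\ cabs (derive1n l (ratfun (pade a zeta p q)) z - w) < e.
Proof.
rewrite /pade_err; case: eqVneq => B0; last by rewrite lte_fin; split => // -[].
by split => // -[].
Qed.

(** A tube lemma. Nearby points are restricted to A and B, since extended derivatives are controlled
    only on the sets [L n]. *)
Lemma near_compact2 (A B : set C) (f : T) (P : C -> C -> T -> Prop) : compact A -> compact B ->
  (forall x y, A x -> B y -> (within [set t : (C * C) * T | A t.1.1 /\ B t.1.2]
     (filter_prod (nbhs (x, y)) (nbhs f))) [set t | P t.1.1 t.1.2 t.2]) ->
  \forall g \near f, forall x y, A x -> B y -> P x y g.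
Proof.
move=> cA cB H; have cAB := compact_setX cA cB.
move/compact_near_coveringP/near_covering_withinP : cAB => cAB.
have H2 : \forall g \near nbhs f, (A `*` B) `<=` (fun xy => P xy.1 xy.2 g).
  apply: cAB => -[x y] [/= Ax By]; have := H x y Ax By; rewrite /within /=.
  by apply: filterS => -[[x' y'] g] /= Hxy [Ax' By']; exact: Hxy.
by apply: (@filterS _ (nbhs f) _ _ _ _ H2) => g Hg x y Ax By; exact: (Hg (x, y)).
Qed.

Section Good.
Variables (p q : nat) (K : set C) (m : nat).
Hypothesis L_compact : forall n, compact (L n).
Hypothesis K_compact : compact K.

(** One index and one order l, with strict pointwise inequalities, which compactness turns into an
    open condition; suprema return only in the passage to limits. *)
Definition good_at (P : {poly C}) (e : R) (l : nat) : set T := [set f |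
  let a := taylor_coef Omega (L m) f in
  let df := dext Omega (L m) f in
  forall zeta, L m zeta -> [/\ in_D (a zeta) p q,
    forall z, L m z -> (pade_err (a zeta) zeta p q l z (df l z) < e%:E)%E,
    forall z, K z -> (pade_err (a zeta) zeta p q l z (derive1n l (horner P) z) < e%:E)%E,
    forall z, L m z -> cabs (derive1n l (taylor_sum (a zeta) zeta p) z - df l z) < e &
    forall z, K z -> cabs (derive1n l (taylor_sum (a zeta) zeta p) z -
                           derive1n l (horner P) z) < e]].

Lemma tends_near_lt (T0 : Type) (F : set_system T0) (FF : Filter F) (h : T0 -> C) h0 (e : R) :
  tends F h h0 -> cabs h0 < e -> F [set t | cabs (h t) < e].
Proof.
move=> hh he; have := hh (e - cabs h0); rewrite subr_gt0 => /(_ he).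
apply: (@filterS _ F FF) => t /= H; have := cabsD (h t - h0) h0.
by rewrite subrK; lra.
Qed.

Lemma open_good_at P e l : open (good_at P e l).
Proof.
rewrite openE => f Hf.
(* The filter of triples (centre, evaluation point, function) tending to (x, y, f) with the points
   kept in A and B. *)
pose F (A B : set C) (x y : C) := within [set t : (C * C) * T | A t.1.1 /\ B t.1.2]
     (filter_prod (nbhs (x, y)) (nbhs f)).
have FF A B x y : Filter (F A B x y) by exact: within_filter.
have Fg A B x y (V : set T) : nbhs f V -> F A B x y [set t | V t.2].
  move=> fV; exists (setT, V); first by split => //=; exact: filterT.
  by move=> [xy g] /= [_ Vg] _.
have FA A B x y : F A B x y [set t | A t.1.1].
  by apply: (@filterS _ (filter_prod (nbhs (x, y)) (nbhs f)) _ setT); [move=> t _ /= []|exact: filterT].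
have FB A B x y : F A B x y [set t | B t.1.2].
  by apply: (@filterS _ (filter_prod (nbhs (x, y)) (nbhs f)) _ setT); [move=> t _ /= []|exact: filterT].
have F1 A B x y : tends (F A B x y) (fun t => t.1.1) x.
  move=> d d0; exists ([set t : C * C | cabs (t.1 - x) < d], setT).
    split => /=; last exact: filterT.
    by exists ([set w | cabs (w - x) < d], setT);
      [split => /=; [by apply/nbhs_cabs; exists d|exact: filterT]|move=> [a b] /= []].
  by move=> [xy g] /= [H _] _.
have F2 A B x y : tends (F A B x y) (fun t => t.1.2) y.
  move=> d d0; exists ([set t : C * C | cabs (t.2 - y) < d], setT).
    split => /=; last exact: filterT.
    by exists (setT, [set w | cabs (w - y) < d]);
      [split => /=; [exact: filterT|by apply/nbhs_cabs; exists d]|move=> [a b] /= []].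
  by move=> [xy g] /= [H _] _.
have Fa B x y k : L m x -> tends (F (L m) B x y)
    (fun t => taylor_coef Omega (L m) t.2 t.1.1 k) (taylor_coef Omega (L m) f x k).
  move=> Lx; apply: (tends_taylor_coef (FF _ _ _ _) (Fg _ _ _ _)) => //.
have Fd A x y : L m y -> tends (F A (L m) x y)
    (fun t => dext Omega (L m) t.2 l t.1.2) (dext Omega (L m) f l y).
  move=> Ly; apply: (tends_dext (FF _ _ _ _) (Fg _ _ _ _)) => //.
have FP A B x y : tends (F A B x y) (fun t => derive1n l (horner P) t.1.2) (derive1n l (horner P) y).
  rewrite derive1n_horner_deriv; exact: (tends_horner (FF _ _ _ _) _ (F2 A B x y)).
have padeN B x y (w : (C * C) * T -> C) w0 : L m x -> tends (F (L m) B x y) w w0 ->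
    (pade_err (taylor_coef Omega (L m) f x) x p q l y w0 < e%:E)%E ->
    F (L m) B x y [set t : (C * C) * T |
      (pade_err (taylor_coef Omega (L m) t.2 t.1.1) t.1.1 p q l t.1.2 (w t) < e%:E)%E].
  move=> Lx ww /pade_err_lt[B0 err].
  have [D _ _ _ _] := Hf x Lx.
  have [nB tB] := tends_pade (FF _ _ _ _) (fun k => Fa B x y k Lx) (F1 _ _ x y) (F2 _ _ x y) l D B0.
  have nlt := tends_near_lt (FF _ _ _ _) (tendsB (FF _ _ _ _) tB ww) err.
  apply: (@filterS2 _ _ (FF (L m) B x y)) nB nlt => t /= H1 H2.
  by apply/pade_err_lt.
(* The second point y is a dummy that brings the condition into the shape of [near_compact2]. *)
have nD : nbhs f [set g : T | forall x y, L m x -> L m y -> in_D (taylor_coef Omega (L m) g x) p q].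
  apply: near_compact2 => // x y Lx Ly.
  have [D _ _ _ _] := Hf x Lx.
  exact: (near_in_D (FF _ _ _ _) (fun k => Fa (L m) x y k Lx) D).
have n1 : nbhs f [set g : T | forall x y, L m x -> L m y ->
    (pade_err (taylor_coef Omega (L m) g x) x p q l y (dext Omega (L m) g l y) < e%:E)%E].
  apply: near_compact2 => // x y Lx Ly; have [_ H _ _ _] := Hf x Lx.
  exact: (padeN (L m) x y _ _ Lx (Fd _ _ _ Ly) (H y Ly)).
have n2 : nbhs f [set g : T | forall x y, L m x -> K y ->
    (pade_err (taylor_coef Omega (L m) g x) x p q l y (derive1n l (horner P) y) < e%:E)%E].
  apply: near_compact2 => // x y Lx Ky; have [_ _ H _ _] := Hf x Lx.
  exact: (padeN K x y _ _ Lx (FP _ _ _ _) (H y Ky)).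
have n3 : nbhs f [set g : T | forall x y, L m x -> L m y ->
    cabs (derive1n l (taylor_sum (taylor_coef Omega (L m) g x) x p) y - dext Omega (L m) g l y) < e].
  apply: near_compact2 => // x y Lx Ly; have [_ _ _ H _] := Hf x Lx.
  apply: (tends_near_lt (FF _ _ _ _) _ (H y Ly)).
  apply: (tendsB (FF _ _ _ _) _ (Fd _ _ _ Ly)).
  exact: (tends_taylor_sum (FF _ _ _ _) (fun k => Fa (L m) x y k Lx) (F1 _ _ _ _) (F2 _ _ _ _)).
have n4 : nbhs f [set g : T | forall x y, L m x -> K y ->
    cabs (derive1n l (taylor_sum (taylor_coef Omega (L m) g x) x p) y - derive1n l (horner P) y) < e].
  apply: near_compact2 => // x y Lx Ky; have [_ _ _ _ H] := Hf x Lx.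
  apply: (tends_near_lt (FF _ _ _ _) _ (H y Ky)).
  apply: (tendsB (FF _ _ _ _) _ (FP _ _ _ _)).
  exact: (tends_taylor_sum (FF _ _ _ _) (fun k => Fa K x y k Lx) (F1 _ _ _ _) (F2 _ _ _ _)).
rewrite /interior.
have nI (A B : set T) : nbhs f A -> nbhs f B -> nbhs f [set g : T | A g /\ B g].
  by move=> nA nB; exact: (@filterI _ _ (nbhs_filter f) A B nA nB).
have N4 := nI _ _ nD (nI _ _ (nI _ _ n1 n2) (nI _ _ n3 n4)).
apply: (@filterS _ _ (nbhs_filter f) _ _ _ N4) => g /= [Dg [[G1 G2] [G3 G4]]] a df zeta Lz; split.
- exact: (Dg _ _ Lz Lz).
- by move=> z; exact: G1.
- by move=> z; exact: G2.
- by move=> z; exact: G3.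
- by move=> z; exact: G4.
Qed.

End Good.

End Openness.

(** * Iterated suprema tending to zero *)

Section SupLimits.
Context {R : realType}.
Local Notation C := R[i].
Implicit Types (A B : set C) (u : nat -> C -> C -> \bar R).

Lemma sup0_cvg0 A B u : (forall e : R, 0 < e -> exists J, forall n, (J <= n)%N ->
    forall x y, A x -> B y -> (u n x y <= e%:E)%E) ->
  (fun n => Defs.sup0 A (fun x => Defs.sup0 B (u n x))) @ \oo --> 0%E.
Proof.
move=> H; set v := fun n => _.
have v0 n : (0 <= v n)%E by exact: sup0_ge0.
have vle (e : R) : 0 < e -> exists J, forall n, (J <= n)%N -> (v n <= e%:E)%E.
  move=> e0; have [J HJ] := H e e0; have e1 : (0 <= e%:E)%E by rewrite lee_fin ltW.
  exists J => n Jn; apply: sup0_le => // x Ax; apply: sup0_le => // y By.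
  exact: HJ.
apply/fine_cvgP; split.
  have [J HJ] := vle 1 ltr01; exists J => // n /= Jn.
  by rewrite ge0_fin_numE //; apply: le_lt_trans (HJ n Jn) (ltry _).
apply/cvgrPdist_le => e e0; have [J HJ] := vle e e0; exists J => // n /= Jn.
have vn : v n \is a fin_num by rewrite ge0_fin_numE //; apply: le_lt_trans (HJ n Jn) (ltry _).
by rewrite sub0r normrN ger0_norm ?fine_ge0 // -lee_fin fineK // HJ.
Qed.

Lemma cvg0_sup0 A B u (e : R) : (fun n => Defs.sup0 A (fun x => Defs.sup0 B (u n x))) @ \oo --> 0%E ->
  0 < e -> exists J, forall n, (J <= n)%N -> forall x y, A x -> B y -> (u n x y < e%:E)%E.
Proof.
move=> H e0; have [|J _ HJ] := H [set x | (x < e%:E)%E].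
  by apply: open_nbhs_nbhs; split; [exact: open_ereal_lt_ereal|rewrite /= lte_fin].
exists J => n Jn x y Ax By; apply: le_lt_trans (HJ n Jn).
apply: le_trans (sup0_ub _ By) _.
exact: (sup0_ub (fun x => Defs.sup0 B (u n x)) Ax).
Qed.

End SupLimits.

(** * A countable dense family of polynomials *)

Section RationalPolynomials.
Context {R : realType}.
Local Notation C := R[i].

(** Coefficient lists of rational pairs form a countable type, so targets can be enumerated by
    [pickle]. *)
Definition rat_poly (s : seq (rat * rat)) : {poly C} :=
  foldr (fun c Q => Q * 'X + ((ratr c.1 +i* ratr c.2)%C)%:P) 0 s.

Lemma rat_dense (x e : R) : 0 < e -> exists r : rat, `|ratr r - x| <= e.
Proof.
move=> e0; have [|r] := @rat_in_itvoo R (x - e) (x + e); first by lra.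
by rewrite in_itv /= => /andP[H1 H2]; exists r; rewrite ler_distl; apply/andP; split; lra.
Qed.

(** Horner's scheme: half of e is left for the quotient, scaled by the bound M on the jets of z, and
    a quarter for each part of the constant term. *)
Lemma rat_poly_dense N (K : set C) (P : {poly C}) (e : R) : compact K -> 0 < e ->
  exists s, forall z, K z -> jnorm N 1 (jet (rat_poly s) z - jet P z) <= e.
Proof.
move=> cK; have [r r0 Kr] := compact_cabs_bounded cK.
have [M M0 HM] := jnorm_jet_bound N (ltr01 : 0 < (1 : R)) 'X r.
elim/poly_ind: P e => [|P c IH] e e0.
  by exists [::] => z _; rewrite subrr jnormC // cabs0 ltW.
have [s Hs] := IH (e / 2 / M) (divr_gt0 (divr_gt0 e0 (ltr0Sn _ 1)) M0).
have e4 : 0 < e / 4 by rewrite divr_gt0.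
have [a Ha] := rat_dense (complex.Re c) e4; have [b Hb] := rat_dense (complex.Im c) e4.
exists ((a, b) :: s) => z Kz; rewrite /= !jetD !jetM !jetC opprD addrACA -mulrBl -polyCB.
apply: le_trans (jnormD _ ltr01 _ _) _; rewrite // jnormC //.
have H1 := jnormM N (ltr01 : 0 < (1 : R)) (jet (rat_poly s) z - jet P z) (jet 'X z).
have H2 : jnorm N 1 (jet (rat_poly s) z - jet P z) * jnorm N 1 (jet 'X z) <= e / 2 / M * M.
  by apply: ler_pM; rewrite ?jnorm_ge0 ?Hs // HM // ltW // Kr.
have H3 := cabs_ReIm ((ratr a +i* ratr b)%C - c).
rewrite divfK ?gt_eqF // in H2; case: c => x y in Ha Hb H3 *; rewrite /= in Ha Hb H3.
by move: (cabs _) H3 => t; lra.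
Qed.

Lemma jnorm_derivn N l (u v : {poly C}) (e : R) z : (l <= N)%N -> jnorm N 1 (jet u z - jet v z) <= e ->
  cabs ((derivn l u).[z] - (derivn l v).[z]) <= N`!%:R * e.
Proof.
move=> lN uv; rewrite -!jet_derivn -mulrBr -coefB cabsM cabs_nat.
have := jnorm_coef ltr01 (jet u z - jet v z) lN.
rewrite expr1n mulr1 => /le_trans/(_ uv) H1.
have H2 : (l`!%:R : R) <= N`!%:R by rewrite ler_nat leq_fact.
by apply: le_trans (ler_pM _ _ H2 H1) _; rewrite ?ler0n ?cabs_ge0.
Qed.

End RationalPolynomials.

(** * Universal functions as a countable intersection *)

Section Universality.
Context {R : realType}.
Local Notation C := R[i].
Variables (Omega : set C) (L : nat -> set C) (p q : nat -> nat) (K : set C) (m : nat).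
Hypothesis L_closure : forall n, closure (L n `&` Omega) = L n.
Hypothesis L_compact : forall n, compact (L n).
Hypothesis K_compact : compact K.
Local Notation T := (Tinf Omega L).
Implicit Types (P : {poly C}) (f g : T).

Definition good_some P (s : nat) : set T := [set f | exists2 n, (s <= n)%N &
  forall l, (l <= s)%N -> good_at (p n) (q n) K m P s.+1%:R^-1 l f].

Lemma open_good_some P s : open (good_some P s).
Proof.
have -> : good_some P s = \bigcup_(n in [set n | (s <= n)%N])
    [set f : T | forall l : nat, (l <= s)%N -> good_at (p n) (q n) K m P s.+1%:R^-1 l f].
  by rewrite predeqE => f; split => -[n]; exists n.
apply: bigcup_open => n _; elim: {1}s => [|t IH].
  have <- : good_at (p n) (q n) K m P s.+1%:R^-1 0 =
      [set f : T | forall l : nat, (l <= 0)%N -> good_at (p n) (q n) K m P s.+1%:R^-1 l f].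
    rewrite predeqE => f; split => [H l|]; last exact.
    by rewrite leqn0 => /eqP->.
  exact: open_good_at.
have -> : [set f : T | forall l : nat, (l <= t.+1)%N -> good_at (p n) (q n) K m P s.+1%:R^-1 l f] =
    [set f : T | forall l : nat, (l <= t)%N -> good_at (p n) (q n) K m P s.+1%:R^-1 l f] `&`
    good_at (p n) (q n) K m P s.+1%:R^-1 t.+1.
  rewrite predeqE => f; split => [H|[H1 H2] l].
    by split => [l lt|]; apply: H => //; exact: leqW.
  by rewrite leq_eqVlt => /orP[/eqP->|]; [|exact: H1].
by apply: openI => //; exact: open_good_at.
Qed.

(** s >= 2 t + 1 means 2/(s + 1) <= 1/(t + 1): one half for the error against Q, one half for
    replacing Q by P on K. *)
Lemma good_some_le P Q (s t : nat) : ((t.*2.+1) <= s)%N ->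
  (forall z l, K z -> (l <= t)%N -> cabs ((derivn l Q).[z] - (derivn l P).[z]) <= s.+1%:R^-1) ->
  good_some Q s `<=` good_some P t.
Proof.
move=> ts QP f [n sn H]; exists n; first by lia.
have s0 : (0 : R) < s.+1%:R^-1 by rewrite invr_gt0 ltr0n.
have st : s.+1%:R^-1 + s.+1%:R^-1 <= t.+1%:R^-1 :> R.
  have -> : s.+1%:R^-1 + s.+1%:R^-1 = 2 / s.+1%:R :> R.
    by rewrite (mulrDl 1 1) mul1r.
  rewrite ler_pdivrMr ?ltr0n // ler_pdivlMl ?ltr0n // -natrM ler_nat.
  by rewrite muln2 doubleS ltnS.
move=> l lt a df zeta Lz; have [|D H1 H2 H3 H4] := H l _ zeta Lz; first by lia.
have le1 : s.+1%:R^-1 <= t.+1%:R^-1 :> R by apply: le_trans st; rewrite lerDl ltW.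
have QPz z (w : C) : K z -> cabs (w - derive1n l (horner Q) z) < s.+1%:R^-1 ->
    cabs (w - derive1n l (horner P) z) < t.+1%:R^-1.
  rewrite !derive1n_horner_deriv => Kz wd; apply: lt_le_trans st.
  apply: le_lt_trans (cabs_triangle _ _ (derivn l Q).[z]) _.
  by rewrite ltr_leD // QP.
split => //.
- by move=> z Lzz; apply: lt_le_trans (H1 z Lzz) _; rewrite lee_fin.
- by move=> z Kz; have /pade_err_lt[B0 err] := H2 z Kz; apply/pade_err_lt; split => //; exact: QPz.
- by move=> z Lzz; apply: lt_le_trans (H3 z Lzz) _.
- by move=> z Kz; apply: QPz => //; exact: H4.
Qed.

(** Forward, a late term of the subsequence meets finitely many orders at once. Backward, indices
    for growing s are chained into a subsequence; the error at order l is controlled from step l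
    on. *)
Lemma universalP (f : Yinf Omega L) : pade_universal Omega L p q K m f <->
  forall P s, good_some P s (set_val f).
Proof.
split=> [H P s|H f1 E a df S0 P].
  have [k [k_incr kD kl]] := H P.
  have s0 : (0 : R) < s.+1%:R^-1 by rewrite invr_gt0 ltr0n.
  have key l : exists J, forall n, (J <= n)%N -> good_at (p (k n)) (q (k n)) K m P s.+1%:R^-1 l (set_val f).
    have [/cvg0_sup0/(_ s0)[J1 H1] /cvg0_sup0/(_ s0)[J2 H2] /cvg0_sup0/(_ s0)[J3 H3]
      /cvg0_sup0/(_ s0)[J4 H4]] := kl l.
    exists (maxn (maxn J1 J2) (maxn J3 J4)) => n; rewrite !geq_max => /andP[/andP[n1 n2] /andP[n3 n4]].
    move=> zeta Lz; split => [|z Lzz|z Kz|z Lzz|z Kz].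
    - exact: kD.
    - exact: H1.
    - exact: H2.
    - by rewrite -lte_fin; exact: H3.
    - by rewrite -lte_fin; exact: H4.
  have [J HJ] := choice key.
  (* As k n >= n, this index is at least s, and it lies beyond the thresholds [J l] of all orders l
     <= s. *)
  pose n := (s + \max_(l < s.+1) J l)%N.
  have kge j : (j <= k j)%N.
    elim: j => // j IH; apply: leq_ltn_trans IH _.
    by move/increasing_seqP: k_incr => /(_ j).
  exists (k n); first by apply: leq_trans (kge n); exact: leq_addr.
  move=> l; rewrite -ltnS => ls; apply: HJ; apply: leq_trans (leq_addl _ _).
  exact: (leq_bigmax (Ordinal ls)).
have H' s : exists n, (s <= n)%N /\
    forall l, (l <= s)%N -> good_at (p n) (q n) K m P s.+1%:R^-1 l (set_val f).
  by have [n sn Hn] := H P s; exists n.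
have [N HN] := choice H'.
(* Asking next for an index beyond the one just found makes the indices strictly increase. *)
pose S j := iter j (fun s => (N s).+1) 0%N.
have NS j : (S j <= N (S j))%N by have [] := HN (S j).
have Sj j : (j <= S j)%N by elim: j => // j IH; rewrite /S iterS ltnS; exact: leq_trans IH (NS j).
have Hgood j l : (l <= j)%N -> good_at (p (N (S j))) (q (N (S j))) K m P j.+1%:R^-1 l (set_val f).
  move=> lj a1 df1 zeta Lz; have [_ /(_ l (leq_trans lj (Sj j)))] := HN (S j).
  have le1 : (S j).+1%:R^-1 <= j.+1%:R^-1 :> R by rewrite lef_pV2 ?posrE ?ltr0n // ler_nat ltnS.
  move=> G; have [D H1 H2 H3 H4] := G zeta Lz; split => // w Lw.
  - by apply: lt_le_trans (H1 w Lw) _; rewrite lee_fin.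
  - by apply: lt_le_trans (H2 w Lw) _; rewrite lee_fin.
  - by apply: lt_le_trans (H3 w Lw) _.
  - by apply: lt_le_trans (H4 w Lw) _.
have small l (e : R) : 0 < e -> exists J, forall j, (J <= j)%N -> (l <= j)%N /\ j.+1%:R^-1 <= e.
  move=> e0; have /cvgrPdist_le/(_ e e0)[J _ HJ] := @cvg_harmonic R.
  exists (maxn J l) => j; rewrite geq_max => /andP[Jj lj]; split=> //.
  have := HJ j Jj; rewrite /= sub0r normrN => /(le_trans (ler_norm _)).
  exact.
exists (fun j => N (S j)); split.
- by apply/increasing_seqP => j; have := NS j.+1.
- move=> n zeta Lz; have [D _ _ _ _] := Hgood n 0%N (leq0n n) zeta Lz; exact: D.
- move=> l; split; apply: sup0_cvg0 => e e0; have [J HJ] := small l e e0; exists J => j /HJ[lj je] x y Lx Ly;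
    have [D H1 H2 H3 H4] := Hgood j l lj x Lx.
  + by apply: ltW; apply: lt_le_trans (H1 y Ly) _; rewrite lee_fin.
  + by apply: ltW; apply: lt_le_trans (H2 y Ly) _; rewrite lee_fin.
  + by rewrite lee_fin; apply: ltW; apply: lt_le_trans (H3 y Ly) _.
  + by rewrite lee_fin; apply: ltW; apply: lt_le_trans (H4 y Ly) _.
Qed.

(** Numbers that decode to nothing impose no condition. *)
Definition good_code (j : nat) : set T :=
  if unpickle j is Some (s, t) then good_some (rat_poly s) t else setT.

Lemma open_good_code j : open (good_code j).
Proof.
rewrite /good_code; case: unpickle => [[s t]|]; last exact: openT.
exact: open_good_some.
Qed.

Lemma universal_bigcap : pade_universal Omega L p q K m =
  \bigcap_j (@set_val _ (Yinf Omega L) @^-1` (good_code j)).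
Proof.
rewrite predeqE => f; split=> [/universalP H j _|H].
  by rewrite /preimage /= /good_code; case: unpickle => [[s t]|].
(* The division by t! turns closeness of jets into closeness of derivatives; 1/(2 t + 2) is the
   tolerance 1/(s + 1) at s = 2 t + 1. *)
apply/universalP => P t; have t0 : (0 : R) < t.*2.+2%:R^-1 / t`!%:R.
  by rewrite divr_gt0 ?invr_gt0 ?ltr0n ?fact_gt0.
have [s Hs] := rat_poly_dense t P K_compact t0.
have := H (pickle (s, t.*2.+1)) I; rewrite /preimage /= /good_code pickleK.
apply: good_some_le => // z l Kz lt.
apply: le_trans (jnorm_derivn lt (Hs z Kz)) _.
by rewrite mulrCA mulfV ?mulr1 // pnatr_eq0 -lt0n fact_gt0.
Qed.

End Universality.

(** * Density *)

Section DensityStep.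
Context {R : realType}.
Local Notation C := R[i].
Variables (Omega : set C) (L : nat -> set C) (p q : nat -> nat) (K : set C) (m : nat).
Hypothesis Omega_open : open Omega.
Hypothesis L_closure : forall n, closure (L n `&` Omega) = L n.
Hypothesis L_compact : forall n, compact (L n).
Hypothesis L_incr : forall i j, (i <= j)%N -> L i `<=` L j.
Hypothesis L_exhaust : forall A : set C, compact A -> A `<=` Omega -> exists n, A `<=` L n.
Hypothesis L_filled : forall n, filled (L n).
Hypothesis K_compact : compact K.
Hypothesis K_filled : filled K.
Hypothesis K_L : forall n, K `&` L n = set0.
Hypothesis p_oo : p @ \oo --> \oo.
Local Notation T := (Tinf Omega L).
Local Notation polyT h := (polyT Omega_open L_compact h).
Implicit Types (P g h A B : {poly C}) (f : T).

Lemma taylor_coef_polyT h n zeta : L n zeta ->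
  taylor_coef Omega (L n) (polyT h) zeta = fun k => (jet h zeta)`_k.
Proof.
move=> Lz; rewrite funeqE => k; rewrite /taylor_coef dext_polyT //.
by rewrite -jet_derivn mulrC mulKf // pnatr_eq0 -lt0n fact_gt0.
Qed.

Lemma taylor_sum_jet h zeta N : (size h <= N.+1)%N ->
  taylor_sum (fun k => (jet h zeta)`_k) zeta N = horner h.
Proof.
move=> sh; rewrite funeqE => z; rewrite -[in RHS](shift_jet h zeta) horner_comp.
rewrite hornerD hornerX hornerN hornerC (@horner_coef_wide _ N.+1) //.
by rewrite size_jet.
Qed.

(** For a polynomial of exact degree [p n] the errors on [L m] are zero, so only its closeness to P
    on K remains to be required. *)
Lemma good_some_polyT P g (s n : nat) : (s <= n)%N -> size g = (p n).+1 ->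
  (forall z l, K z -> (l <= s)%N -> cabs ((derivn l g).[z] - (derivn l P).[z]) < s.+1%:R^-1) ->
  good_some p q K m P s (polyT g).
Proof.
move=> sn sg gP; exists n => // l ls a df zeta Lz.
have s0 : (0 : R) < s.+1%:R^-1 by rewrite invr_gt0 ltr0n.
have -> : a zeta = fun k => (jet g zeta)`_k by exact: taylor_coef_polyT.
have g1 : ratfun (g, 1) = horner g by rewrite funeqE => z; rewrite /ratfun /= hornerC divr1.
rewrite taylor_sum_jet ?sg // !derive1n_horner_deriv.
have dfz z : L m z -> df l z = (derivn l g).[z] by move=> Lzz; rewrite /df dext_polyT.
split=> [|z Lzz|z Kz|z Lzz|z Kz].
- exact: in_D_poly.
- apply/pade_err_lt; rewrite pade_poly // hornerC oner_eq0; split=> //.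
  by rewrite g1 derive1n_horner_deriv dfz // subrr cabs0.
- apply/pade_err_lt; rewrite pade_poly // hornerC oner_eq0; split=> //.
  by rewrite g1 derive1n_horner_deriv; exact: gP.
- by rewrite dfz // subrr cabs0.
- exact: gP.
Qed.

(** The Runge polynomial for f on [L N] and P on K is perturbed to exact degree [p n]; the
    perturbation is small at order M on both sets. *)
Lemma polyT_dense_good P s f N (e : R) : rationals Omega L f -> 0 < e ->
  exists h, (forall n l, (n <= N)%N -> (l <= N)%N -> forall z, L n z ->
      cabs (dext Omega (L n) (polyT h) l z - dext Omega (L n) f l z) < e) /\
    good_some p q K m P s (polyT h).
Proof.
move=> [A [B [LB fAB]]] e0.
(* Order M covers both the seminorms up to N and the orders up to s on K; [L N] contains all [L n]
   with n <= N. *)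
pose M := maxn N s; pose X := L N.
pose e1 := Num.min e s.+1%:R^-1; have e10 : 0 < e1 by rewrite lt_min e0 invr_gt0 ltr0n.
have M0 : (0 : R) < M`!%:R by rewrite ltr0n fact_gt0.
(* M! converts coefficients of jets into derivatives, and two errors of size d then use up only half
   of e1. *)
pose d := e1 / M`!%:R / 4; have d0 : 0 < d by rewrite !divr_gt0.
have XB z : X z -> B.[z] != 0 by exact: LB.
have XK : X `&` K = set0 by rewrite setIC; exact: K_L.
have [g [gX gK]] := runge_union P (@L_compact N) K_compact XK (@L_filled N) K_filled
  (approx_qjet M A (@L_compact N) (@L_filled N) XB) d0.
have [n0 _ Hn0] := p_oo (nbhs_infty_ge (size g)).
(* [size g <= p n] puts the degree of g strictly below [p n], so the added leading term cannot
   cancel. *)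
pose n := maxn n0 s; have gn : (size g <= p n)%N by apply: Hn0; exact: leq_maxl.
have [r1 _ Xr] := compact_cabs_bounded (@L_compact N).
have [r2 _ Kr] := compact_cabs_bounded K_compact.
have [b b0 Hb] := jnorm_jet_bound M (ltr01 : 0 < (1 : R)) 'X^(p n) (Num.max r1 r2).
pose c : C := (d / b)%:C%C; have cE : cabs c = d / b by rewrite cabs_real ger0_norm // divr_ge0 ?ltW.
have c0 : c != 0 by rewrite -cabs_eq0 cE gt_eqF // divr_gt0.
pose h := g + c *: 'X^(p n).
have sh : size h = (p n).+1.
  by rewrite /h addrC size_polyDl size_scale // size_polyXn.
have hg z : X z \/ K z -> jnorm M 1 (jet h z - jet g z) <= d.
  move=> XKz; have zr : cabs z <= Num.max r1 r2.
    by rewrite le_max; case: XKz => [/Xr|/Kr] /ltW ->; rewrite ?orbT.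
  have -> : jet h z - jet g z = c *: jet 'X^(p n) z.
    by rewrite /h jetD addrC addKr /jet comp_polyZ.
  apply: le_trans (jnormZ _ ltr01 _ _) _; rewrite cE -ler_pdivlMl ?divr_gt0 //.
  by rewrite invf_div divfK ?gt_eqF // Hb.
have d4 : M`!%:R * (d + d) < e1.
  have -> : M`!%:R * (d + d) = e1 / 4 * 2 by rewrite /d; field; exact: lt0r_neq0.
  by lra.
have ee1 : e1 <= e by rewrite /e1 ge_min lexx.
have se1 : e1 <= s.+1%:R^-1 by rewrite /e1 ge_min lexx orbT.
exists h; split=> [k l kN lN z Lz|].
  have Xz : X z by exact: (L_incr kN).
  rewrite (@dext_rational _ _ _ Omega_open L_closure L_exhaust f A B k M) //;
    last by rewrite (leq_trans lN) // leq_maxl.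
  rewrite dext_polyT // -jet_derivn -mulrBr -coefB cabsM cabs_nat.
  have lM : (l <= M)%N by rewrite (leq_trans lN) // leq_maxl.
  have := jnorm_coef ltr01 (jet h z - qjet M A B z) lM; rewrite expr1n mulr1 => H1.
  have H2 : (l`!%:R : R) <= M`!%:R by rewrite ler_nat leq_fact.
  have H3 : jnorm M 1 (jet h z - qjet M A B z) <= d + d.
    rewrite -[jet h z](subrK (jet g z)) -addrA; apply: le_trans (jnormD _ ltr01 _ _) _.
    by rewrite lerD ?gX // hg //; left.
  apply: lt_le_trans ee1; apply: le_lt_trans d4.
  by apply: ler_pM; rewrite ?ler0n ?cabs_ge0 //; exact: le_trans H3.
apply: (@good_some_polyT _ _ _ n) => //; first exact: leq_maxr.
move=> z l Kz ls; apply: lt_le_trans se1; apply: le_lt_trans d4.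
apply: jnorm_derivn; first by rewrite (leq_trans ls) // leq_maxr.
rewrite -[jet h z](subrK (jet g z)) -addrA; apply: le_trans (jnormD _ ltr01 _ _) _.
by rewrite lerD ?gK // hg //; right.
Qed.

End DensityStep.

Section Components.
Context {T : topologicalType}.

(** Every component of B contains a whole component of A, hence the point a; so B has a single
    component. *)
Lemma connected_component_connected (A B : set T) a : connected A -> A a ->
  (forall x, B x -> exists2 y, A y & connected_component A y `<=` connected_component B x) ->
  connected B.
Proof.
move=> cA Aa H.
have aB x : B x -> connected_component B x a.
  move=> /H[y Ay]; apply; exists A => //; split=> //.
case: (pselect (exists x, B x)) => [[x Bx]|nB]; last first.
  by have -> : B = set0 by [rewrite predeqE => x; split => // Bx; case: nB; exists x]; exact: connected0.
have -> : B = connected_component B a.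
  rewrite predeqE => y; split=> [By|]; last exact: connected_component_sub.
  by apply: connected_component_sym; exact: aB.
exact: component_connected.
Qed.

End Components.

(** * Nested balls and density *)

Section Baire.
Context {R : realType}.
Local Notation C := R[i].
Variables (Omega : set C) (L : nat -> set C) (p q : nat -> nat) (K : set C) (m : nat).
Hypothesis Omega_open : open Omega.
Hypothesis L_closure : forall n, closure (L n `&` Omega) = L n.
Hypothesis L_compact : forall n, compact (L n).
Hypothesis L_incr : forall i j, (i <= j)%N -> L i `<=` L j.
Hypothesis L_exhaust : forall A : set C, compact A -> A `<=` Omega -> exists n, A `<=` L n.
Hypothesis L_filled : forall n, filled (L n).
Hypothesis K_compact : compact K.
Hypothesis K_filled : filled K.
Hypothesis K_L : forall n, K `&` L n = set0.
Hypothesis p_oo : p @ \oo --> \oo.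
Local Notation T := (Tinf Omega L).
Local Notation polyT h := (polyT Omega_open L_compact h).
Implicit Types (P g h A B : {poly C}) (f : T).
Local Notation good := (good_code (Omega := Omega) (L := L) p q K m).

(** Closed balls, so that limits of the nested construction stay inside. *)
Definition cball (c : T) (N : nat) (e : R) : set T := [set f | forall n l,
  (n <= N)%N -> (l <= N)%N -> forall z, L n z ->
  cabs (dext Omega (L n) f l z - dext Omega (L n) c l z) <= e].

Lemma cball_center c N (e : R) : 0 < e -> cball c N e c.
Proof. by move=> e0 n l _ _ z _; rewrite subrr cabs0 ltW. Qed.

Lemma cball_trans c d N M (e e' : R) : (N <= M)%N -> cball c N e d ->
  cball d M e' `<=` cball c N (e' + e).
Proof.
move=> NM cd f df n l nN lN z Lz.
apply: le_trans (cabs_triangle _ _ (dext Omega (L n) d l z)) _.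
by rewrite lerD // ?cd ?df // (leq_trans _ NM).
Qed.

(** A polynomial of the dense family close to r lies in the open set [good j], together with a small
    ball around it. *)
Lemma cball_refine j (r : T) N (e : R) : rationals Omega L r -> 0 < e ->
  exists h N' e', [/\ 0 < e', e' <= e / 2, (N < N')%N &
    cball (polyT h) N' e' `<=` cball r N e `&` good j].
Proof.
move=> rr e0; have e2 : 0 < e / 2 by rewrite divr_gt0.
have [h rh gh] : exists2 h, cball r N (e / 2) (polyT h) & good j (polyT h).
  have H P s := polyT_dense_good q m Omega_open L_closure L_compact L_incr L_exhaust
    L_filled K_compact K_filled K_L p_oo P s N rr e2.
  rewrite /good_code; case: (unpickle j : option (seq (rat * rat) * nat)) => [[s t]|].
    by have [h [rh gh]] := H (rat_poly s) t; exists h => // n l nN lN z Lz; exact/ltW/rh.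
  (* An undecodable code imposes nothing, but the new centre must still be a polynomial; the target
     0 serves. *)
  by have [h [rh _]] := H 0 0%N; exists h => // n l nN lN z Lz; exact/ltW/rh.
have : nbhs (polyT h) (good j).
  by apply: open_nbhs_nbhs; split => //; exact: open_good_code.
move=> /nbhs_Tinf[N1 [e1 e10 H1]].
(* The successor makes the order grow strictly along the nested sequence, while the radius is at
   least halved. *)
exists h, (maxn N1 N).+1, (Num.min (e / 2) (e1 / 2)).
split; rewrite ?lt_min ?e2 ?divr_gt0 ?ge_min ?lexx // ?ltnS ?leq_maxr //.
move=> f Hf; have le1 : Num.min (e / 2) (e1 / 2) <= e / 2 by rewrite ge_min lexx.
have le2 : Num.min (e / 2) (e1 / 2) <= e1 / 2 by rewrite ge_min lexx orbT.
split.
  rewrite [e]splitr; apply: (cball_trans (leqnn N) rh) => n l nN lN z Lz.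
  by apply: le_trans le1; apply: Hf => //; rewrite (leq_trans _ (leqW (leq_maxr _ _))).
apply: H1 => n l nN lN z Lz; apply: (@le_lt_trans _ _ (e1 / 2)); last by lra.
by apply: le_trans le2; apply: Hf => //; rewrite (leq_trans _ (leqW (leq_maxl _ _))).
Qed.

(** The centres are polynomials, Cauchy in every seminorm as the orders tend to infinity and the
    radii to 0; their limit lies in [Yinf] and in all the balls. *)
Lemma nested_cballs (r : T) N (e : R) : rationals Omega L r -> 0 < e ->
  exists f : T, [/\ Yinf Omega L f, cball r N e f & forall j, good j f].
Proof.
move=> rr e0.
pose St := ({poly C} * nat * R)%type.
pose ball (x : St) := cball (polyT x.1.1) x.1.2 x.2.
(* Positivity of the radius stands inside the existential so that choice yields a total map; a dummy
   state covers the other case. *)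
have step (jx : nat * St) : exists y : St, 0 < jx.2.2 ->
    [/\ 0 < y.2, y.2 <= jx.2.2 / 2, (jx.2.1.2 < y.1.2)%N & ball y `<=` ball jx.2 `&` good jx.1].
  case: jx => j [[h M] d] /=; case: (pselect (0 < d)) => [d0|nd]; last by exists (0, 0%N, 0).
  have [h' [M' [d' H]]] := cball_refine j M (polyT_rational Omega_open L_compact h) d0.
  by exists (h', M', d').
have [F HF] := choice step.
have [h0 [N0 [d0 [d00 _ _ B0]]]] := cball_refine 0 N rr e0.
pose fix x j := if j is j'.+1 then F (j', x j') else (h0, N0, d0) : St.
have x0 j : 0 < (x j).2 by elim: j => //= j IH; have [] := HF (j, x j) IH.
have xS j : [/\ (x j.+1).2 <= (x j).2 / 2, ((x j).1.2 < (x j.+1).1.2)%N &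
    ball (x j.+1) `<=` ball (x j) `&` good j] by have [] := HF (j, x j) (x0 j).
have xN j : (j <= (x j).1.2)%N.
  by elim: j => // j IH; apply: leq_ltn_trans IH _; have [] := xS j.
have xB i j : (j <= i)%N -> ball (x i) `<=` ball (x j).
  move=> ji; rewrite -(subnK ji); elim: (i - j)%N => // k IH f.
  by rewrite addSn; have [_ _ H] := xS (k + j)%N => /H[/IH].
have x2 j : (x j).2 <= d0 * 2^-1 ^+ j.
  elim: j => [|j IH]; first by rewrite mulr1.
  have [H _ _] := xS j; rewrite exprSr mulrA; apply: le_trans H _.
  by rewrite ler_pM2r // invr_gt0.
have small n (d : R) : 0 < d -> exists J, (n <= J)%N /\ (x J).2 <= d.
  move=> dp; have half1 : `|2^-1 : R| < 1.
    by rewrite ger0_norm ?invr_ge0 // invf_lt1 // ltr1n.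
  have /cvgrPdist_le/(_ d dp)[J _ HJ] := cvg_geometric d0 half1.
  exists (maxn n J); split; first exact: leq_maxl.
  have := HJ _ (leq_maxr n J); rewrite /= sub0r normrN => /(le_trans (ler_norm _)).
  exact: le_trans (x2 _).
pose h j := (x j).1.1.
have hball i j : (j <= i)%N -> ball (x j) (polyT (h i)).
  by move=> ji; apply: (xB _ _ ji); exact: cball_center.
have hd i j n l z : (j <= i)%N -> (n <= j)%N -> (l <= j)%N -> L n z ->
    cabs ((derivn l (h i)).[z] - (derivn l (h j)).[z]) <= (x j).2.
  move=> ji nj lj Lz; rewrite -!(dext_polyT Omega_open L_compact L_closure _ _ Lz).
  by apply: hball ji _ _ _ _ _ Lz; apply: leq_trans (xN j).
have hc n l (d : R) : 0 < d -> exists J, forall i j, (J <= i)%N -> (J <= j)%N ->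
    forall z, L n z -> cabs ((derivn l (h i)).[z] - (derivn l (h j)).[z]) <= d.
  move=> dp; have [J [nJ Jd]] := small (maxn n l) _ (divr_gt0 dp (ltr0Sn _ 1)).
  move: nJ; rewrite geq_max => /andP[nJ lJ].
  exists J => i j Ji Jj z Lz.
  apply: le_trans (cabs_triangle _ _ (derivn l (h J)).[z]) _.
  rewrite [X in _ + X]cabsB [d]splitr lerD //; apply: le_trans Jd; exact: (hd _ _ n).
have [f Hf] := uniform_limit Omega_open L_compact L_closure L_exhaust hc.
(* The later centres all lie in the closed ball [x j], hence so does their limit. *)
have fB j : ball (x j) f.
  move=> n l nN lN z Lz; apply/ler_addgt0Pr => d dp.
  have [J HJ] := Hf n l d dp; have jJ := leq_maxr J j.
  apply: le_trans (cabs_triangle _ _ (derivn l (h (maxn J j))).[z]) _.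
  rewrite addrC lerD ?HJ ?leq_maxl //.
  by rewrite -!(dext_polyT Omega_open L_compact L_closure _ _ Lz); exact: hball jJ _ _ nN lN _ Lz.
exists f; split.
- move=> A /nbhs_Tinf[M [d dp HA]].
  have [J [MJ Jd]] := small M _ (divr_gt0 dp (ltr0Sn _ 1)).
  exists (polyT (h J)); split; first exact: polyT_rational.
  apply: HA => n l nM lM z Lz; rewrite cabsB; apply: (@le_lt_trans _ _ (d / 2)); last by lra.
  apply: le_trans Jd; apply: fB => //; apply: leq_trans (leq_trans MJ (xN J)) => //.
- by have [] := B0 f (fB 0%N).
- by move=> j; have [_ _ /(_ f (fB j.+1))[]] := xS j.
Qed.

(** A nonempty open subset of [Yinf] is the trace of an open V, which meets the rational functions
    by definition of the closure; the nested balls start at such a function. *)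
Lemma dense_universal : dense (pade_universal Omega L p q K m).
Proof.
move=> O [f0 Of0] oO.
have [V oV VO] : exists2 V : set T, open V & @set_val _ (Yinf Omega L) @^-1` V = O by exact: oO.
have Vf0 : nbhs (set_val f0 : T) V by apply: open_nbhs_nbhs; split => //; move: Of0; rewrite -VO.
have [r [rr Vr]] := set_valP f0 V Vf0.
have /nbhs_Tinf[N [e e0 HV]] : nbhs r V by exact: open_nbhs_nbhs.
(* Half the radius, since [cball] is closed and V contains only the open ball. *)
have [f [Yf rf gf]] := nested_cballs N rr (divr_gt0 e0 (ltr0Sn _ 1)).
pose f1 : Yinf Omega L := exist _ f (mem_set Yf).
exists f1; split.
  rewrite -VO; apply: HV => n l nN lN z Lz; apply: le_lt_trans (rf n l nN lN z Lz) _; lra.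
rewrite universal_bigcap // => j _; exact: gf.
Qed.

Lemma Gdelta_universal : Gdelta (pade_universal Omega L p q K m).
Proof.
exists (fun j => @set_val _ (Yinf Omega L) @^-1` good j); last exact: universal_bigcap.
by move=> j; exists (good j) => //; exact: open_good_code.
Qed.

End Baire.

(** * Existence, density and the G-delta property *)

Theorem theorem8p1 (R : realType) (p q : nat -> nat)
    (Omega : set R[i]) (L : nat -> set R[i]) (K : set R[i]) (m : nat)
  (p_oo : p @ \oo --> \oo)
  (Omega_open : open Omega)
  (Omega_conn : connected (sphere_compl (closure Omega)))
  (L_incr : forall i j, (i <= j)%N -> L i `<=` L j)
  (L_compact : forall n, compact (L n))
  (L_sub : forall n, L n `<=` closure Omega)
  (L_closure : forall n, closure (L n `&` Omega) = L n)
  (L_components : forall n x, sphere_compl (L n) x ->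
     exists2 y, sphere_compl (closure Omega) y &
       connected_component (sphere_compl (closure Omega)) y
         `<=` connected_component (sphere_compl (L n)) x)
  (L_exhaust : forall A : set R[i], compact A -> A `<=` Omega ->
     exists n, A `<=` L n)
  (K_compact : compact K)
  (K_conn : connected (~` K))
  (K_L : forall n, K `&` L n = set0) :
  [/\ exists f : Yinf Omega L, pade_universal Omega L p q K m f,
      dense (pade_universal Omega L p q K m) &
      Gdelta (pade_universal Omega L p q K m)].
Proof.
(* Each component of the complement of [L n] contains the whole connected complement of the closure
   of Omega, infinity included; so there is only one. *)
have L_filled n : filled (L n).
  apply: connected_sphere_compl_filled (L_compact n) _.
  by apply: (connected_component_connected Omega_conn _ (@L_components n)); left.
have K_filled := connected_complement_filled K_compact K_conn.
have D : dense (pade_universal Omega L p q K m) by exact: dense_universal.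
split => //; last exact: Gdelta_universal.
(* Density yields a universal function once [Yinf] is inhabited; the zero polynomial belongs to
   it. *)
have [|f [_ Uf]] := D setT _ openT; last by exists f.
have Y0 : Yinf Omega L (polyT Omega_open L_compact 0).
  by apply: subset_closure; exact: polyT_rational.
move: (polyT _ _ 0) Y0 => g Yg.
by pose g0 : Yinf Omega L := exist _ g (mem_set Yg); exists g0.
Qed.
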